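(* Let $J\ge2$ and let $X=(X_n)_{n\le N}$ come from the $J$-state hidden Markov model described in the context with $\mu$ Lebesgue measure on $\mathbb R$, with parameters satisfying Assumptions A2', A3 and A4 (for some $s>0$). Let $r_N=(N/\log N)^{-s/(1+2s)}$ and suppose $L_0=L_0(N)\to\infty$ with $L_0^{\max(5,(J+3)/2)}r_N\to0$. Then there exist estimators $\hat f_1,\dots,\hat f_J$ (functions of $X$ which are continuous functions on $\mathbb R$) and a permutation $\tau$ of $\{1,\dots,J\}$ such that, for some $C>0$ and each $j\le J$, $$\Pi_H\big(\|\hat f_j-f_{\tau(j)}\|_\infty\ge CL_0^5r_N\big)\to0,$$ and, for some $C'>0$ and each $j\le J$, $E_H\|\hat f_j-f_{\tau(j)}\|_\infty\le C'L_0^5r_N$.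
   Context: $J$-state hidden Markov model: $\theta=(\theta_n)_{n\le N}$ is a Markov chain on $\{1,\dots,J\}$ with transition matrix $Q$ and initial distribution $\pi$; conditionally on $\theta$, the $X_n$ are independent with densities $f_{\theta_n}$ with respect to $\mu$. $\Pi_H,E_H$ denote the law and expectation for $H=(Q,\pi,f_1,\dots,f_J)$. Assumption A2': $Q$ has full rank, the chain is irreducible and aperiodic, and $\theta_1$ follows the invariant distribution. Assumption A3: $f_1,\dots,f_J$ are linearly independent. Assumption A4: $f_1,\dots,f_J\in C^s(\mathbb R)$, where, with $C^0(\mathbb R)$ the bounded continuous functions, for $s\in(0,1)$ $C^s(\mathbb R)=\{f\in C^0:\sup_{0<|x-y|\le1}|f(x)-f(y)|/|x-y|^s<\infty\}$, and for $s\ge1$ $C^s(\mathbb R)=\{f: f^{(\lfloor s\rfloor)}\in C^{s-\lfloor s\rfloor}(\mathbb R)\}$ (with the usual Hölder norms). *)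

(* Defs.v *)
From HB Require Import structures.
From mathcomp Require Import all_boot all_order all_algebra.
From mathcomp Require Import all_classical all_reals all_analysis.
From mathcomp Require Import measurable_realfun.
Set Implicit Arguments. Unset Strict Implicit. Unset Printing Implicit Defensive.
Import Order.TTheory GRing.Theory Num.Theory.
Import numFieldNormedType.Exports.
Local Open Scope classical_set_scope.
Local Open Scope ring_scope.

Section Defs.
Variable R : realType.

Definition bounded_continuous (f : R -> R) : Prop :=
  continuous f /\ exists M : R, forall x, `|f x| <= M.

Definition holder_low (a : R) (f : R -> R) : Prop :=
  bounded_continuous f /\
  (0 < a -> exists M : R, forall x y, 0 < `|x - y| <= 1 ->
      `|f x - f y| <= M * (`|x - y| `^ a)).

Definition holder (s : R) (f : R -> R) : Prop :=
  let k := Num.truncn s in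
  (forall i : nat, (i < k)%N -> forall x, derivable (derive1n i f) x 1) /\
  holder_low (s - k%:R) (derive1n k f).

Definition supnorm (g : R -> R) : \bar R :=
  ereal_sup [set (`|g x|)%:E | x in [set: R]].

Definition mpow (J : nat) (Q : 'M[R]_J) (n : nat) : 'M[R]_J :=
  iter n (fun M => M *m Q) 1%:M.

Definition stochastic_matrix (J : nat) (Q : 'M[R]_J) : Prop :=
  (forall i j, 0 <= Q i j) /\ (forall i, \sum_j Q i j = 1).

Definition prob_vector (J : nat) (pi : 'I_J -> R) : Prop :=
  (forall i, 0 <= pi i) /\ \sum_i pi i = 1.

Definition irreducible_chain (J : nat) (Q : 'M[R]_J) : Prop :=
  forall i j : 'I_J, exists n : nat, (0 < n)%N /\ 0 < mpow Q n i j.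

(** aperiodic: every state has period 1, i.e. the gcd of
    {n >= 1 : Q^n(i,i) > 0} is 1 (no d > 1 divides all such n). *)
Definition aperiodic_chain (J : nat) (Q : 'M[R]_J) : Prop :=
  forall (i : 'I_J) (d : nat), (1 < d)%N ->
    exists n : nat, [/\ (0 < n)%N, 0 < mpow Q n i i & ~~ (d %| n)%N].

Definition invariant_distribution (J : nat) (Q : 'M[R]_J) (pi : 'I_J -> R) :=
  forall j, \sum_i pi i * Q i j = pi j.

Definition assumption_A2' (J : nat) (Q : 'M[R]_J) (pi : 'I_J -> R) : Prop :=
  [/\ \rank Q = J, irreducible_chain Q, aperiodic_chain Q
    & invariant_distribution Q pi].

Definition assumption_A3 (J : nat) (f : 'I_J -> R -> R) : Prop :=
  forall c : 'I_J -> R, (forall x, \sum_j c j * f j x = 0) -> forall j, c j = 0.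

Definition assumption_A4 (J : nat) (s : R) (f : 'I_J -> R -> R) : Prop :=
  forall j, holder s (f j).

Definition is_density_lebesgue (f : R -> R) : Prop :=
  [/\ measurable_fun [set: R] f, (forall x, 0 <= f x)
    & (\int[lebesgue_measure]_x (f x)%:E = 1)%E].

(** (theta_n, X_n)_{n >= 0} on the probability space (Omega, P) is a
    hidden Markov model with parameters (Q, pi, f): every finite-dimensional
    joint law of (theta_0..theta_{n-1}, X_0..X_{n-1}) is the HMM law, i.e.
    P(theta_k = t_k, X_k in B_k, k < n)
      = pi(t_0) prod_{k<n-1} Q(t_k,t_{k+1}) prod_{k<n} int_{B_k} f_{t_k} dx.
    (Indices start at 0 instead of 1.) *)
Definition is_HMM d (Omega : measurableType d) (P : probability Omega R)
    (J : nat) (Q : 'M[R]_J) (pi : 'I_J -> R) (f : 'I_J -> R -> R)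
    (theta : nat -> Omega -> 'I_J) (X : nat -> Omega -> R) : Prop :=
  (forall n, measurable_fun [set: Omega] (X n)) /\
  (forall n i, measurable (theta n @^-1` [set i])) /\
  forall (n : nat) (t : nat -> 'I_J) (B : nat -> set R),
    (0 < n)%N -> (forall k, measurable (B k)) ->
    P [set w | forall k, (k < n)%N -> theta k w = t k /\ B k (X k w)] =
    (pi (t 0%N) * (\prod_(k < n.-1) Q (t k) (t k.+1)) *
     \prod_(k < n) fine (\int[lebesgue_measure]_(x in B k) (f (t k) x)%:E))%:E.

Definition rate (s : R) (N : nat) : R :=
  (N%:R / ln N%:R) `^ (- (s / (1 + 2 * s))).

End Defs.

(* Main.v *)
(* For thresholds a_1, ..., a_J put O_jl = F_j(a_l), with F_j the distribution
   function of f_j.  The law of three consecutive observations gives the matrices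
   S(B) = (P(X_0 < a_l, X_1 in B, X_2 < a_m))_lm = A diag(int_B f_j) D, where
   A = O^T diag(pi) Q and D = Q O.  By linear independence of the f_j some rational
   thresholds make O, hence A and D, invertible, and some integer t makes the numbers
   lam_j = sum_k t^k F_j(a_k) distinct.  The pair S(R) = A D and
   sum_k t^k S(]-oo, a_k[) = A diag(lam) D is then simultaneously diagonalizable: with
   W_j = D^-1 E_jj A^-1 one gets tr(W_j S(B)) = int_B f_j, and W_j depends stably on
   the two matrices.  The estimator takes the first pair (a, t), in an enumeration,
   for which the empirical matrices are approximately diagonalized with a spectral
   gap sqrt r_N; with high probability this is the first separating pair, whatever
   the parameters.  The densities are recovered by replacing S(B) by a local
   polynomial smoothing, exact on polynomials of degree floor(s), of the empirical
   frequencies of cells of width h with h^s = r_N.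

   The empirical frequencies concentrate through exponential moments of the number
   of hits by disjoint triples: if v solves the Poisson equation for Q^3, then
   1 + c v is a supersolution for the transition operator tilted by c.
   Cells of mass below N^-8 are controlled by the probability of two hits, so the
   union bound over all cells sums to O(N^-3), which also absorbs the
   polynomial bound on the error off the good event.  The resulting rate is r_N,
   and L_0 >= 1 eventually. *)

Require Import Defs.
From HB Require Import structures.
From mathcomp Require Import all_boot all_order all_algebra.
From mathcomp Require Import all_classical all_reals all_analysis.
From mathcomp Require Import measurable_realfun.
From mathcomp Require Import perm qpoly.
From mathcomp Require Import ring lra zify.
Import Order.TTheory GRing.Theory Num.Theory.
Import numFieldNormedType.Exports.
Local Open Scope classical_set_scope.
Local Open Scope ring_scope.

Set Implicit Arguments.
Unset Strict Implicit.

(** * Ergodicity of the chain *)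

(** The estimator is fixed before [Q], [pi] and [f], so its tuning may not involve their constants
    (spectral gap, condition numbers, size of the weights). Each of them is replaced by a power of
    [N / ln N] that eventually passes it. Write e for [scale], so that h = e^4. Candidate
    eigenvalues and weights are only required to be at most 1/e, which in the end admits the true
    ones. Passing from empirical to true matrices then costs a factor e^-2, and this is why the
    finitely many moments are controlled at precision e^2 r_N. The gap sqrt r_N falls below the true
    gap, yet exceeds every multiple of r_N, so coinciding eigenvalues are detected. The identity h
    r_N^2 N = ln N serves both deviation bounds: cells have variance of order h and are known up to
    h r_N, moments have variance of order 1 and are known up to e^2 r_N. Between disjoint triples
    the chain moves by Q^3, which aperiodicity keeps irreducible. Listing the eigenvalues in
    increasing order fixes the labelling, so [tau] depends on the parameters alone. *)

Section chain.
Variables (R : realType) (J : nat).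
Implicit Types (Q : 'M[R]_J) (pi : 'I_J -> R) (u v : 'I_J -> R).

Definition trans Q u : 'I_J -> R := fun i => \sum_j Q i j * u j.

Lemma mpowS Q n : mpow Q n.+1 = mpow Q n *m Q.
Proof. by []. Qed.

Lemma mpowD Q m n : mpow Q (m + n) = mpow Q m *m mpow Q n.
Proof.
elim: n => [|n IH]; first by rewrite addn0 /mpow /= mulmx1.
by rewrite addnS !mpowS IH mulmxA.
Qed.

Lemma mpow1 Q : mpow Q 1 = Q.
Proof. by rewrite mpowS /mpow /= mul1mx. Qed.

Lemma trans_iter Q n u i : iter n (trans Q) u i = \sum_j mpow Q n i j * u j.
Proof.
elim: n i => [|n IH] i.
  rewrite (bigD1 i) //= /mpow /= mxE eqxx mul1r big1 ?addr0// => j ji.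
  by rewrite mxE eq_sym (negPf ji) mul0r.
rewrite iterS -[n.+1]add1n mpowD mpow1 /trans.
under eq_bigr do rewrite IH mulr_sumr.
rewrite exchange_big /=; apply: eq_bigr => k _.
by rewrite mxE mulr_suml; apply: eq_bigr => j _; rewrite mulrA.
Qed.

Section stochastic.
Variables (Q : 'M[R]_J) (pi : 'I_J -> R).
Hypotheses (Qs : stochastic_matrix Q) (ps : prob_vector pi).

Lemma trans_ge0 u : (forall i, 0 <= u i) -> forall i, 0 <= trans Q u i.
Proof. by move=> u0 i; apply: sumr_ge0 => j _; apply: mulr_ge0 => //; apply Qs.1. Qed.

Lemma le_trans_fun u v : (forall i, u i <= v i) ->
  forall i, trans Q u i <= trans Q v i.
Proof. by move=> uv i; apply: ler_sum => j _; apply: ler_wpM2l => //; apply Qs.1. Qed.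

Lemma trans_cst a i : trans Q (fun=> a) i = a.
Proof. by rewrite /trans -mulr_suml (Qs.2 i) mul1r. Qed.

Lemma iter_trans_cst n a i : iter n (trans Q) (fun=> a) i = a.
Proof.
by elim: n i => //= n IH i; rewrite -[RHS](trans_cst a i); apply: eq_bigr => j _; rewrite IH.
Qed.

Lemma mpow_ge0 n i j : 0 <= mpow Q n i j.
Proof.
elim: n i j => [|n IH] i j; first by rewrite /mpow /= mxE; case: eqP.
by rewrite mpowS mxE; apply: sumr_ge0 => k _; apply: mulr_ge0 => //; apply Qs.1.
Qed.

Lemma mpow_gt0_mul m n i k j :
  0 < mpow Q m i k -> 0 < mpow Q n k j -> 0 < mpow Q (m + n) i j.
Proof.
move=> ik kj; rewrite mpowD mxE (bigD1 k) //= ltr_pwDl //; first exact: mulr_gt0.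
by apply: sumr_ge0 => l _; apply: mulr_ge0; exact: mpow_ge0.
Qed.

Lemma mpow_row_sum n i : \sum_j mpow Q n i j = 1.
Proof.
have := trans_iter Q n (fun=> 1) i.
under eq_bigr do rewrite mulr1.
by move=> <-; exact: iter_trans_cst.
Qed.

Hypotheses (irr : irreducible_chain Q) (ape : aperiodic_chain Q).

(* A return time prime to 3 corrects the length of a path modulo 3. *)
Lemma mpow3_gt0 i j : exists m, 0 < mpow Q (3 * m) i j.
Proof.
have [n [_ nij]] := irr i j; have [c [c0 cjj ndvd]] := @ape j 3%N isT.
have step a : 0 < mpow Q (n + a * c) i j.
  elim: a => [|a IH]; first by rewrite mul0n addn0.
  by rewrite mulSn [(c + _)%N]addnC addnA; exact: mpow_gt0_mul IH cjj.
have [a /dvdnP[m am]] : exists a, (3 %| n + a * c)%N.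
  have c3 : (c %% 3 = 1 \/ c %% 3 = 2)%N by lia.
  have n3 : (n %% 3 = 0 \/ n %% 3 = 1 \/ n %% 3 = 2)%N by lia.
  case: c3 => c3; case: n3 => [n3|[n3|n3]];
    [exists 0%N|exists 2%N|exists 1%N|exists 0%N|exists 1%N|exists 2%N]; lia.
by exists m; rewrite mulnC -am.
Qed.

(** Maximum principle: at a maximiser [k] the value [u k] is an average of [u] weighted by row [k]
    of [Q^(3m)], so [u] equals it at every state charged by that row. By [mpow3_gt0] every [j] is
    charged for some [m]. *)
Lemma harmonic_cst u : (forall i, iter 3 (trans Q) u i = u i) ->
  forall i j, u i = u j.
Proof.
move=> h.
have hm m i : iter (3 * m) (trans Q) u i = u i.
  elim: m i => [|m IH] i; first by rewrite muln0.
  rewrite mulnS iterD.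
  have -> : iter (3 * m) (trans Q) u = u by apply/funext => k; exact: IH.
  exact: h.
suff le i j : u i <= u j by move=> i j; apply/eqP; rewrite eq_le !le.
pose k := [arg max_(k > i) u k]%O.
have uk l : u l <= u k by rewrite /k; case: Order.TotalTheory.arg_maxP => //= x _; exact.
have [m kj] := mpow3_gt0 k j.
have := hm m k; rewrite trans_iter => e.
have : \sum_l mpow Q (3 * m) k l * (u k - u l) = 0.
  under eq_bigr do rewrite mulrBr.
  by rewrite sumrB -mulr_suml mpow_row_sum mul1r e subrr.
move/eqP; rewrite psumr_eq0; last first.
  by move=> l _; rewrite mulr_ge0 ?mpow_ge0 ?subr_ge0.
move/allP/(_ j (mem_index_enum _)) => /=.
rewrite mulf_eq0 (gt_eqF kj) /= subr_eq0 => /eqP <-; exact: uk.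
Qed.

Hypothesis inv : invariant_distribution Q pi.

Lemma pi_trans u : \sum_i pi i * trans Q u i = \sum_i pi i * u i.
Proof.
under eq_bigr do rewrite mulr_sumr.
rewrite exchange_big /=; apply: eq_bigr => j _.
by rewrite -(inv j) mulr_suml; apply: eq_bigr => i _; rewrite mulrA.
Qed.

(** [pi] is invariant under every power of [Q]; some state has positive mass, and irreducibility
    carries part of it to [j]. *)
Lemma invariant_gt0 j : 0 < pi j.
Proof.
have [i pi0] : exists i, 0 < pi i.
  apply: contrapT => /forallNP h.
  have := ps.2; rewrite big1 => [/esym/eqP|i _]; first by rewrite oner_eq0.
  apply/eqP; rewrite eq_le (ps.1 i) andbT leNgt; apply/negP; exact: h.
have [n [_ nij]] := irr i j.
have <- : \sum_i pi i * mpow Q n i j = pi j.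
  elim: n j {nij} => [|n IH] j.
    rewrite (bigD1 j) //= /mpow /= mxE eqxx mulr1 big1 ?addr0// => k kj.
    by rewrite mxE (negPf kj) mulr0.
  under eq_bigr do rewrite mpowS mxE mulr_sumr.
  rewrite exchange_big /= -[RHS](inv j); apply: eq_bigr => k _.
  by rewrite -IH mulr_suml; apply: eq_bigr => l _; rewrite mulrA.
rewrite (bigD1 i) //= ltr_pwDl ?mulr_gt0// sumr_ge0// => k _.
by rewrite mulr_ge0 ?mpow_ge0//; exact: ps.1.
Qed.

Definition poisson_bound K : Prop :=
  forall (g : 'I_J -> R) (b : R), \sum_i pi i * g i = 0 -> (forall i, `|g i| <= b) ->
  exists v, (forall i, v i - iter 3 (trans Q) v i = g i) /\
            (forall i, `|v i| <= K * b).

(* [I - Q^3 + 1 pi^T] is invertible: an element of its kernel is [pi]-centred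
   and harmonic. *)
Lemma poisson_solution : exists2 K : R, 1 <= K & poisson_bound K.
Proof.
pose A : 'M[R]_J := \matrix_(i, j) (pi j + (i == j)%:R - mpow Q 3 i j).
have Aev (v : 'cV[R]_J) i : (A *m v) i 0 =
    \sum_j pi j * v j 0 + v i 0 - iter 3 (trans Q) (fun j => v j 0) i.
  rewrite mxE trans_iter.
  under eq_bigr do rewrite mxE mulrBl mulrDl.
  rewrite sumrB big_split /=; congr (_ + _ - _).
  rewrite (bigD1 i) //= eqxx mul1r big1 ?addr0// => j ji.
  by rewrite eq_sym (negPf ji) mul0r.
have piA (v : 'cV[R]_J) : \sum_i pi i * (A *m v) i 0 = \sum_i pi i * v i 0.
  under eq_bigr do rewrite Aev mulrBr mulrDr.
  rewrite sumrB big_split /= -mulr_suml ps.2 mul1r !pi_trans.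
  by rewrite addrK.
have Au : A \in unitmx.
  rewrite -unitmx_tr -row_free_unit -kermx_eq0; apply/eqP/row_matrixP => i.
  rewrite row0; set r := row i _.
  have rA : A *m r^T = 0.
    apply: trmx_inj; rewrite trmx_mul trmxK trmx0 /r -row_mul mulmx_ker.
    by rewrite row0.
  have pir : \sum_i pi i * r^T i 0 = 0.
    rewrite -piA rA big1// => k _; by rewrite mxE mulr0.
  have har k : iter 3 (trans Q) (fun j => r^T j 0) k = r^T k 0.
    by have := Aev r^T k; rewrite rA mxE pir add0r => /esym/eqP; rewrite subr_eq0 => /eqP.
  have cst := harmonic_cst har.
  apply/rowP => k; rewrite [RHS]mxE.
  have <- : r^T k 0 = r 0 k by rewrite mxE.
  rewrite -pir -[LHS]mul1r -ps.2 mulr_suml; apply: eq_bigr => l _.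
  by rewrite (cst k l).
pose B := invmx A.
pose K := 1 + \sum_i \sum_j `|B i j|.
have K1 : 1 <= K by rewrite lerDl sumr_ge0// => i _; rewrite sumr_ge0.
exists K => // g b pg gb.
pose v : 'cV[R]_J := B *m (\col_i g i).
have Av : A *m v = \col_i g i by rewrite mulKVmx.
have piv : \sum_i pi i * v i 0 = 0.
  by rewrite -piA Av -[RHS]pg; apply: eq_bigr => i _; rewrite mxE.
exists (fun i => v i 0); split=> i.
  by have := Aev v i; rewrite Av mxE piv add0r => ->.
have b0 : 0 <= b := le_trans (normr_ge0 _) (gb i).
rewrite mxE (le_trans (ler_norm_sum _ _ _))//.
apply: (@le_trans _ _ (\sum_j `|B i j| * b)).
  by apply: ler_sum => j _; rewrite normrM mxE ler_wpM2l.
rewrite -mulr_suml ler_wpM2r//.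
rewrite /K [X in _ <= _ + X](bigD1 i) //= addrCA lerDl addr_ge0// sumr_ge0// => k _.
by rewrite sumr_ge0.
Qed.

End stochastic.
End chain.

(** * Law of the observations *)

Definition mass (R : realType) (g : R -> R) (B : set R) : R :=
  fine (\int[lebesgue_measure]_(x in B) (g x)%:E).

(* The likelihood of the observation sets [l] as a function of the first state. *)
Fixpoint lik (R : realType) (J : nat) (Q : 'M[R]_J) (f : 'I_J -> R -> R)
    (l : seq (set R)) : 'I_J -> R :=
  if l is B :: l' then fun i => mass (f i) B * trans Q (lik Q f l') i
  else fun=> 1.

Definition window (R : realType) (T : Type) (X : nat -> T -> R) (m : nat)
    (l : seq (set R)) : set T :=
  [set w | forall k, (k < size l)%N -> nth setT l k (X (m + k)%N w)].

Lemma window_nil (R : realType) (T : Type) (X : nat -> T -> R) m :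
  window X m [::] = setT.
Proof. by apply/seteqP; split. Qed.

Lemma window_cons (R : realType) (T : Type) (X : nat -> T -> R) m B l :
  window X m (B :: l) = [set w | B (X m w)] `&` window X m.+1 l.
Proof.
apply/seteqP; split=> w /=.
  move=> h; split; first by have := h 0%N isT; rewrite addn0.
  by move=> k kl; have := h k.+1 kl; rewrite addnS.
move=> [h0 h] [_|k kl] /=; first by rewrite addn0.
by rewrite addnS; exact: h.
Qed.

Section mass.
Variables (R : realType) (g : R -> R).
Hypothesis dg : is_density_lebesgue g.
Implicit Types A B : set R.

Lemma mass_integral B : measurable B ->
  (\int[lebesgue_measure]_(x in B) (g x)%:E = (mass g B)%:E)%E.
Proof.
case: dg => mg g0 g1 mB; rewrite /mass fineK// ge0_fin_numE; last first.
  by apply: integral_ge0 => x _; rewrite lee_fin.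
rewrite (@le_lt_trans _ _ 1%E) ?ltry// -g1.
apply: ge0_subset_integral => //; first exact/measurable_EFinP.
by move=> x _; rewrite lee_fin.
Qed.

Lemma mass_ge0 B : 0 <= mass g B.
Proof. by rewrite /mass fine_ge0// integral_ge0// => x _; rewrite lee_fin; case: dg. Qed.

Lemma mass_setT : mass g setT = 1.
Proof. by rewrite /mass; case: dg => _ _ ->. Qed.

Lemma le_mass A B : measurable A -> measurable B -> A `<=` B ->
  mass g A <= mass g B.
Proof.
move=> mA mB AB; rewrite -lee_fin -!mass_integral//.
case: dg => mg g0 _; apply: ge0_subset_integral => //; last by move=> x _; rewrite lee_fin.
by apply/measurable_EFinP; apply: measurable_funTS.
Qed.

Lemma mass_le1 B : measurable B -> mass g B <= 1.
Proof. by move=> mB; rewrite -mass_setT; exact: le_mass. Qed.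

End mass.

Section law.
Variables (R : realType) (d : measure_display) (Omega : measurableType d).
Variables (P : probability Omega R) (J : nat) (Q : 'M[R]_J) (pi : 'I_J -> R).
Variables (f : 'I_J -> R -> R) (theta : nat -> Omega -> 'I_J).
Variable X : nat -> Omega -> R.
Hypotheses (Qs : stochastic_matrix Q) (ps : prob_vector pi).
Hypothesis HMM : is_HMM P Q pi f theta X.

Let mX n : measurable_fun setT (X n). Proof. by case: HMM. Qed.
Let mtheta n i : measurable (theta n @^-1` [set i]).
Proof. by case: HMM => _ []. Qed.

Lemma measurable_window m l : (forall B, B \in l -> measurable B) ->
  measurable (window X m l).
Proof.
elim: l m => [|B l IH] m mB; first by rewrite window_nil.
rewrite window_cons; apply: measurableI; last first.
  by apply: IH => C Cl; apply: mB; rewrite in_cons Cl orbT.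
rewrite -[X in measurable X]setTI; apply: mX => //.
by apply: mB; rewrite in_cons eqxx.
Qed.

Lemma sum_state n (E : set Omega) : measurable E ->
  (P E = \sum_(j < J) P (E `&` theta n @^-1` [set j]))%E.
Proof.
move=> mE; rewrite -measure_bigsetU_ord.
- congr (P _); rewrite -bigcup_seq; apply/seteqP; split=> w /=.
    by move=> Ew; exists (theta n w) => //=; exact: mem_index_enum.
  by case=> i _ [].
- by move=> i; exact: measurableI.
- by move=> i j _ _ [w [[_ <-] [_ <-]]].
Qed.

Definition prefix n (t : nat -> 'I_J) (B : nat -> set R) : set Omega :=
  [set w | forall k, (k < n)%N -> theta k w = t k /\ B k (X k w)].

Lemma measurable_prefix n t B : (forall k, measurable (B k)) ->
  measurable (prefix n t B).
Proof.
move=> mB; elim: n => [|n IH].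
  by rewrite (_ : prefix _ _ _ = setT)//; apply/seteqP; split.
rewrite (_ : prefix _ _ _ =
    prefix n t B `&` (theta n @^-1` [set t n] `&` [set w | B n (X n w)])).
  apply: measurableI => //; apply: measurableI => //.
  by rewrite -[X in measurable X]setTI; exact: mX.
apply/seteqP; split=> w /=.
  by move=> h; split=> [k kn|]; apply: h => //; exact: ltnW.
move=> [h [h1 h2]] k; rewrite ltnS leq_eqVlt => /predU1P[->//|]; exact: h.
Qed.

(** [is_HMM] only gives the law of prefixes in which every hidden state is prescribed. Splitting
    over the next hidden state moves the first set of the window into the prefix, and the induction
    leaves the likelihood of the rest as a factor. *)
Lemma prefix_window n t B l : (0 < n)%N -> (forall k, measurable (B k)) ->
  (forall B, B \in l -> measurable B) ->
  (P (prefix n t B `&` window X n l) =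
  (pi (t 0%N) * (\prod_(k < n.-1) Q (t k) (t k.+1)) *
     (\prod_(k < n) mass (f (t k)) (B k)) * trans Q (lik Q f l) (t n.-1))%:E)%E.
Proof.
elim: l n t B => [|C l IH] [//|n] t B _ mB ml.
  rewrite window_nil setIT trans_cst// mulr1.
  by case: HMM => _ [_ h]; exact: h.
have mC : measurable C by apply: ml; rewrite in_cons eqxx.
have ml' B' : B' \in l -> measurable B' by move=> h; apply: ml; rewrite in_cons h orbT.
rewrite (@sum_state n.+1); last first.
  by apply: measurableI; [exact: measurable_prefix|exact: measurable_window].
rewrite /trans mulr_sumr -sumEFin; apply: eq_bigr => j _.
pose t' k := if k == n.+1 then j else t k.
pose B' k := if k == n.+1 then C else B k.
have tt' k : (k < n.+1)%N -> t' k = t k by move=> kn; rewrite /t' ltn_eqF.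
have BB' k : (k < n.+1)%N -> B' k = B k by move=> kn; rewrite /B' ltn_eqF.
have tn : t' n.+1 = j by rewrite /t' eqxx.
have Bn : B' n.+1 = C by rewrite /B' eqxx.
have -> : prefix n.+1 t B `&` window X n.+1 (C :: l) `&` theta n.+1 @^-1` [set j] =
    prefix n.+2 t' B' `&` window X n.+2 l.
  rewrite window_cons; apply/seteqP; split=> w /=.
    move=> [[h [Cn hl]] tj]; split=> // k.
    rewrite ltnS leq_eqVlt => /predU1P[->|kn]; first by rewrite tn Bn.
    by rewrite tt'// BB'//; exact: h.
  move=> [h hl]; have [h1 h2] := h n.+1 (ltnSn _); split; last by rewrite h1.
  split; last by split=> //; rewrite -Bn.
  by move=> k kn; rewrite -tt'// -BB'//; apply: h; exact: ltnW.
rewrite IH//; last by move=> k; rewrite /B'; case: eqP.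
congr (_%:E); rewrite /= big_ord_recr/= [in LHS]big_ord_recr/=.
rewrite tn Bn !tt'//.
under eq_bigr => k _ do rewrite !tt' ?ltnS ?(ltnW (ltn_ord k))//.
under [X in _ * (X * _) * _]eq_bigr => k _ do rewrite tt'// BB'//.
by ring.
Qed.

Lemma window_law l : (forall B, B \in l -> measurable B) ->
  (P (window X 0 l) = (\sum_i pi i * lik Q f l i)%:E)%E.
Proof.
case: l => [|C l] ml.
  rewrite window_nil probability_setT; under eq_bigr do rewrite mulr1.
  by rewrite ps.2.
have mC : measurable C by apply: ml; rewrite in_cons eqxx.
rewrite (@sum_state 0); last exact: measurable_window.
rewrite -sumEFin; apply: eq_bigr => j _.
have -> : window X 0 (C :: l) `&` theta 0%N @^-1` [set j] =
    prefix 1 (fun=> j) (fun=> C) `&` window X 1 l.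
  rewrite window_cons; apply/seteqP; split=> w /=.
    by move=> [[h hl] tj]; split=> // -[].
  by move=> [h hl]; have [] := h 0%N isT.
rewrite prefix_window//; last by move=> B Bl; apply: ml; rewrite in_cons Bl orbT.
by congr (_%:E); rewrite big_ord0 big_ord_recl big_ord0 /= !mulr1 mulrA.
Qed.

End law.

(** * Concentration of block frequencies *)

Section generating_function.
Variables (R : realType) (J : nat) (Q : 'M[R]_J) (pi : 'I_J -> R).
Variables (f : 'I_J -> R -> R) (B1 B2 B3 : set R).
Hypotheses (Qs : stochastic_matrix Q) (ps : prob_vector pi).
Hypothesis df : forall j, is_density_lebesgue (f j).
Hypotheses (mB1 : measurable B1) (mB2 : measurable B2) (mB3 : measurable B3).

(** The part of [Q^3] carried by paths whose three observations fall in [B1], [B2], [B3]; the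
    innermost [trans] leads to the first state of the next block. *)
Definition blockop (u : 'I_J -> R) : 'I_J -> R :=
  fun i => mass (f i) B1 * trans Q (fun j => mass (f j) B2 *
    trans Q (fun k => mass (f k) B3 * trans Q u k) j) i.

(* Weights a block of three steps by [1 + c * indicator of B1 x B2 x B3]. *)
Definition tiltop (c : R) (u : 'I_J -> R) : 'I_J -> R :=
  fun i => iter 3 (trans Q) u i + c * blockop u i.

Lemma trans_lin a u v i :
  trans Q (fun j => u j + a * v j) i = trans Q u i + a * trans Q v i.
Proof.
rewrite /trans mulr_sumr -big_split /=; apply: eq_bigr => j _.
by rewrite mulrDr [Q i j * (a * _)]mulrCA.
Qed.

Lemma iter_trans_lin n a u v i : iter n (trans Q) (fun j => u j + a * v j) i =
  iter n (trans Q) u i + a * iter n (trans Q) v i.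
Proof.
elim: n i => //= n IH i; rewrite -trans_lin; congr (trans Q _ i).
by apply/funext => k; exact: IH.
Qed.

Lemma blockop_lin a u v i :
  blockop (fun j => u j + a * v j) i = blockop u i + a * blockop v i.
Proof.
have t B (g g1 g2 : 'I_J -> R) : (forall j, g j = g1 j + a * g2 j) -> forall j,
    mass (f j) B * trans Q g j =
    mass (f j) B * trans Q g1 j + a * (mass (f j) B * trans Q g2 j).
  by move=> /funext -> j; rewrite trans_lin; ring.
by rewrite /blockop; apply: (t) => j; apply: (t) => k; exact: t.
Qed.

Lemma tiltop_lin c a u v i :
  tiltop c (fun j => u j + a * v j) i = tiltop c u i + a * tiltop c v i.
Proof. by rewrite /tiltop iter_trans_lin blockop_lin; ring. Qed.

Lemma iter_tiltop_lin n c a u v i : iter n (tiltop c) (fun j => u j + a * v j) i =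
  iter n (tiltop c) u i + a * iter n (tiltop c) v i.
Proof.
elim: n i => //= n IH i; rewrite -tiltop_lin; congr (tiltop c _ i).
by apply/funext => k; exact: IH.
Qed.

Lemma tiltop_scale c a v i : tiltop c (fun j => a * v j) i = a * tiltop c v i.
Proof.
have -> : (fun j => a * v j) = (fun j => v j + (a - 1) * v j).
  by apply/funext => j; ring.
by rewrite tiltop_lin; ring.
Qed.

Lemma blockop_ge0 u : (forall i, 0 <= u i) -> forall i, 0 <= blockop u i.
Proof.
move=> u0; have t v : (forall j, 0 <= v j) -> forall B j, 0 <= mass (f j) B * trans Q v j.
  by move=> v0 B j; rewrite mulr_ge0 ?mass_ge0//; exact: trans_ge0.
by move=> i; apply: (t) => j; apply: (t) => k; exact: t.
Qed.

(** In the applications the small set is the middle one (a cell): its mass [q] is kept, the outer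
    two masses are estimated by 1. *)
Lemma blockop_le u b : 0 <= b -> (forall i, `|u i| <= b) ->
  forall q, (forall j, mass (f j) B2 <= q) -> forall i, `|blockop u i| <= q * b.
Proof.
move=> b0 ub q hq i.
have q0 : 0 <= q by apply: le_trans (hq i); exact: mass_ge0.
have tb v a : (forall j, `|v j| <= a) -> forall j, `|trans Q v j| <= a.
  move=> va j; rewrite (le_trans (ler_norm_sum _ _ _))//.
  rewrite -[leRHS](trans_cst Qs a j); apply: ler_sum => k _.
  by rewrite normrM ger0_norm ?ler_wpM2l//; apply Qs.1.
have m1 B j : measurable B -> `|mass (f j) B| <= 1.
  by move=> mB; rewrite ger0_norm ?mass_le1 ?mass_ge0.
rewrite /blockop normrM -[leRHS]mul1r ler_pM// ?m1//.
apply: (tb) => j; rewrite normrM ler_pM//; first by rewrite ger0_norm ?mass_ge0.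
apply: (tb) => k; rewrite normrM -[leRHS]mul1r ler_pM// ?m1//.
exact: tb.
Qed.

Lemma blockop_le_iter u : (forall i, 0 <= u i) ->
  forall i, blockop u i <= iter 3 (trans Q) u i.
Proof.
move=> u0.
have t1 v w : (forall j, 0 <= v j) -> (forall j, v j <= w j) -> forall B j,
    measurable B -> mass (f j) B * trans Q v j <= trans Q w j.
  move=> v0 vw B j mB; rewrite -[leRHS]mul1r ler_pM ?mass_ge0 ?mass_le1//.
    exact: trans_ge0.
  exact: le_trans_fun.
have t0 v : (forall j, 0 <= v j) -> forall B j, 0 <= mass (f j) B * trans Q v j.
  by move=> v0 B j; rewrite mulr_ge0 ?mass_ge0//; exact: trans_ge0.
move=> i; apply: (t1) => // j; first by apply: (t0) => k; exact: t0.
by apply: (t1) => // k; [exact: t0|exact: (t1)].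
Qed.

(** [blockop] is dominated by [Q^3], so even [Q^3 - blockop] is positive. Negative [c] serve the
    lower tail. *)
Lemma tiltop_ge0 c u : -1 <= c -> (forall i, 0 <= u i) ->
  forall i, 0 <= tiltop c u i.
Proof.
move=> c1 u0 i; rewrite /tiltop.
have := blockop_le_iter u0 i; have := blockop_ge0 u0 i; nra.
Qed.

Lemma le_tiltop c u v : -1 <= c -> (forall i, u i <= v i) ->
  forall i, tiltop c u i <= tiltop c v i.
Proof.
move=> c1 uv i; rewrite -subr_ge0.
have -> : tiltop c v i - tiltop c u i = tiltop c (fun j => v j + (-1) * u j) i.
  by rewrite tiltop_lin mulN1r.
by apply: tiltop_ge0 => // j; rewrite mulN1r subr_ge0.
Qed.

(** Comparison principle: the supersolution [w] dominates the constant 1 up to the factor [a], and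
    positivity of [tiltop] preserves the comparison at each step. *)
Lemma iter_tiltop_le c w r a M : -1 <= c -> 0 <= r -> 0 <= a ->
  (forall i, tiltop c w i <= r * w i) -> (forall i, 1 <= a * w i) ->
  forall i, iter M (tiltop c) (fun=> 1) i <= a * r ^+ M * w i.
Proof.
move=> c1 r0 a0 hw aw; elim: M => [|M IH] i; first by rewrite expr0 mulr1.
rewrite iterS (le_trans (le_tiltop c1 IH i))// tiltop_scale.
rewrite exprSr -!mulrA ler_wpM2l// ler_wpM2l ?exprn_ge0//.
Qed.

End generating_function.

(** * Exponential moments of block counts *)

Section block_moments.
Variables (R : realType) (d : measure_display) (Omega : measurableType d).
Variables (P : probability Omega R) (J : nat) (Q : 'M[R]_J) (pi : 'I_J -> R).
Variables (f : 'I_J -> R -> R) (theta : nat -> Omega -> 'I_J).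
Variable X : nat -> Omega -> R.
Hypotheses (Qs : stochastic_matrix Q) (ps : prob_vector pi).
Hypothesis df : forall j, is_density_lebesgue (f j).
Hypothesis HMM : is_HMM P Q pi f theta X.
Variables (B1 B2 B3 : set R).
Hypotheses (mB1 : measurable B1) (mB2 : measurable B2) (mB3 : measurable B3).

Definition hit n : set Omega := window X (3 * n) [:: B1; B2; B3].

Definition tilt (c : R) M (w : Omega) : R := \prod_(n < M) (1 + c * \1_(hit n) w).

Definition hits M (w : Omega) : R := \sum_(n < M) \1_(hit n) w.

Definition blockprob : R := \sum_i pi i * blockop Q f B1 B2 B3 (fun=> 1) i.

Lemma measurable_hit n : measurable (hit n).
Proof.
apply: (measurable_window HMM) => B.
by rewrite !in_cons in_nil orbF => /or3P[] /eqP ->.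
Qed.

Lemma measurable_tilt c M : measurable_fun setT (tilt c M).
Proof.
apply: measurable_prod => n _.
apply: measurable_funD => //; apply: measurable_funM => //.
by apply: measurable_indic; exact: measurable_hit.
Qed.

Lemma measurable_hits M : measurable_fun setT (hits M).
Proof.
by apply: measurable_sum => n; apply: measurable_indic; exact: measurable_hit.
Qed.

Lemma tilt_bounded c M w : `|tilt c M w| <= (1 + `|c|) ^+ M.
Proof.
elim: M => [|M IH]; first by rewrite /tilt big_ord0 normr1 expr0.
rewrite /tilt big_ord_recr /= normrM exprSr ler_pM//.
rewrite (le_trans (ler_normD _ _))// normr1 lerD2l normrM ler_piMr//.
by rewrite indicE; case: (_ \in _); rewrite ?normr1// normr0.
Qed.

Lemma integrable_tilt_indic c M A : measurable A ->
  P.-integrable setT (EFin \o (fun w => tilt c M w * \1_A w)).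
Proof.
move=> mA; apply: measurable_bounded_integrable => //.
- by rewrite (le_lt_trans (probability_le1 _ _)) ?ltry.
- by apply: measurable_funM; [exact: measurable_tilt|exact: measurable_indic].
- exists ((1 + `|c|) ^+ M); split; first by rewrite num_real.
  move=> a Ma w _ /=; rewrite (le_trans _ (ltW Ma))// normrM.
  rewrite (le_trans _ (tilt_bounded c M w))// ler_piMr//.
  by rewrite indicE; case: (_ \in _); rewrite ?normr1// normr0.
Qed.

(** The last factor of the tilt splits the integral in two: its indicator puts [B1], [B2], [B3] in
    front of the window, its 1 puts three copies of [setT] there. Both are windows that start one
    block earlier, and linearity reassembles them into one more [tiltop]. *)
Lemma tilt_window c M l : (forall B, B \in l -> measurable B) ->
  \int[P]_w (tilt c M w * \1_(window X (3 * M) l) w) =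
  \sum_i pi i * iter M (tiltop Q f B1 B2 B3 c) (lik Q f l) i.
Proof.
elim: M l => [|M IH] l ml.
  rewrite muln0 /=; under eq_Rintegral do rewrite /tilt big_ord0 mul1r.
  transitivity (fine (P (window X 0 l))); last by rewrite (window_law Qs ps HMM ml).
  by rewrite /Rintegral integral_indic ?setIT//; exact: (measurable_window HMM).
pose l0 : seq (set R) := [:: setT, setT, setT & l].
pose l1 : seq (set R) := [:: B1, B2, B3 & l].
have ml0 B : B \in l0 -> measurable B.
  by rewrite !in_cons => /or4P[/eqP->|/eqP->|/eqP->|/ml].
have ml1 B : B \in l1 -> measurable B.
  by rewrite !in_cons => /or4P[/eqP->|/eqP->|/eqP->|/ml].
have w0 : window X (3 * M.+1) l = window X (3 * M) l0.
  rewrite !window_cons (_ : 3 * M.+1 = (3 * M).+3)%N; last by lia.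
  by rewrite (_ : [set w | setT _] = setT) ?setTI//; apply/seteqP; split.
have w1 : hit M `&` window X (3 * M.+1) l = window X (3 * M) l1.
  rewrite /hit !window_cons window_nil setIT -!setIA.
  by rewrite (_ : 3 * M.+1 = (3 * M).+3)%N//; lia.
have e w : tilt c M.+1 w * \1_(window X (3 * M.+1) l) w =
    tilt c M w * \1_(window X (3 * M) l0) w +
    c * (tilt c M w * \1_(window X (3 * M) l1) w).
  rewrite -w0 -w1 indicI /= /tilt big_ord_recr /=; ring.
under eq_Rintegral do rewrite e.
have I0 := integrable_tilt_indic c M (measurable_window HMM (3 * M) ml0).
have I1 := integrable_tilt_indic c M (measurable_window HMM (3 * M) ml1).
rewrite RintegralD//; last first.
  by rewrite (_ : EFin \o _ = (fun w => c%:E * (EFin \o (fun w => (tilt c M w * \1_(window X (3 * M) l1) w)%R)) w)%E)//; exact: integrableZl.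
rewrite RintegralZl// IH// IH// mulr_sumr -big_split /=.
apply: eq_bigr => i _; rewrite mulrCA -mulrDr; congr (_ * _).
rewrite -iter_tiltop_lin -iterS iterSr; congr (iter M _ _ i).
apply/funext => j; rewrite /tiltop /= ; congr (_ + _).
have e1 u k : mass (f k) setT * trans Q u k = trans Q u k by rewrite mass_setT// mul1r.
rewrite e1; congr (trans Q _ j); apply/funext => k; rewrite e1; congr (trans Q _ k).
by apply/funext => h; rewrite e1.
Qed.

Lemma integral_tilt c M : \int[P]_w tilt c M w =
  \sum_i pi i * iter M (tiltop Q f B1 B2 B3 c) (fun=> 1) i.
Proof.
have := @tilt_window c M [::] (fun B => ltac:(by [])).
by rewrite window_nil indicT /= => <-; apply: eq_Rintegral => w _; rewrite mulr1.
Qed.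

Lemma blockprob_ge0 : 0 <= blockprob.
Proof.
apply: sumr_ge0 => i _; rewrite mulr_ge0 ?(ps.1 i)//.
by apply: blockop_ge0.
Qed.

Lemma block_le q i : (forall j, mass (f j) B2 <= q) ->
  0 <= blockop Q f B1 B2 B3 (fun=> 1) i <= q.
Proof.
move=> hq; rewrite blockop_ge0//= -[leRHS]mulr1 (le_trans (ler_norm _))//.
by apply: blockop_le => // j; rewrite normr1.
Qed.

Lemma blockprob_le q : (forall j, mass (f j) B2 <= q) -> blockprob <= q.
Proof.
move=> hq; rewrite -[leRHS]mul1r -[X in _ <= X * _]ps.2 mulr_suml; apply: ler_sum => i _.
by rewrite ler_wpM2l ?(ps.1 i)//; case/andP: (block_le i hq).
Qed.

(** The constant 1 is taken as supersolution. This allows arbitrarily large [c], as [hits_ge2]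
    requires, but the exponent sees only [q] and not the stationary probability. *)
Lemma integral_tilt_crude c M q : 0 <= c -> (forall j, mass (f j) B2 <= q) ->
  \int[P]_w tilt c M w <= expR (c * q * M%:R).
Proof.
move=> c0 hq; rewrite integral_tilt.
have [j _|J0] := pickP [pred j : 'I_J | true]; last first.
  by rewrite big1 ?expR_ge0// => j; have := J0 j.
have q0 : 0 <= q by apply: le_trans (hq j); exact: mass_ge0.
apply: (@le_trans _ _ ((1 + c * q) ^+ M)).
  rewrite -[leRHS]mul1r -[X in _ <= X * _]ps.2 mulr_suml; apply: ler_sum => i _.
  rewrite ler_wpM2l ?(ps.1 i)//.
  apply: (@le_trans _ _ (1 * (1 + c * q) ^+ M * 1)); last by rewrite mul1r mulr1.
  apply: (@iter_tiltop_le _ _ _ _ _ _ _ Qs df mB1 mB2 mB3 c (fun=> 1)) => //.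
  - by rewrite (le_trans _ c0)// oppr_le0.
  - by rewrite addr_ge0// mulr_ge0.
  - move=> k; rewrite mulr1 /tiltop iter_trans_cst//.
    by rewrite lerD2l ler_wpM2l//; case/andP: (block_le k hq).
  - by rewrite mul1r.
rewrite expRM_natr lerXn2r ?nnegrE ?expR_ge0 ?expR_ge1Dx//.
by rewrite addr_ge0// mulr_ge0.
Qed.

(** Replacing 1 by [1 + c v], with [v] the Poisson solution, cancels at first order in [c] the
    dependence of the block probability on the current state. The growth rate is then [c] times the
    stationary probability, up to a term of order [c^2 q]. *)
Lemma integral_tilt_le K c M q :
  1 <= K -> poisson_bound Q pi K ->
  `|c| * (2 * K) <= 1 -> 0 <= q <= 1 -> (forall j, mass (f j) B2 <= q) ->
  \int[P]_w tilt c M w <= 3 * expR ((c * blockprob + 4 * K * c ^+ 2 * q) * M%:R).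
Proof.
move=> K1 hK cK /andP[q0 q1] hq; rewrite integral_tilt.
pose g i := blockop Q f B1 B2 B3 (fun=> 1) i.
have [v [vE vb]] : exists v : 'I_J -> R, (forall i, v i - iter 3 (trans Q) v i = g i - blockprob) /\
     (forall i, `|v i| <= K * q).
  apply: hK => [|i].
    under eq_bigr do rewrite mulrBr.
    by rewrite sumrB -mulr_suml ps.2 mul1r subrr.
  have /andP[? ?] := block_le i hq.
  by rewrite ler_norml; have := blockprob_ge0; have := blockprob_le hq; rewrite /g; lra.
have c2 : `|c| <= 1 / 2 by have := normr_ge0 c; nra.
have cv i : `|c * v i| <= q / 2.
  by rewrite normrM; have := vb i; have := normr_ge0 (v i); have := normr_ge0 c; nra.
pose w i := 1 + c * v i.
have wb i : 1 / 2 <= w i <= 3 / 2.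
  by have := cv i; rewrite ler_norml /w; lra.
(* From [v - Q^3 v = g - p], with p the block probability, [tiltop c w = w + c p + c^2 (blockop v)].
   Compared with [rho * w], two terms of size at most [K c^2 q] remain, from [blockop v] and from
   [p v]; since [w >= 1/2], the constant 4 absorbs both. *)
pose rho := 1 + (c * blockprob + 4 * K * c ^+ 2 * q).
have blkv i : `|blockop Q f B1 B2 B3 v i| <= q * (K * q).
  by apply: blockop_le => //; nra.
have step i : tiltop Q f B1 B2 B3 c w i <= rho * w i.
  rewrite {1}/w tiltop_lin {1}/tiltop iter_trans_cst//.
  rewrite -/(g i) /tiltop.
  have -> : iter 3 (trans Q) v i = v i - (g i - blockprob) by rewrite -vE opprB addrC subrK.
  rewrite /rho /w.
  have h1 : c ^+ 2 * blockop Q f B1 B2 B3 v i <= c ^+ 2 * (K * q).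
    rewrite ler_wpM2l ?sqr_ge0//; have := blkv i; rewrite ler_norml => /andP[_ /le_trans]; apply.
    by rewrite ler_piMl// mulr_ge0//; lra.
  have h2 : - (c ^+ 2 * (K * q)) <= c ^+ 2 * (blockprob * v i).
    rewrite -mulrN ler_wpM2l ?sqr_ge0//.
    have := vb i; rewrite ler_norml => /andP[v1 _].
    have b0 := blockprob_ge0; have bq := blockprob_le hq.
    have k1 : 0 <= blockprob * (v i + K * q) by rewrite mulr_ge0//; lra.
    have k2 : 0 <= (1 - blockprob) * (K * q).
      by rewrite mulr_ge0 ?mulr_ge0//; lra.
    by lra.
  have h3 : c ^+ 2 * (K * q) * (1 / 2) <= c ^+ 2 * (K * q) * w i.
    rewrite ler_wpM2l//; last by case/andP: (wb i).
    by apply: mulr_ge0; [exact: sqr_ge0|apply: mulr_ge0 => //; lra].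
  by move: h3; rewrite /w; nra.
have c1 : -1 <= c by move: c2; rewrite ler_norml; lra.
have rho0 : 0 <= rho.
  have [j _|J0] := pickP [pred j : 'I_J | true]; last first.
    by exfalso; move: ps.2; rewrite big1 => [/esym/eqP|j]; [rewrite oner_eq0|have := J0 j].
  have w0 k : 0 <= w k by have := wb k; lra.
  have := le_trans (tiltop_ge0 Qs df mB1 mB2 mB3 c1 w0 j) (step j).
  by rewrite pmulr_lge0//; have := wb j; lra.
(* The bounds [1/2 <= w <= 3/2] give [a = 2] in the comparison and the constant 2 * 3/2 = 3. *)
apply: (@le_trans _ _ (\sum_i pi i * (3 * rho ^+ M))).
  apply: ler_sum => i _; rewrite ler_wpM2l ?(ps.1 i)//.
  apply: (le_trans (iter_tiltop_le Qs df mB1 mB2 mB3 M c1 rho0 (ler0n _ 2) step _ i)).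
    by move=> k; have := wb k; lra.
  by rewrite -mulrA mulrCA [leRHS]mulrC ler_wpM2l ?exprn_ge0//; have := wb i; lra.
rewrite -mulr_suml ps.2 mul1r ler_wpM2l// expRM_natr.
by rewrite lerXn2r ?nnegrE ?expR_ge0 ?expR_ge1Dx.
Qed.

End block_moments.

(** * Tail bounds for block counts *)

Section tails.
Variables (R : realType) (d : measure_display) (Omega : measurableType d).
Variables (P : probability Omega R) (J : nat) (Q : 'M[R]_J) (pi : 'I_J -> R).
Variables (f : 'I_J -> R -> R) (theta : nat -> Omega -> 'I_J).
Variable X : nat -> Omega -> R.
Hypotheses (Qs : stochastic_matrix Q) (ps : prob_vector pi).
Hypothesis df : forall j, is_density_lebesgue (f j).
Hypothesis HMM : is_HMM P Q pi f theta X.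
Variables (B1 B2 B3 : set R).
Hypotheses (mB1 : measurable B1) (mB2 : measurable B2) (mB3 : measurable B3).

Let nhits := hits X B1 B2 B3.
Let p := blockprob Q pi f B1 B2 B3.

Lemma tilt_expR la M w : tilt X B1 B2 B3 (expR la - 1) M w = expR (la * nhits M w).
Proof.
rewrite /nhits /tilt /hits mulr_sumr expR_sum; apply: eq_bigr => n _.
rewrite indicE; case: (_ \in _) => /=; first by rewrite !mulr1 addrC subrK.
by rewrite !mulr0 addr0 expR0.
Qed.

Lemma measurable_ge_preimage (g : Omega -> R) a : measurable_fun setT g ->
  measurable [set w | a <= g w].
Proof.
move=> mg; rewrite (_ : [set w | _] = g @^-1` `[a, +oo[).
  by rewrite -[X in measurable X]setTI; exact: mg.
by apply/seteqP; split=> w /=; rewrite in_itv/= andbT.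
Qed.

Lemma hits_chernoff la M A a : measurable A -> (forall w, A w -> a <= la * nhits M w) ->
  (P A <= (expR (- a) * \int[P]_w tilt X B1 B2 B3 (expR la - 1) M w)%:E)%E.
Proof.
move=> mA hA.
have fA : P A \is a fin_num by rewrite fin_num_measure.
rewrite -(fineK fA) lee_fin expRN mulrC ler_pdivlMr ?expR_gt0//.
have -> : fine (P A) * expR a = \int[P]_w (expR a * \1_A w).
  rewrite RintegralZl//; last first.
    apply: measurable_bounded_integrable => //; last 1 first.
    - exists 1; split=> // b b1 w _ /=; rewrite indicE.
      by case: (_ \in _); rewrite ?normr1 ?normr0 ltW// (lt_trans _ b1).
    - by rewrite (le_lt_trans (probability_le1 _ _)) ?ltry.
  by rewrite /Rintegral integral_indic// setIT mulrC.
have It : P.-integrable setT (EFin \o tilt X B1 B2 B3 (expR la - 1) M).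
  have := integrable_tilt_indic HMM mB1 mB2 mB3 (expR la - 1) M measurableT.
  by under [X in _ \o X]eq_fun do rewrite indicT mulr1.
apply: le_Rintegral => //.
  have := integrable_tilt_indic HMM mB1 mB2 mB3 0 0 mA.
  move=> /(integrableZl measurableT (expR a)); apply: eq_integrable => // w _.
  by rewrite /= /tilt big_ord0 mul1r.
move=> w _; rewrite tilt_expR indicE; have [wA|wA] := boolP (w \in A).
  by rewrite mulr1 ler_expR; apply: hA; exact: set_mem.
by rewrite mulr0 expR_ge0.
Qed.

Lemma expRB1_bounds (x : R) : `|x| <= 1 / 2 -> 0 <= expR x - 1 - x <= 2 * x ^+ 2.
Proof.
move=> hx; have h1 := expR_ge1Dx x; apply/andP; split; first by lra.
have h2 := expR_ge1Dx (- x).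
move: hx; rewrite ler_norml => /andP[x1 x2].
have e0 := expR_gt0 x.
have h3 : expR x * (1 - x) <= 1.
  rewrite -[leRHS](expRxMexpNx_1 x) ler_wpM2l//; exact: ltW.
nra.
Qed.

(** Both tails at once, [e] being the sign. For [c = exp(e la) - 1], the bound [c^2 <= 4 la^2] turns
    [4 K c^2 q] into [16 K la^2 q], and [c - e la <= 2 la^2] adds at most [2 K la^2 q]: hence 18. *)
Lemma hits_tail (K la t q : R) M (e : R) : `|e| = 1 ->
  1 <= K -> poisson_bound Q pi K ->
  0 < la -> la * (8 * K) <= 1 -> 0 <= q <= 1 -> (forall j, mass (f j) B2 <= q) ->
  (P [set w | (M%:R * t <= e * (nhits M w - M%:R * p))%R] <=
    (3 * expR ((18 * K * la ^+ 2 * q - la * t) * M%:R))%:E)%E.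
Proof.
move=> e1 K1 hK la0 laK q01 hq.
have e2 : e ^+ 2 = 1 by rewrite -(real_normK (num_real e)) e1 expr1n.
have mh := measurable_hits HMM mB1 mB2 mB3 M.
have la2 : `|e * la| <= 1 / 2 by rewrite normrM e1 mul1r gtr0_norm//; nra.
have /andP[b1 b2] := expRB1_bounds la2.
set c := expR (e * la) - 1 in b1 b2 *.
have ela : (e * la) ^+ 2 = la ^+ 2 by rewrite exprMn e2 mul1r.
rewrite ela in b2.
have cla : `|c| <= 2 * la.
  move: la2; rewrite !ler_norml => /andP[x1 x2].
  have : `|e * la| = la by rewrite normrM e1 mul1r gtr0_norm.
  by move=> h; have := ler_norm (e * la); have := ler_norm (- (e * la)); rewrite normrN h; nra.
have c2 : c ^+ 2 <= 4 * la ^+ 2.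
  by rewrite -(real_normK (num_real c)); have := normr_ge0 c; nra.
have p0 : 0 <= p := blockprob_ge0 Qs ps df B1 B2 B3.
have pq : p <= q := blockprob_le Qs ps df mB1 mB3 hq.
have cK : `|c| * (2 * K) <= 1 by have := normr_ge0 c; nra.
have mA : measurable [set w | M%:R * t <= e * (nhits M w - M%:R * p)].
  by apply: measurable_ge_preimage; apply: measurable_funM => //; exact: measurable_funB.
have hA w : [set w | M%:R * t <= e * (nhits M w - M%:R * p)] w ->
    (la * t + e * la * p) * M%:R <= (e * la) * nhits M w.
  by move=> /= /(ler_wpM2l (ltW la0)) h; rewrite -subr_ge0; move: h; rewrite -subr_ge0; congr (0 <= _); ring.
apply: (le_trans (hits_chernoff mA hA)); rewrite lee_fin.
have := integral_tilt_le Qs ps df HMM mB1 mB2 mB3 M K1 hK cK q01 hq.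
move=> /(ler_wpM2l (expR_ge0 (- ((la * t + e * la * p) * M%:R)))) /le_trans; apply.
rewrite mulrCA -expRD ler_wpM2l// ler_expR -mulNr -mulrDl ler_wpM2r//.
have /andP[q0 _] := q01.
have h1 : c * p - e * la * p <= 2 * la ^+ 2 * q.
  rewrite -mulrBl (le_trans (ler_wpM2r p0 b2))// ler_wpM2l//.
  by rewrite mulr_ge0// sqr_ge0.
have h2 : 4 * K * c ^+ 2 * q <= 16 * K * la ^+ 2 * q.
  rewrite ler_wpM2r//; nra.
have h3 : la ^+ 2 * q <= K * (la ^+ 2 * q).
  by rewrite ler_peMl// mulr_ge0// sqr_ge0.
by rewrite -/p; lra.
Qed.

Lemma hits_bernstein (K la t q : R) M :
  1 <= K -> poisson_bound Q pi K ->
  0 < la -> la * (8 * K) <= 1 -> 0 <= q <= 1 -> (forall j, mass (f j) B2 <= q) ->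
  (P [set w | (M%:R * t <= `|nhits M w - M%:R * p|)%R] <=
    (6 * expR ((18 * K * la ^+ 2 * q - la * t) * M%:R))%:E)%E.
Proof.
move=> K1 hK la0 laK q01 hq.
have mh := measurable_hits HMM mB1 mB2 mB3 M.
pose A e := [set w | M%:R * t <= e * (nhits M w - M%:R * p)].
have mA e : measurable (A e).
  by apply: measurable_ge_preimage; apply: measurable_funM => //; exact: measurable_funB.
have hA e : `|e| = 1 -> (P (A e) <= _)%E := fun h => hits_tail t M h K1 hK la0 laK q01 hq.
have -> : [set w | M%:R * t <= `|nhits M w - M%:R * p|] = A 1 `|` A (-1).
  by apply/seteqP; split=> w; rewrite /A /= mul1r mulN1r ler_normr => /orP.
rewrite (le_trans (measureU2 _ _ _))//.
rewrite (_ : 6 * _ = 3 * expR ((18 * K * la ^+ 2 * q - la * t) * M%:R) +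
  3 * expR ((18 * K * la ^+ 2 * q - la * t) * M%:R)); last by ring.
by rewrite EFinD leeD// hA// ?normrN normr1.
Qed.

(** With [y = q M], tilting by [c] gives [P * (1 + c)^2 <= exp(c y)]; the choice [c = 1/y] makes
    this quadratic in [y]. Unlike the Bernstein bound at a fixed tilt and threshold, it tends to 0
    with [q]. *)
Lemma hits_ge2 M (q : R) : 0 <= q -> (forall j, mass (f j) B2 <= q) ->
  (P [set w | (2 <= nhits M w)%R] <= (expR 1 * (q * M%:R) ^+ 2)%:E)%E.
Proof.
move=> q0 hq.
have mh := measurable_hits HMM mB1 mB2 mB3 M.
have mA : measurable [set w | 2 <= nhits M w] by exact: measurable_ge_preimage.
have fA : P [set w | 2 <= nhits M w] \is a fin_num by rewrite fin_num_measure.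
have main c : 0 < c ->
    fine (P [set w | 2 <= nhits M w]) * (1 + c) ^+ 2 <= expR (c * (q * M%:R)).
  move=> c0; have c1 : 0 < 1 + c by lra.
  have l0 : 0 <= ln (1 + c) by rewrite ln_ge0//; lra.
  have hA w : [set w | 2 <= nhits M w] w -> ln (1 + c) * 2 <= ln (1 + c) * nhits M w.
    by move=> /= h; rewrite ler_wpM2l.
  have e1 : expR (ln (1 + c)) = 1 + c by rewrite lnK.
  have := hits_chernoff mA hA; rewrite -{1}(fineK fA) lee_fin e1.
  rewrite [1 + c - 1]addrC addKr expRN [X in _ <= X]mulrC ler_pdivlMr ?expR_gt0//.
  rewrite expRM_natr e1 => /le_trans; apply; rewrite mulrA.
  exact: (integral_tilt_crude Qs ps df HMM mB1 mB2 mB3 M (ltW c0) hq).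
rewrite -(fineK fA) lee_fin; set x := fine _ in main *.
have x0 : 0 <= x by rewrite fine_ge0.
have := mulr_ge0 q0 (ler0n R M); rewrite le_eqVlt => /predU1P[y0|y0].
  (* For [y = 0] every tilt has moment at most 1, and [c = 1/x] contradicts [x > 0]. *)
  rewrite -y0 expr0n mulr0 leNgt; apply/negP => x1.
  have := main x^-1; rewrite invr_gt0 -y0 mulr0 expR0 => /(_ x1).
  have -> : x * (1 + x^-1) ^+ 2 = x + 2 + x^-1 by field; rewrite gt_eqF.
  have : 0 < x^-1 by rewrite invr_gt0.
  by lra.
set y := q * M%:R in main y0 *.
have := main y^-1; rewrite invr_gt0 => /(_ y0); rewrite mulVf ?gt_eqF//.
have -> : x * (1 + y^-1) ^+ 2 = x * (1 + y) ^+ 2 / y ^+ 2.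
  by field; rewrite gt_eqF.
rewrite ler_pdivrMr ?exprn_gt0// => /(le_trans _); apply.
by rewrite ler_peMr// exprn_ege1//; lra.
Qed.

End tails.

(** * Smoothing of cell frequencies *)

Section taylor.
Variable R : realType.
Implicit Types (f df : R -> R) (p q : {poly R}) (x y : R).

(** The formal antiderivative; at [i = 0] the division by 0 gives 0, so the constant term
    vanishes. *)
Definition primitive p : {poly R} := \poly_(i < (size p).+1) (p`_i.-1 / i%:R).

Lemma deriv_primitive p : (primitive p)^`() = p.
Proof.
apply/polyP => i; rewrite coef_deriv coef_poly ltnS /=.
case: ltnP => [_|pi]; last by rewrite mul0rn nth_default.
by rewrite -mulrnAr -[_ *+ _]mulr_natr mulVf ?mulr1// pnatr_eq0.
Qed.

Lemma size_primitive p : (size (primitive p) <= (size p).+1)%N.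
Proof. exact: size_poly. Qed.

Lemma mean_value_bound f df x y (B : R) :
  (forall z : R, is_derive z 1 f (df z)) ->
  (forall z, `|z - x| <= `|y - x| -> `|df z| <= B) ->
  `|f y - f x| <= B * `|y - x|.
Proof.
move=> fd dB.
have cf a b : {within `[a, b], continuous f}.
  apply: continuous_subspaceT => z; apply: differentiable_continuous.
  by apply/derivable1_diffP; case: (fd z).
have [xy|yx] := leP x y.
  have [z + ->] := MVT_segment xy (fun z _ => fd z) (cf _ _).
  rewrite in_itv/= => /andP[xz zy]; rewrite normrM ler_wpM2r// dB//.
  by rewrite !ger0_norm; lra.
have [z + e] := MVT_segment (ltW yx) (fun z _ => fd z) (cf _ _).
rewrite in_itv/= => /andP[yz zx]; rewrite distrC e normrM distrC ler_wpM2r// dB//.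
by rewrite !ler0_norm; lra.
Qed.

(** Induction on [k] through the derivative: its approximating polynomial is integrated and
    normalised at [x], and the mean value inequality contributes one factor [rho]. *)
Lemma taylor_poly k f x (rho B : R) :
  (forall i, (i < k)%N -> forall y, derivable (derive1n i f) y 1) ->
  (forall y, `|y - x| <= rho -> `|derive1n k f y - derive1n k f x| <= B) ->
  exists p, [/\ (size p <= k.+1)%N, p.[x] = f x &
    forall y, `|y - x| <= rho -> `|f y - p.[y]| <= B * rho ^+ k].
Proof.
elim: k f => [|k IH] f fd fB.
  exists (f x)%:P; split=> [||y yx]; rewrite ?size_polyC ?hornerC ?leq_b1//.
  by rewrite expr0 mulr1 fB.
have dS i : derive1n i.+1 f = derive1n i (derive1 f) by rewrite derive1Sn.
have [||q [sq qx qB]] := IH (derive1 f).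
- by move=> i ik y; rewrite -dS; exact: (fd i.+1).
- by move=> y; rewrite -dS; exact: fB.
set P := primitive q; pose p := P + (f x - P.[x])%:P.
have px : p.[x] = f x by rewrite /p hornerD hornerC addrC subrK.
have p' : p^`() = q by rewrite /p derivD derivC addr0 deriv_primitive.
exists p; split=> // [|y yx].
  rewrite (leq_trans (size_polyD _ _))// geq_max (leq_trans (size_primitive _))//=.
  by rewrite size_polyC; case: (_ != 0).
pose g := f - horner p.
have gd (z : R) : is_derive z 1 g (derive1 f z - q.[z]).
  have fz : is_derive z (1 : R) f (derive1 f z).
    by rewrite derive1E; apply: DeriveDef => //; exact: (fd 0%N).
  by rewrite -p'; exact: is_deriveB.
have -> : f y - p.[y] = g y - g x by rewrite /g !fctE px subrr subr0.
apply: le_trans (mean_value_bound (B := B * rho ^+ k) gd _) _.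
  by move=> z zx; apply: qB; exact: le_trans zx yx.
rewrite exprSr mulrA ler_wpM2l//.
by apply: le_trans (normr_ge0 _) (qB x _); rewrite subrr normr0 (le_trans _ yx).
Qed.

End taylor.

Section quasi_interpolation.
Variable R : realType.

(* The derivative of the Lagrange interpolant of [S] at [0, .., k+1], written in
   terms of the increments of [S]. *)
Lemma increment_weights k : exists q : 'I_k.+1 -> {poly R},
  forall S : {poly R}, (size S <= k.+2)%N -> forall t,
  \sum_i (q i).[t] * (S.[i.+1%:R] - S.[i%:R]) = S^`().[t].
Proof.
have xinj : injective (fun n : nat => n%:R : R) by move=> m n /eqP; rewrite eqr_nat => /eqP.
pose L (j : 'I_k.+2) : {poly R} := tnth (lagrange k.+2 (fun n : nat => n%:R : R)) j.
exists (fun i => (\sum_(j < k.+2 | (i < j)%N) L j)^`()) => S sS t.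
pose T := S - (S.[0])%:P.
have sT : (size T <= k.+2)%N.
  by rewrite (leq_trans (size_polyD _ _))// geq_max sS size_polyN size_polyC; case: (_ != 0).
have -> : S^`() = T^`() by rewrite /T derivB derivC subr0.
have tel (j : 'I_k.+2) : T.[j%:R] = \sum_(i < k.+1 | (i < j)%N) (S.[i.+1%:R] - S.[i%:R]).
  rewrite -(big_ord_widen _ (fun i => S.[i.+1%:R] - S.[i%:R])) -1?ltnS//.
  rewrite -(big_mkord xpredT (fun i => S.[i.+1%:R] - S.[i%:R])) telescope_sumr//.
  by rewrite /T hornerD hornerN hornerC.
rewrite (@lagrange_gen _ k.+2 _ isT xinj T sT).
rewrite raddf_sum horner_sum /=.
under [RHS]eq_bigr do rewrite mul_polyC derivZ hornerZ tel mulr_suml.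
under [LHS]eq_bigr do rewrite raddf_sum horner_sum mulr_suml.
rewrite (exchange_big_dep xpredT)//=; apply: eq_bigr => j _.
by apply: eq_bigr => i _; rewrite mulrC.
Qed.

Definition hat (t : R) : R := Num.max 0 (1 - `|t|).

Lemma hat_ge0 t : 0 <= hat t.
Proof. by rewrite /hat le_max lexx. Qed.

Lemma hat_le1 t : hat t <= 1.
Proof. by rewrite /hat ge_max ler01 lerBlDr lerDl normr_ge0. Qed.

Lemma hat_eq0 t : 1 <= `|t| -> hat t = 0.
Proof. by move=> t1; rewrite /hat; apply/max_idPl; rewrite subr_le0. Qed.

Lemma continuous_hat : continuous hat.
Proof.
move=> t; apply: (@continuous_max _ _ (cst 0) (fun t => 1 - `|t|)).
  exact: cvg_cst.
by apply: cvgB; [exact: cvg_cst|exact: norm_continuous].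
Qed.

Lemma floor_frac (u : R) : 0 <= u - (Num.floor u)%:~R < 1.
Proof.
have := floor_itv u; rewrite intrD => /andP[h1 h2].
by rewrite subr_ge0 h1/= ltrBlDl.
Qed.

Variables (k : nat) (q : 'I_k.+1 -> {poly R}).
Implicit Types (a : int -> R) (u : R).

(** Every integer [m] carries a local polynomial computed from the cells [m, ..., m + k], and
    neighbouring ones are blended continuously by the tent [hat]. Only [m = floor u] and
    [m = floor u + 1] can have a nonzero tent at [u], hence the sum over two indices. *)
Definition smooth a u : R := \sum_(b < 2)
  hat (u - (Num.floor u + b%:Z)%:~R) *
  \sum_(i < k.+1) (q i).[u - (Num.floor u + b%:Z)%:~R] * a (Num.floor u + b%:Z + i%:Z).

(** The response of [smooth] to a unit mass in cell 0. Sums of its translates represent [smooth]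
    without the floor of [u], so continuity is immediate. *)
Definition smoothing_kernel u : R := \sum_(i < k.+1) hat (u + i%:R) * (q i).[u + i%:R].

Lemma continuous_smoothing_kernel : continuous smoothing_kernel.
Proof.
apply: (continuous_big (op := +%R)) => [|i _ u]; first exact: add_continuous.
have cs : {for u, continuous (fun u : R => u + i%:R)}.
  by apply: cvgD; [exact: cvg_id|exact: cvg_cst].
apply: cvgM; first by apply: (continuous_comp cs); exact: continuous_hat.
by apply: (continuous_comp cs); exact: continuous_horner.
Qed.

Lemma smooth_delta z u :
  smooth (fun z' => (z' == z)%:R) u = smoothing_kernel (u - z%:~R).
Proof.
rewrite /smooth; under eq_bigr do rewrite mulr_sumr.
rewrite exchange_big /=; apply: eq_bigr => i _.
have -> : u - z%:~R + i%:R = u - (z - i%:Z)%:~R.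
  by rewrite intrB opprB addrA addrAC.
set v := Num.floor u; set m := z - i%:Z.
have eqm b : (v + b%:Z + i%:Z == z) = (v + b%:Z == m) by rewrite /m eq_sym -subr_eq eq_sym.
rewrite big_ord_recl big_ord1 /= (eqm 0%N) (eqm 1%N).
have [vm|vm] := eqVneq (v + 0%:Z) m.
  rewrite (_ : (v + 1 == m) = false); last by apply/negbTE/eqP; rewrite -vm; lia.
  by rewrite !mulr0 addr0 mulr1 vm.
rewrite mulr0 mulr0 add0r.
have [vm1|vm1] := eqVneq (v + 1%:Z) m; first by rewrite mulr1 vm1.
rewrite !mulr0 hat_eq0 ?mul0r//.
have /andP[u0 u1] := floor_frac u; rewrite -/v in u0 u1.
have [mv|mv] := leP m (v - 1).
  have : m%:~R <= (v - 1)%:~R :> R by rewrite ler_int.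
  by rewrite intrB => h; rewrite ger0_norm; lra.
have : (v + 2)%:~R <= m%:~R :> R.
  by rewrite ler_int; move: vm vm1 mv => /eqP + /eqP; lia.
by rewrite intrD => h; rewrite ler0_norm; lra.
Qed.

Lemma smooth_sum n (w : 'I_n -> R) (z : 'I_n -> int) u :
  \sum_i w i * smoothing_kernel (u - (z i)%:~R) =
  smooth (fun z' => \sum_i w i * (z' == z i)%:R) u.
Proof.
under eq_bigr do rewrite -smooth_delta mulr_sumr.
rewrite exchange_big /=; apply: eq_bigr => b _.
under eq_bigr do rewrite mulrCA mulr_sumr.
rewrite -mulr_sumr exchange_big /=; congr (_ * _).
by apply: eq_bigr => i _; rewrite mulr_sumr; apply: eq_bigr => j _; rewrite mulrCA.
Qed.

Lemma smooth_scale c a u : smooth (fun z => c * a z) u = c * smooth a u.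
Proof.
rewrite /smooth mulr_sumr; apply: eq_bigr => b _.
rewrite mulrCA; congr (_ * _); rewrite mulr_sumr; apply: eq_bigr => i _.
by rewrite mulrCA.
Qed.

Lemma smoothB a a' u : smooth (fun z => a z - a' z) u = smooth a u - smooth a' u.
Proof.
rewrite /smooth -sumrB; apply: eq_bigr => b _.
rewrite -mulrBr; congr (_ * _); rewrite -sumrB; apply: eq_bigr => i _.
by rewrite mulrBr.
Qed.

Lemma eq_smooth a a' u : a =1 a' -> smooth a u = smooth a' u.
Proof. by move=> /funext ->. Qed.

Definition smooth_norm : R := \sum_(b < 2) \sum_i \sum_(j < size (q i)) `|(q i)`_j|.

Lemma horner_le_coef (p : {poly R}) t : `|t| <= 1 ->
  `|p.[t]| <= \sum_(j < size p) `|p`_j|.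
Proof.
move=> t1; rewrite horner_coef (le_trans (ler_norm_sum _ _ _))//.
apply: ler_sum => j _; rewrite normrM ler_piMr// normrX.
by rewrite exprn_ile1.
Qed.

Lemma smooth_norm_ge0 : 0 <= smooth_norm.
Proof. by do 3! (apply: sumr_ge0 => ? _). Qed.

Lemma smooth_bound a u (B : R) :
  (forall n, (n <= k.+1)%N -> `|a (Num.floor u + n%:Z)| <= B) ->
  `|smooth a u| <= smooth_norm * B.
Proof.
move=> aB; rewrite (le_trans (ler_norm_sum _ _ _))//.
rewrite mulr_suml; apply: ler_sum => b _.
rewrite normrM (ger0_norm (hat_ge0 _)).
rewrite (le_trans (ler_piMl _ (hat_le1 _)))//.
rewrite (le_trans (ler_norm_sum _ _ _))// mulr_suml; apply: ler_sum => i _.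
rewrite normrM ler_pM//; last first.
  rewrite -addrA -PoszD; apply: aB.
  by have := ltn_ord b; have := ltn_ord i; lia.
apply: horner_le_coef; rewrite intrD opprD addrA.
have /andP[h1 h2] := floor_frac u.
have [-> | ->] : (b : nat) = 0%N \/ (b : nat) = 1%N by have := ltn_ord b; lia.
  by rewrite subr0 ger0_norm// ltW.
by rewrite ler_norml; lra.
Qed.

Hypothesis qP : forall S : {poly R}, (size S <= k.+2)%N -> forall t,
  \sum_i (q i).[t] * (S.[i.+1%:R] - S.[i%:R]) = S^`().[t].

(** The local polynomials at both nodes coincide with the derivative of [S], and the two tents add
    up to 1. *)
Lemma smooth_increments (S : {poly R}) u : (size S <= k.+2)%N ->
  smooth (fun z => S.[(z + 1)%:~R] - S.[z%:~R]) u = S^`().[u].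
Proof.
move=> sS.
have key (m : int) t : \sum_i (q i).[t - m%:~R] *
    (S.[(m + i%:Z + 1)%:~R] - S.[(m + i%:Z)%:~R]) = S^`().[t].
  pose T := S \Po ('X + (m%:~R)%:P).
  have sT : (size T <= k.+2)%N by rewrite size_comp_poly2// size_XaddC.
  have := qP sT (t - m%:~R).
  rewrite /T deriv_comp derivD derivX derivC addr0 mulr1 horner_comp.
  rewrite hornerD hornerX hornerC subrK => <-.
  apply: eq_bigr => i _; rewrite !horner_comp !hornerD !hornerX !hornerC.
  congr (_ * (S.[_] - S.[_])); last by rewrite intrD addrC.
  by rewrite !intrD -natr1 -!pmulrn; ring.
rewrite /smooth; under eq_bigr do rewrite key.
rewrite -mulr_suml -[RHS]mul1r; congr (_ * _).
rewrite big_ord_recl big_ord_recl big_ord0 addr0 /= addr0 intrD.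
have /andP[h1 h2] := floor_frac u.
rewrite /hat opprD addrA /bump /=.
set s := u - _ in h1 h2 *.
rewrite (ger0_norm h1) (@ler0_norm _ (s - 1%:~R)); last by lra.
by rewrite !max_r; lra.
Qed.

End quasi_interpolation.

(** * Masses of cells *)

Section cells.
Variable R : realType.
Implicit Types (g : R -> R) (p : {poly R}).

Definition cell (h : R) (z : int) : set R := [set x | Num.floor (x / h) = z].

Lemma floor_eqP (x : R) z : (Num.floor x == z) = (z%:~R <= x < (z + 1)%:~R).
Proof. by apply/eqP/idP => [<-|]; [exact: floor_itv|exact: floor_def]. Qed.

Lemma measurable_cell h z : measurable (cell h z).
Proof.
rewrite (_ : cell h z = (fun x => x / h) @^-1` `[z%:~R, (z + 1)%:~R[).
  rewrite -[X in measurable X]setTI.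
  by apply: (measurable_funM (f := id) (g := cst h^-1)).
apply/seteqP; split=> x /=; rewrite in_itv/=.
  by move/eqP; rewrite floor_eqP.
by move=> h1; apply/eqP; rewrite floor_eqP.
Qed.

Lemma cellE h z : 0 < h -> cell h z = `[z%:~R * h, (z + 1)%:~R * h[%classic.
Proof.
move=> h0; apply/seteqP; split=> x /=; rewrite in_itv/=.
  by move/eqP; rewrite floor_eqP ler_pdivlMr// ltr_pdivrMr.
by move=> h1; apply/eqP; rewrite floor_eqP ler_pdivlMr// ltr_pdivrMr.
Qed.

Lemma integral_poly p a b : a < b ->
  (\int[lebesgue_measure]_(x in `[a, b[) (p^`().[x])%:E = (p.[b] - p.[a])%:E)%E.
Proof.
move=> ab; rewrite integral_itv_bndo_bndc; last first.
  apply/measurable_EFinP; apply: measurable_funTS.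
  by apply: continuous_measurable_fun; exact: continuous_horner.
rewrite (@continuous_FTC2 _ _ (horner p))//.
- by apply: continuous_subspaceT => x; exact: continuous_horner.
- split.
  + by move=> x _; exact: derivable_horner.
  + by apply: cvg_at_right_filter; exact: continuous_horner.
  + by apply: cvg_at_left_filter; exact: continuous_horner.
- by move=> x _; rewrite derivE.
Qed.

(** On the interval [g] lies between the derivatives of [p - eps X] and [p + eps X], whose integrals
    are explicit. *)
Lemma mass_poly g p a b eps : is_density_lebesgue g -> a < b ->
  (forall x, a <= x < b -> `|g x - p^`().[x]| <= eps) ->
  `|mass g `[a, b[ - (p.[b] - p.[a])| <= eps * (b - a).
Proof.
move=> dg ab gp; have [mg g0 g1] := dg.
have ip (P : {poly R}) : lebesgue_measure.-integrable `[a, b[ (EFin \o horner P).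
  have sub : `[a, b[ `<=` (`[a, b] : set R) by move=> x /=; rewrite !in_itv/= => /andP[-> /ltW].
  have ipc : lebesgue_measure.-integrable `[a, b] (EFin \o horner P).
    apply: continuous_compact_integrable; first exact: segment_compact.
    by apply: continuous_subspaceT => x; exact: continuous_horner.
  by apply: integrableS ipc.
have ig : lebesgue_measure.-integrable `[a, b[ (EFin \o g).
  have igT : lebesgue_measure.-integrable setT (EFin \o g).
    apply/integrableP; split; first exact/measurable_EFinP.
    under eq_integral => x _ do rewrite gee0_abs ?lee_fin//.
    by rewrite g1 ltry.
  by apply: integrableS igT.
have IP (e : R) : (\int[lebesgue_measure]_(x in `[a, b[) ((p + e *: 'X)^`().[x])%:E =
    (p.[b] - p.[a] + e * (b - a))%:E)%E.
  rewrite integral_poly//; congr (_%:E); rewrite !hornerE; ring.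
have mI : measurable (`[a, b[ : set R) by exact: measurable_itv.
have h2 : mass g `[a, b[ <= p.[b] - p.[a] + eps * (b - a).
  rewrite -lee_fin -(mass_integral dg mI) -IP; apply: le_integral => //; first exact: ip.
  move=> x; rewrite inE /= in_itv/= => xab; rewrite lee_fin derivD derivZ derivX.
  by have := gp x xab; rewrite !hornerE ler_norml; lra.
have h1 : p.[b] - p.[a] + (- eps) * (b - a) <= mass g `[a, b[.
  rewrite -lee_fin -(mass_integral dg mI) -IP; apply: le_integral => //; first exact: ip.
  move=> x; rewrite inE /= in_itv/= => xab; rewrite lee_fin derivD derivZ derivX.
  by have := gp x xab; rewrite !hornerE ler_norml; lra.
by rewrite ler_norml; lra.
Qed.

End cells.

(** * Bias of the smoothed densities *)

Section bias.
Variables (R : realType) (s : R) (f : R -> R).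
Hypotheses (s0 : 0 < s) (hf : holder s f) (df : is_density_lebesgue f).

Let k := Num.truncn s.

Lemma truncn_bounds : k%:R <= s < k.+1%:R.
Proof. by have := truncn_itv (ltW s0). Qed.

(** For an integer [s] the exponent is 0 and boundedness of the top derivative gives [2 * M0];
    otherwise this is the Hölder condition. *)
Lemma holder_modulus : exists2 M : R, 0 <= M & forall rho x y, 0 < rho <= 1 ->
  `|y - x| <= rho -> `|derive1n k f y - derive1n k f x| <= M * rho `^ (s - k%:R).
Proof.
have [_ [[_ [M0 hM0]] hM]] := hf; rewrite -/k in hM0 hM.
have M00 : 0 <= M0 := le_trans (normr_ge0 _) (hM0 0).
have /andP[] := truncn_bounds; rewrite -subr_ge0 le_eqVlt => /predU1P[sk _|sk _].
  exists (2 * M0) => [|rho x y r0 _]; first by rewrite mulr_ge0.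
  rewrite -sk powRr0 mulr1 (le_trans (ler_normB _ _))//.
  by have := hM0 x; have := hM0 y; lra.
have [M1 hM1] := hM sk.
exists `|M1| => // rho x y /andP[r0 r1] yx.
have [->|nyx] := eqVneq y x.
  by rewrite subrr normr0 mulr_ge0// powR_ge0.
apply: (le_trans (hM1 _ _ _)); first by rewrite normr_gt0 subr_eq0 nyx (le_trans yx).
apply: (@le_trans _ _ (`|M1| * `|y - x| `^ (s - k%:R))).
  by rewrite ler_wpM2r ?powR_ge0// ler_norm.
by rewrite ler_wpM2l// ge0_ler_powR ?nnegrE// ltW.
Qed.

Lemma holder_continuous : continuous f.
Proof.
have [hd [[hc _] _]] := hf; rewrite -/k in hd hc.
case: k hd hc => [_ //|k'] hd _ x.
by apply: differentiable_continuous; apply/derivable1_diffP; exact: (hd 0%N).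
Qed.

Variable q : 'I_k.+1 -> {poly R}.
Hypothesis qP : forall S : {poly R}, (size S <= k.+2)%N -> forall t,
  \sum_i (q i).[t] * (S.[i.+1%:R] - S.[i%:R]) = S^`().[t].

(** Smoothing is exact on the cell integrals of the Taylor polynomial at [x], so only the smoothed
    remainder is left. The cells involved have indices from [floor (x / h)] to
    [floor (x / h) + k + 1], hence lie within [rho = (k + 2) h] of [x]. *)
Lemma smooth_bias : exists2 C : R, 0 < C & forall h x, 0 < h -> k.+2%:R * h <= 1 ->
  `|h^-1 * smooth q (fun z => mass f (cell h z)) (x / h) - f x| <= C * h `^ s.
Proof.
have [M M0 hM] := holder_modulus.
pose C0 := smooth_norm q * (M * k.+2%:R `^ s).
have C00 : 0 <= C0 by rewrite !mulr_ge0 ?smooth_norm_ge0 ?powR_ge0.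
exists (C0 + 1) => [|h x h0 h1]; first by lra.
set rho := k.+2%:R * h.
have r0 : 0 < rho by rewrite mulr_gt0.
have r01 : 0 < rho <= 1 by rewrite r0.
have [p [sp px pB]] := @taylor_poly _ k f x rho _ hf.1 (fun y => hM rho x y r01).
have rs : M * rho `^ (s - k%:R) * rho ^+ k = M * rho `^ s.
  rewrite -mulrA; congr (_ * _); rewrite -powR_mulrn ?ltW// -powRD ?subrK//.
  by rewrite gt_eqF ?implybT.
rewrite rs in pB.
(* Scaled so that [h] times its increment over [[z, z + 1]] is the integral of [p] over cell [z],
   while its derivative at [x / h] is [p(x) = f x]. *)
pose S : {poly R} := h^-1 *: (primitive p \Po (h *: 'X)).
have sX : size (h *: 'X : {poly R}) = 2%N.
  by rewrite size_scale ?size_polyX// gt_eqF.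
have sS : (size S <= k.+2)%N.
  rewrite (leq_trans (size_scale_leq _ _))// size_comp_poly2//.
  by rewrite (leq_trans (size_primitive _)).
have Sx u : S.[u] = h^-1 * (primitive p).[h * u].
  by rewrite /S hornerZ horner_comp hornerZ hornerX.
have S'x : S^`().[x / h] = f x.
  rewrite /S derivZ deriv_comp deriv_primitive derivZ derivX alg_polyC.
  rewrite hornerZ hornerM hornerC horner_comp hornerZ hornerX [h * _]mulrC divfK ?gt_eqF//.
  by rewrite px mulrC mulfK// gt_eqF.
have -> : h^-1 * smooth q (fun z => mass f (cell h z)) (x / h) - f x =
    h^-1 * smooth q (fun z => mass f (cell h z) - h * (S.[(z + 1)%:~R] - S.[z%:~R])) (x / h).
  by rewrite smoothB smooth_scale (smooth_increments qP _ sS) S'x mulrBr mulKf// gt_eqF.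
rewrite normrM gtr0_norm ?invr_gt0// mulrC ler_pdivrMr//.
apply: (@le_trans _ _ (smooth_norm q * (M * rho `^ s * h))).
  apply: smooth_bound => n nk.
  set z := Num.floor (x / h) + n%:Z.
  have zh : z%:~R * h < (z + 1)%:~R * h by rewrite ltr_pM2r// ltr_int; lia.
  have -> : M * rho `^ s * h = M * rho `^ s * ((z + 1)%:~R * h - z%:~R * h).
    by rewrite intrD; ring.
  have -> : h * (S.[(z + 1)%:~R] - S.[z%:~R]) =
     (primitive p).[(z + 1)%:~R * h] - (primitive p).[z%:~R * h].
    by rewrite !Sx -mulrBr mulVKf ?gt_eqF// ![h * _]mulrC.
  rewrite cellE//; apply: mass_poly => // y /andP[y1 y2].
  rewrite deriv_primitive; apply: pB.
  have := floor_itv (x / h); rewrite ler_pdivlMr// ltr_pdivrMr// => /andP[x1 x2].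
  move: y1 y2 x2; rewrite /z !intrD -pmulrn => y1 y2 x2.
  have nk' : n%:R * h <= k.+1%:R * h by rewrite ler_wpM2r ?ler_nat// ltW.
  have n0 : 0 <= n%:R * h by rewrite mulr_ge0// ltW.
  rewrite /rho -[k.+2]addn1 natrD ler_norml.
  have k1 : 0 <= k.+1%:R * h by rewrite mulr_ge0// ltW.
  by apply/andP; split; nra.
rewrite /rho powRM ?(ltW h0)//.
have hs := powR_ge0 h s.
have -> : smooth_norm q * (M * (k.+2%:R `^ s * h `^ s) * h) = C0 * h `^ s * h.
  by rewrite /C0; ring.
by rewrite ler_pM2r// ler_wpM2r//; lra.
Qed.

(** For [s >= 1] the Hölder condition bounds only the top derivative. At the fixed bandwidth
    [1 / (k + 2)] the smoothed masses are bounded because [f] integrates to 1, and [smooth_bias]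
    transfers the bound to [f]. *)
Lemma holder_density_bounded : exists2 F : R, 1 <= F & forall x, f x <= F.
Proof.
have [C C0 hC] := smooth_bias.
pose h : R := k.+2%:R^-1.
have h0 : 0 < h by rewrite invr_gt0.
have hV : h^-1 = k.+2%:R by rewrite invrK.
pose F := k.+2%:R * smooth_norm q + C * h `^ s.
have F0 : 0 <= F.
  by rewrite addr_ge0 ?mulr_ge0 ?smooth_norm_ge0 ?powR_ge0// ltW.
exists (F + 1) => [|x]; first by lra.
have := hC h x h0; rewrite mulfV ?pnatr_eq0// lexx hV => /(_ isT).
set S := smooth _ _ _.
have : `|S| <= smooth_norm q * 1.
  apply: smooth_bound => n _; rewrite ger0_norm ?mass_ge0//.
  by apply: mass_le1 => //; exact: measurable_cell.
rewrite mulr1 !ler_norml => /andP[S1 S2] /andP[B1 B2].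
have : k.+2%:R * S <= k.+2%:R * smooth_norm q by rewrite ler_wpM2l.
by rewrite /F; lra.
Qed.

End bias.

Lemma mass_cell_le (R : realType) (f : R -> R) (F h : R) z :
  is_density_lebesgue f -> (forall x, f x <= F) -> 0 < h ->
  mass f (cell h z) <= F * h.
Proof.
move=> df fF h0; rewrite cellE//.
have zh : z%:~R * h < (z + 1)%:~R * h by rewrite ltr_pM2r// ltr_int; lia.
have := @mass_poly _ f 0 _ _ F df zh.
rewrite deriv0 !horner0 subrr subr0 -mulrBl intrD [_ + 1%:~R]addrC addrK mul1r => h1.
apply: (le_trans (ler_norm _)); apply: h1 => x _.
by case: df => _ f0 _; rewrite horner0 subr0 ger0_norm.
Qed.

(** * Stability of the spectral decomposition *)

Section spectral_stability.
Variables (R : realType) (J : nat).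
Implicit Types (A D P G X Y U V : 'M[R]_J) (lam mu : 'I_J -> R) (W : 'I_J -> 'M[R]_J).

Definition mxnorm1 X : R := \sum_a \sum_b `|X a b|.

Lemma mxnorm1_ge0 X : 0 <= mxnorm1 X.
Proof. by apply: sumr_ge0 => a _; apply: sumr_ge0. Qed.

Lemma row_le_mxnorm1 X a : \sum_b `|X a b| <= mxnorm1 X.
Proof.
rewrite /mxnorm1 [leRHS](bigD1 a)//= lerDl sumr_ge0// => c _; exact: sumr_ge0.
Qed.

Lemma col_le_mxnorm1 X b : \sum_a `|X a b| <= mxnorm1 X.
Proof.
apply: ler_sum => a _; rewrite [leRHS](bigD1 b)//= lerDl; exact: sumr_ge0.
Qed.

Lemma entry_le_mxnorm1 X a b : `|X a b| <= mxnorm1 X.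
Proof.
apply: le_trans (row_le_mxnorm1 X a).
by rewrite (bigD1 b)//= lerDl sumr_ge0.
Qed.

Lemma mulmx_entry_le X Y (x y : R) a b : 0 <= x ->
  (forall a b, `|X a b| <= x) -> (forall a b, `|Y a b| <= y) ->
  `|(X *m Y) a b| <= J%:R * (x * y).
Proof.
move=> x0 Xx Yy; rewrite mxE (le_trans (ler_norm_sum _ _ _))//.
rewrite mulr_natl -[X in _ *+ X]card_ord -sumr_const.
by apply: ler_sum => c _; rewrite normrM ler_pM.
Qed.

Lemma conj_entry_le X U V (x : R) a b : (forall a b, `|X a b| <= x) ->
  `|(U *m X *m V) a b| <= mxnorm1 U * mxnorm1 V * x.
Proof.
move=> Xx; have x0 : 0 <= x := le_trans (normr_ge0 _) (Xx a b).
have h c : `|(U *m X) a c| <= mxnorm1 U * x.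
  rewrite mxE (le_trans (ler_norm_sum _ _ _))//.
  apply: (@le_trans _ _ (\sum_e `|U a e| * x)).
    by apply: ler_sum => e _; rewrite normrM ler_wpM2l.
  by rewrite -mulr_suml ler_wpM2r// row_le_mxnorm1.
rewrite mxE (le_trans (ler_norm_sum _ _ _))//.
apply: (@le_trans _ _ (\sum_c mxnorm1 U * x * `|V c b|)).
  by apply: ler_sum => c _; rewrite normrM ler_wpM2r.
rewrite -mulr_sumr [leRHS]mulrAC ler_wpM2l ?col_le_mxnorm1//.
by rewrite mulr_ge0// mxnorm1_ge0.
Qed.

(* [mu] and [W] diagonalize [G] relatively to [P] up to an error [r]: the
   matrices [P *m W j] are nearly the spectral projectors of [G P^-1], for
   eigenvalues [mu j] that are separated by [g] and listed in increasing order. *)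
Definition diagonalizes (r g : R) P G mu W : Prop :=
  [/\ forall a b, `|(\sum_j (P *m W j) - 1%:M) a b| <= r,
      forall j a b, `|(G *m W j - mu j *: (P *m W j)) a b| <= r,
      forall j, `|\tr (P *m W j) - 1| <= r &
      forall j k : 'I_J, (j < k)%N -> mu j + g <= mu k].

(** An error [eta] in the matrices is multiplied by the entries of [W] and, in the eigenvalue
    equation, once more by [mu]: hence [b ^+ 2]. *)
Lemma diagonalizes_perturb (r g eta b : R) P G P' G' mu W :
  0 <= eta -> 1 <= b ->
  (forall x y, `|P x y - P' x y| <= eta) -> (forall x y, `|G x y - G' x y| <= eta) ->
  (forall j x y, `|W j x y| <= b) -> (forall j, `|mu j| <= b) ->
  diagonalizes r g P' G' mu W ->
  diagonalizes (r + 2 * J%:R ^+ 2 * (eta * b ^+ 2)) g P G mu W.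
Proof.
move=> eta0 b1 PP GG Wb mub [h1 h2 h3 h4].
have PW j x y : `|((P - P') *m W j) x y| <= J%:R * (eta * b).
  by apply: mulmx_entry_le => // c e; rewrite !mxE; exact: PP.
have GW j x y : `|((G - G') *m W j) x y| <= J%:R * (eta * b).
  by apply: mulmx_entry_le => // c e; rewrite !mxE; exact: GG.
have eb : 0 <= eta * b by rewrite mulr_ge0//; lra.
have ebb : eta * b <= eta * b ^+ 2 by rewrite expr2 mulrA ler_peMr.
have Jsum (F : 'I_J -> R) x : (forall j, `|F j| <= x) -> `|\sum_j F j| <= J%:R * x.
  move=> Fx; rewrite (le_trans (ler_norm_sum _ _ _))//.
  by rewrite mulr_natl -[X in _ *+ X]card_ord -sumr_const ler_sum.
have small : J%:R * (J%:R * (eta * b)) <= 2 * J%:R ^+ 2 * (eta * b ^+ 2).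
  by have := sqr_ge0 (J%:R : R); rewrite mulrA -expr2; nra.
split=> //.
- move=> x y.
  have -> : (\sum_j (P *m W j) - 1%:M) x y =
      (\sum_j (P' *m W j) - 1%:M) x y + \sum_j ((P - P') *m W j) x y.
    rewrite !mxE !summxE [RHS]addrAC -big_split /=; congr (_ - _); apply: eq_bigr => j _.
    by rewrite mulmxBl !mxE addrC subrK.
  rewrite (le_trans (ler_normD _ _))// lerD//.
  by apply: le_trans small; apply: Jsum.
- move=> j x y.
  have -> : (G *m W j - mu j *: (P *m W j)) x y =
      (G' *m W j - mu j *: (P' *m W j)) x y +
      (((G - G') *m W j) x y - mu j * ((P - P') *m W j) x y).
    by rewrite !mulmxBl !mxE; ring.
  rewrite (le_trans (ler_normD _ _))// lerD//.
  rewrite (le_trans (ler_normB _ _))// normrM.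
  have J1 : 1 <= J%:R :> R by rewrite ler1n (leq_trans _ (ltn_ord j)).
  have m1 : `|mu j| * `|((P - P') *m W j) x y| <= b * (J%:R * (eta * b)) by rewrite ler_pM.
  apply: (le_trans (lerD (GW j x y) m1)).
  have e2 : 0 <= eta * b ^+ 2 by rewrite mulr_ge0// sqr_ge0.
  have -> : b * (J%:R * (eta * b)) = J%:R * (eta * b ^+ 2) by ring.
  have h5 : J%:R * (eta * b) <= J%:R * (eta * b ^+ 2) by rewrite ler_wpM2l.
  have h6 : J%:R * (eta * b ^+ 2) <= J%:R ^+ 2 * (eta * b ^+ 2).
    by rewrite ler_wpM2r// expr2 ler_peMl.
  by lra.
- move=> j.
  have -> : \tr (P *m W j) - 1 = \tr (P' *m W j) - 1 + \tr ((P - P') *m W j).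
    by rewrite mulmxBl linearB /=; ring.
  rewrite (le_trans (ler_normD _ _))// lerD//.
  by apply: le_trans small; apply: Jsum.
Qed.

(** A left null vector [v] of [P] satisfies [v *m (\sum_j P *m W j - 1) = - v], so that matrix
    cannot have arbitrarily small entries. *)
Lemma diagonalizes_singular P : P \notin unitmx -> exists2 r0 : R, 0 < r0 &
  forall r g G mu W, r <= r0 -> ~ diagonalizes r g P G mu W.
Proof.
rewrite -row_free_unit -kermx_eq0 => /rowV0Pn[v vk v0].
have vP : v *m P = 0 by apply/sub_kermxP.
pose n := \sum_a `|v 0 a|.
have [a va] : exists a, v 0 a != 0.
  apply/existsP; apply: contraNT v0; rewrite negb_exists => /forallP h.
  by apply/eqP/rowP => a; have := h a; rewrite negbK mxE => /eqP.
have n0 : 0 < n.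
  by rewrite /n (bigD1 a)//= ltr_pwDl ?normr_gt0// sumr_ge0.
exists (`|v 0 a| / (2 * n)) => [|r g G mu W rr [h1 _ _ _]].
  by rewrite divr_gt0 ?mulr_gt0// normr_gt0.
set X := \sum_j _ - 1%:M in h1.
have : v *m X = - v.
  rewrite /X mulmxBr mulmx1 mulmx_sumr big1 ?sub0r// => j _.
  by rewrite mulmxA vP mul0mx.
move/(congr1 (fun x : 'rV[R]_J => `|x 0 a|)); rewrite [in RHS]mxE normrN => e.
have : `|v 0 a| <= n * (`|v 0 a| / (2 * n)).
  rewrite -{1}e mxE (le_trans (ler_norm_sum _ _ _))// /n mulr_suml.
  by apply: ler_sum => b _; rewrite normrM ler_wpM2l// (le_trans (h1 _ _)).
have -> : n * (`|v 0 a| / (2 * n)) = `|v 0 a| / 2 by field; rewrite gt_eqF.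
by rewrite -normr_gt0 in va; lra.
Qed.

Section diagonalizable.
Variables (A D : 'M[R]_J) (lam : 'I_J -> R).
Hypotheses (Au : A \in unitmx) (Du : D \in unitmx).

Let P := A *m D.
Let G := A *m diag_mx (\row_i lam i) *m D.
Let kap := mxnorm1 (invmx A) * mxnorm1 A.

(** Conjugation by [A] turns [G P^-1] into the diagonal matrix of [lam], so the eigenvalue equation
    decouples entry by entry. The trace is invariant, which is why the last bound has no factor
    [kap]. *)
Lemma diagonalizes_conj r g mu W (Y := fun j => D *m W j *m A) :
  diagonalizes r g P G mu W ->
  [/\ forall a b, `|(\sum_j Y j - 1%:M) a b| <= kap * r,
      forall j i k, `|(lam i - mu j) * Y j i k| <= kap * r &
      forall j, `|\tr (Y j) - 1| <= r].
Proof.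
move=> [h1 h2 h3 _].
have cj j : invmx A *m (P *m W j) *m A = Y j.
  by rewrite /P -!mulmxA mulKmx// mulmxA.
split.
- move=> a b; have -> : \sum_j Y j - 1%:M = invmx A *m (\sum_j (P *m W j) - 1%:M) *m A.
    rewrite mulmxBr mulmxBl mulmx1 mulVmx// mulmx_sumr mulmx_suml.
    by congr (_ - _); apply: eq_bigr => j _; rewrite cj.
  by apply: conj_entry_le.
- move=> j i k.
  have -> : (lam i - mu j) * Y j i k =
      (invmx A *m (G *m W j - mu j *: (P *m W j)) *m A) i k.
    rewrite mulmxBr mulmxBl -scalemxAr -scalemxAl cj.
    have -> : invmx A *m (G *m W j) *m A = diag_mx (\row_i lam i) *m Y j.
      by rewrite /G /Y -!mulmxA mulKmx// !mulmxA.
    by rewrite mul_diag_mx !mxE mulrBl.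
  by apply: conj_entry_le.
- by move=> j; rewrite -cj mxtrace_mulC mulKVmx.
Qed.

Lemma kap_ge0 : 0 <= kap.
Proof. by rewrite mulr_ge0 ?mxnorm1_ge0. Qed.

Let rad r := 2 * J%:R * (kap * r).

(** The trace of [Y j = D *m W j *m A] is near 1, so one of its diagonal entries exceeds
    [1 / (2 J)]; dividing the bound on [(lam i - mu j) * Y j i i] by that entry produces the factor
    [2 J] of [rad]. *)
Lemma near_eigenvalue r g mu W : r <= 1 / 4 -> diagonalizes r g P G mu W ->
  exists i : 'I_J -> 'I_J, forall j, `|lam (i j) - mu j| <= rad r.
Proof.
move=> r2 /diagonalizes_conj[_ h2 h3].
suff /choice[i hi] : forall j, exists i, `|lam i - mu j| <= rad r by exists i.
move=> j; apply: contrapT => /forallNP far.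
have J0 : 0 < J%:R :> R by rewrite ltr0n (leq_trans _ (ltn_ord j)).
have Ysmall i : `|(D *m W j *m A) i i| <= 1 / (2 * J%:R).
  rewrite leNgt; apply/negP => Yi; apply: (far i).
  have := h2 j i i; rewrite normrM.
  have := normr_ge0 (lam i - mu j).
  rewrite /rad; set l := `|lam i - mu j|; set y := `|_| in Yi * => l0 ly.
  have : l * (1 / (2 * J%:R)) <= kap * r by rewrite (le_trans _ ly)// ler_wpM2l// ltW.
  by rewrite mul1r ler_pdivrMr ?mulr_gt0// mulrC.
have : `|\tr (D *m W j *m A)| <= 1 / 2.
  rewrite /mxtrace (le_trans (ler_norm_sum _ _ _))//.
  apply: (@le_trans _ _ (\sum_(i < J) 1 / (2 * J%:R))); first exact: ler_sum.
  rewrite sumr_const card_ord -[_ *+ J]mulr_natl.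
  have -> : J%:R * (1 / (2 * J%:R)) = 1 / 2 :> R by field; rewrite gt_eqF.
  by [].
by have := h3 j; rewrite !ler_norml; lra.
Qed.

Lemma increasing_eigenvalues r g mu W : r <= 1 / 4 -> 2 * rad r < g ->
  diagonalizes r g P G mu W ->
  exists i : 'I_J -> 'I_J, (forall j, `|lam (i j) - mu j| <= rad r) /\
    (forall j k : 'I_J, (j < k)%N -> lam (i j) < lam (i k)).
Proof.
move=> r2 rg h; have [i hi] := near_eigenvalue r2 h; exists i; split=> // j k jk.
have [_ _ _ /(_ j k jk) h4] := h.
by have := hi j; have := hi k; rewrite !ler_norml; lra.
Qed.

(** The [J] separated values [mu j] have distinct eigenvalues near them, so [lam] takes [J] values.
    A double eigenvalue thus excludes every gap beyond [2 * rad r]. *)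
Lemma diagonalizes_eigenvalues_inj r g mu W : r <= 1 / 4 -> 2 * rad r < g ->
  diagonalizes r g P G mu W -> injective lam.
Proof.
move=> r2 rg h; have [i [_ li]] := increasing_eigenvalues r2 rg h.
have lii : injective (lam \o i).
  move=> j k /= e; apply: ord_inj.
  by case: (ltngtP j k) => // /li; rewrite e ltxx.
have iinj : injective i by move=> j k e; apply: lii; rewrite /= e.
have [i' ii' i'i] := injF_bij iinj.
by move=> a b; rewrite -(i'i a) -(i'i b) => /lii ->.
Qed.

End diagonalizable.

(** Strict increase forces [j <= s j]; the same bound for the map conjugated by [rev_ord] gives
    [s j <= j]. *)
Lemma increasing_ord_id (s : 'I_J -> 'I_J) :
  (forall j k : 'I_J, (j < k)%N -> (s j < s k)%N) -> forall j, s j = j.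
Proof.
have ge (t : 'I_J -> 'I_J) : (forall j k : 'I_J, (j < k)%N -> (t j < t k)%N) ->
    forall j : 'I_J, (j <= t j)%N.
  move=> ht; suff h n (nJ : (n < J)%N) : (n <= t (Ordinal nJ))%N.
    by move=> [j jJ]; exact: h.
  elim: n nJ => // n IH nJ; have nJ' : (n < J)%N by exact: ltnW.
  exact: leq_ltn_trans (IH nJ') (ht (Ordinal nJ') (Ordinal nJ) (ltnSn n)).
move=> hs j; apply: ord_inj; apply/eqP; rewrite eqn_leq (ge s hs) andbT.
have := ge (fun j => rev_ord (s (rev_ord j))) _ (rev_ord j).
rewrite rev_ordK /=; have := ltn_ord j; have := ltn_ord (s j).
move=> h1 h2 h; have : (J - j.+1 <= J - (s j).+1)%N; last by lia.
apply: h => a b ab /=; have := hs (rev_ord b) (rev_ord a) => /=.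
have := ltn_ord a; have := ltn_ord b.
have := ltn_ord (s (rev_ord a)); have := ltn_ord (s (rev_ord b)).
by move=> ? ? ? ? /(_ ltac:(lia)); lia.
Qed.

Section stability.
Variables (A D : 'M[R]_J) (lam : 'I_J -> R) (tau : {perm 'I_J}).
Hypotheses (Au : A \in unitmx) (Du : D \in unitmx).
Hypothesis lam_incr : forall j k : 'I_J, (j < k)%N -> lam (tau j) < lam (tau k).

Let P := A *m D.
Let G := A *m diag_mx (\row_i lam i) *m D.

Definition spectral_weight (j : 'I_J) : 'M[R]_J :=
  invmx D *m delta_mx (tau j) (tau j) *m invmx A.

Lemma spectral_weight_trace (v : 'I_J -> R) j :
  \sum_l \sum_m spectral_weight j m l * (A *m diag_mx (\row_i v i) *m D) l m = v (tau j).
Proof.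
transitivity (\tr (spectral_weight j *m (A *m diag_mx (\row_i v i) *m D))).
  by rewrite /mxtrace exchange_big /=; apply: eq_bigr => m _; rewrite mxE.
rewrite /spectral_weight -!mulmxA (mulKmx Au) mxtrace_mulC !mulmxA (mulmxK Du).
rewrite /mxtrace (bigD1 (tau j))//= mul_mx_diag !mxE !eqxx mul1r.
rewrite big1 ?addr0// => i ij.
by rewrite mxE mxE (negPf ij) mul0r.
Qed.

Lemma spectral_weight_diagonalizes : exists2 g0 : R, 0 < g0 & forall g, g <= g0 ->
  diagonalizes 0 g P G (lam \o tau) spectral_weight.
Proof.
pose g0 := \big[Num.min/1]_(j : 'I_J) \big[Num.min/1]_(k : 'I_J | (j < k)%N)
   (lam (tau k) - lam (tau j)).
exists g0 => [|g gg0].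
  apply: (big_ind (fun x => 0 < x)) => // [x y x0 y0|j _]; first by rewrite lt_min x0.
  apply: (big_ind (fun x => 0 < x)) => // [x y x0 y0|k jk]; first by rewrite lt_min x0.
  by rewrite subr_gt0 lam_incr.
have PW j : P *m spectral_weight j = A *m delta_mx (tau j) (tau j) *m invmx A.
  by rewrite /P /spectral_weight -!mulmxA (mulKVmx Du) !mulmxA.
split.
- move=> a b; suff -> : \sum_j (P *m spectral_weight j) = 1%:M.
    by rewrite !mxE subrr normr0.
  under eq_bigr do rewrite PW.
  rewrite -mulmx_suml -mulmx_sumr.
  suff -> : \sum_j delta_mx (tau j) (tau j) = 1%:M :> 'M[R]_J by rewrite mulmx1 mulmxV.
  apply/matrixP => x y; rewrite summxE (bigD1 ((tau^-1)%g x))//= !mxE permKV eqxx /=.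
  rewrite big1 ?addr0 1?eq_sym// => k kx.
  by rewrite mxE -(inj_eq (@perm_inj _ (tau^-1)%g)) permK eq_sym (negPf kx).
- move=> j a b; suff -> : G *m spectral_weight j = (lam \o tau) j *: (P *m spectral_weight j).
    by rewrite !mxE subrr normr0.
  rewrite PW /G /spectral_weight -!mulmxA (mulKVmx Du) scalemxAr; congr (A *m _).
  rewrite !mulmxA scalemxAl; congr (_ *m _).
  apply/matrixP => x y; rewrite mul_diag_mx !mxE /=.
  by case: (eqVneq x (tau j)) => [->|_]; rewrite ?mulr0.
- move=> j; rewrite PW mxtrace_mulC mulmxA mulVmx// mul1mx.
  rewrite /mxtrace (bigD1 (tau j))//= mxE eqxx big1 ?addr0 ?subrr ?normr0// => k kj.
  by rewrite mxE (negPf kj).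
- move=> j k jk /=; rewrite addrC -lerBrDr (le_trans gg0)// /g0.
  by rewrite (bigD1 j)//= ge_min (bigD1 k)//= ge_min lexx.
Qed.

(** The increasing lists [mu] and [lam \o tau] match index by index. Row [x] of [Y j] is small for
    [x != tau j], because [lam x] stays away from [mu j]; row [tau j] is then known from the sum of
    all [Y k], which is nearly the identity. Undoing the conjugation yields [W j]. *)
Lemma diagonalizes_stable : exists C r0 : R, [/\ 0 < C, 0 < r0 &
  forall r g mu W, 0 <= r -> r <= r0 -> C * r < g -> diagonalizes r g P G mu W ->
  forall j a b, `|W j a b - spectral_weight j a b| <= C * r].
Proof.
pose kap := mxnorm1 (invmx A) * mxnorm1 A.
have kap0 : 0 <= kap by exact: kap_ge0.
have tau_inj : injective (lam \o tau).
  move=> j k /= e; apply: ord_inj.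
  by case: (ltngtP j k) => // /lam_incr; rewrite e ltxx.
have lam_inj : injective lam.
  move=> a b e; rewrite -(permKV tau a) -(permKV tau b); congr (tau _).
  by apply: tau_inj; rewrite /= !permKV.
pose del := \big[Num.min/1]_(i : 'I_J) \big[Num.min/1]_(k : 'I_J | i != k) `|lam i - lam k|.
have del0 : 0 < del.
  apply: (big_ind (fun x => 0 < x)) => // [x y x0 y0|i _]; first by rewrite lt_min x0.
  apply: (big_ind (fun x => 0 < x)) => // [x y x0 y0|k ik]; first by rewrite lt_min x0.
  by rewrite normr_gt0 subr_eq0 (inj_eq lam_inj).
have hdel i k : i != k -> del <= `|lam i - lam k|.
  by move=> ik; rewrite /del (bigD1 i)//= ge_min (bigD1 k)//= ge_min lexx.
pose CY := kap * (1 + 2 * J%:R / del).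
pose nn := mxnorm1 (invmx D) * mxnorm1 (invmx A).
have J0 : 0 <= J%:R :> R by [].
have CY0 : 0 <= CY by rewrite mulr_ge0// addr_ge0// divr_ge0 ?mulr_ge0// ltW.
have nn0 : 0 <= nn by rewrite mulr_ge0 ?mxnorm1_ge0.
(* [nn * CY] is the error constant; [4 * J * kap] lets [C * r < g] imply the gap condition of
   [increasing_eigenvalues]. *)
pose C := nn * CY + 4 * J%:R * kap + 1.
pose C1 := 4 * J%:R * kap + 1.
have C1p : 0 < C1 by rewrite /C1 ltr_wpDl // mulr_ge0 // mulr_ge0.
exists C, (Num.min (1 / 4) (del / (2 * C1))); split.
- by rewrite /C -addrA ltr_wpDl // mulr_ge0.
- by rewrite lt_min !divr_gt0 ?mulr_gt0.
move=> r g mu W r0; rewrite le_min => /andP[r4 rdel] Cg h.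
have Jkr : 0 <= J%:R * kap * r by rewrite mulr_ge0 // mulr_ge0.
have C1r : C1 * r <= del / 2.
  by move: rdel; rewrite !ler_pdivlMr ?mulr_gt0//; lra.
have nCr : 0 <= nn * CY * r by rewrite mulr_ge0 // mulr_ge0.
have rg : 2 * (2 * J%:R * (kap * r)) < g.
  by apply: le_lt_trans Cg; rewrite /C; lra.
have [i [hi li]] := increasing_eigenvalues Au r4 rg h.
rewrite -/kap in hi.
have itau j : i j = tau j.
  have hs : forall j k : 'I_J, (j < k)%N -> ((tau^-1)%g (i j) < (tau^-1)%g (i k))%N.
    move=> a b /li lab; rewrite ltnNge; apply/negP.
    rewrite leq_eqVlt => /predU1P[e|/lam_incr]; last by rewrite !permKV ltNge ltW.
    by move: lab; rewrite -(permKV tau (i a)) -(permKV tau (i b)) (val_inj e) ltxx.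
  by rewrite -[LHS](permKV tau) (increasing_ord_id hs).
have [h1 h2 _] := diagonalizes_conj Au h.
rewrite -/kap in h1 h2.
pose Y j := D *m W j *m A.
have off j x y : x != tau j -> `|Y j x y| <= 2 * kap * r / del.
  move=> xj; have := h2 j x y; rewrite -/(Y j) normrM => le1.
  have d1 := hdel _ _ xj.
  have d2 : `|lam x - lam (tau j)| <= `|lam x - mu j| + `|lam (i j) - mu j|.
    by rewrite itau [`|lam (tau j) - _|]distrC; exact: ler_distD.
  have d3 : del / 2 <= `|lam x - mu j|.
    by have := hi j; move: C1r; rewrite /C1; lra.
  rewrite ler_pdivlMr//.
  have : del / 2 * `|Y j x y| <= kap * r by rewrite (le_trans _ le1)// ler_wpM2r.
  by lra.
have Yb j x y : `|Y j x y - (x == tau j)%:R * (y == tau j)%:R| <= CY * r.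
  have pd : 0 <= 2 * kap * r / del.
    by rewrite divr_ge0 ?(ltW del0)// mulr_ge0// mulr_ge0.
  have [xj|xj] := eqVneq x (tau j); last first.
    rewrite mul0r subr0 (le_trans (off _ _ _ xj))// /CY.
    have kr : 0 <= kap * r by rewrite mulr_ge0.
    have J1 : 1 <= J%:R :> R by rewrite ler1n (leq_trans _ (ltn_ord j)).
    have -> : kap * (1 + 2 * J%:R / del) * r = kap * r + J%:R * (2 * kap * r / del) by ring.
    have : 2 * kap * r / del <= J%:R * (2 * kap * r / del) by rewrite ler_peMl.
    by lra.
  have -> : Y j x y - 1%:R * (y == tau j)%:R =
      (\sum_k Y k - 1%:M) x y - \sum_(k | k != j) Y k x y.
    have -> : (\sum_k Y k - 1%:M) x y = \sum_k Y k x y - (x == y)%:R.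
      by rewrite [LHS]mxE summxE; congr (_ + _); rewrite !mxE.
    by rewrite (bigD1 j)//= xj [tau j == y]eq_sym; ring.
  have -> : CY * r = kap * r + J%:R * (2 * kap * r / del) by rewrite /CY; ring.
  rewrite (le_trans (ler_normB _ _))// lerD//.
  rewrite (le_trans (ler_norm_sum _ _ _))//.
  rewrite mulr_natl -[X in _ *+ X]card_ord -sumr_const [leRHS](bigID (fun k => k != j))/=.
  rewrite -[leLHS]addr0 lerD ?sumr_ge0//.
  apply: ler_sum => k kj; apply: off; rewrite xj (inj_eq perm_inj) eq_sym//.
move=> j a b.
have -> : W j a b - spectral_weight j a b =
    (invmx D *m (Y j - delta_mx (tau j) (tau j)) *m invmx A) a b.
  have -> : invmx D *m (Y j - delta_mx (tau j) (tau j)) *m invmx A =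
      W j - spectral_weight j.
    rewrite mulmxBr mulmxBl; congr (_ - _).
    by rewrite /Y -!mulmxA mulmxV// mulmx1 mulKmx.
  by rewrite !mxE.
apply: (@le_trans _ _ (nn * (CY * r))).
  apply: conj_entry_le => x y; apply: le_trans (Yb j x y).
  rewrite -natrM mulnb (_ : _%:R = delta_mx (tau j) (tau j) x y); last by rewrite mxE.
  by rewrite [X in `|X| <= _]mxE [X in _ + X]mxE.
by rewrite mulrA /C; lra.
Qed.

End stability.
End spectral_stability.

(** * Separating test points *)

Section test_points.
Variables (R : realType) (J : nat) (f : 'I_J -> R -> R).
Hypotheses (df : forall j, is_density_lebesgue (f j)).
Hypotheses (cf : forall j, continuous (f j)) (lf : assumption_A3 f).

Definition below (a : R) : set R := [set x | x < a].

Lemma measurable_below a : measurable (below a).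
Proof.
rewrite (_ : below a = `]-oo, a[%classic); first exact: measurable_itv.
by apply/seteqP; split=> x /=; rewrite in_itv.
Qed.

Lemma mass_below_itv (g : R -> R) a b : is_density_lebesgue g -> a <= b ->
  mass g `[a, b[ = mass g (below b) - mass g (below a).
Proof.
move=> dg ab; apply/eqP; rewrite eq_sym subr_eq; apply/eqP/EFin_inj.
have mab : measurable (`[a, b[ : set R) by exact: measurable_itv.
rewrite EFinD -!mass_integral//; try exact: measurable_below.
have -> : below b = `[a, b[ `|` below a.
  apply/seteqP; split=> x /=; rewrite in_itv/= /below/=.
    by have [?|?] := ltP x a; [right|left].
  by case=> [/andP[]//|/lt_le_trans]; apply.
have [mg _ _] := dg.
rewrite integral_setU//; first exact: measurable_below.
- by apply/measurable_EFinP; apply: measurable_funTS.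
- apply/disj_setPS => x [/=]; rewrite in_itv/= /below/= => /andP[+ _].
  by rewrite leNgt => /negP.
Qed.

(** The relation passes to increments over short rational intervals around [x]. By continuity each
    increment is [f j x] times the length, up to [e / n] times the length, so the combination of the
    [f j x] is at most [e] in absolute value for every [e > 0]. *)
Lemma linear_relation_densities (c : 'I_J -> R) :
  (forall a : rat, \sum_j c j * mass (f j) (below (ratr a)) = 0) ->
  forall j, c j = 0.
Proof.
move=> hc; apply: lf => x.
set S := \sum_j _; pose n := \sum_j `|c j| + 1.
have n0 : 0 < n by rewrite ltr_wpDl// sumr_ge0.
apply/eqP; rewrite -normr_le0; apply/ler_addgt0Pr => e e0; rewrite add0r.
have en : 0 < e / n by rewrite divr_gt0.
have : \forall y \near x, forall j, `|f j x - f j y| <= e / n.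
  apply: (@filter_forall _ 'I_J (fun j => [set y | `|f j x - f j y| <= e / n]) _ (nbhs_filter x)) => j.
  by have /cvgrPdist_le/(_ _ en) : f j y @[y --> x] --> f j x by exact: cf.
move=> /nbhs_ballP[d /= d0 hd].
have xd : x - d < x + d by lra.
have [a] := rat_in_itvoo xd; rewrite in_itv/= => /andP[a1 a2].
have [b] := rat_in_itvoo a2; rewrite in_itv/= => /andP[b1 b2].
have fb j : `|mass (f j) `[ratr a, ratr b[ - f j x * (ratr b - ratr a)| <=
    e / n * (ratr b - ratr a).
  have -> : f j x * (ratr b - ratr a) =
      (f j x *: 'X : {poly R}).[ratr b] - (f j x *: 'X : {poly R}).[ratr a].
    by rewrite !hornerZ !hornerX mulrBr.
  apply: mass_poly => // y /andP[y1 y2].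
  rewrite derivZ derivX alg_polyC hornerC distrC; apply: hd.
  by rewrite /ball/= ltr_norml; lra.
have ba : 0 < ratr b - ratr a :> R by rewrite subr_gt0.
have e1 : S * (ratr b - ratr a) =
    \sum_j c j * (f j x * (ratr b - ratr a) - mass (f j) `[ratr a, ratr b[).
  have z : \sum_j c j * mass (f j) `[ratr a, ratr b[ = 0.
    under eq_bigr do rewrite mass_below_itv ?(ltW b1)// mulrBr.
    by rewrite sumrB !hc subrr.
  rewrite /S mulr_suml; under [RHS]eq_bigr do rewrite mulrBr.
  by rewrite sumrB z subr0; apply: eq_bigr => j _; rewrite mulrA.
rewrite -(ler_pM2r ba) -{1}(gtr0_norm ba) -normrM e1.
rewrite (le_trans (ler_norm_sum _ _ _))//.
apply: (@le_trans _ _ (\sum_j `|c j| * (e / n * (ratr b - ratr a)))).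
  by apply: ler_sum => j _; rewrite normrM distrC ler_wpM2l.
rewrite -mulr_suml mulrA ler_pM2r// mulrA ler_pdivrMr// mulrC ler_pM2l//.
by rewrite /n lerDl.
Qed.

(** Greedy choice: while [n < J], a nonzero column [c] is annihilated by the [n] rows found so far.
    By [linear_relation_densities] some rational threshold gives a row that does not annihilate [c],
    hence lies outside their span. *)
Lemma exists_test_points : exists a : 'I_J -> rat,
  \matrix_(j, l) mass (f j) (below (ratr (a l))) \in unitmx.
Proof.
pose u (r : rat) : 'rV[R]_J := \row_j mass (f j) (below (ratr r)).
suff [a ha] : exists a : 'I_J -> rat, \rank (\matrix_(l < J, j < J) u (a l) 0 j) = J.
  exists a; rewrite -unitmx_tr -row_free_unit -row_leq_rank -{1}ha.
  by apply: eq_leq; congr (\rank _); apply/matrixP => l j; rewrite !mxE.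
suff h n : (n <= J)%N -> exists a : 'I_n -> rat,
    \rank (\matrix_(l < n, j < J) u (a l) 0 j) = n by exact: (h J (leqnn J)).
elim: n => [_|n IH nJ].
  by exists (fun=> 0); apply/eqP; rewrite -leqn0 rank_leq_row.
have [a ha] := IH (ltnW nJ).
set A := \matrix_(l, j) _ in ha.
have [c c0 Ac] : exists2 c : 'cV[R]_J, c != 0 & A *m c = 0.
  have cA : cokermx A != 0 by rewrite -mxrank_eq0 mxrank_coker ha subn_eq0 -ltnNge.
  have [j cj] : exists j, col j (cokermx A) != 0.
    apply/existsP; apply: contraNT cA; rewrite negb_exists => /forallP h.
    apply/eqP/matrixP => x y; have := h y; rewrite negbK => /eqP/matrixP/(_ x 0).
    by rewrite !mxE.
  exists (col j (cokermx A)) => //; apply/matrixP => x y.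
  transitivity ((A *m cokermx A) x j); last by rewrite mulmx_coker !mxE.
  by rewrite [LHS]mxE [RHS]mxE; apply: eq_bigr => l _; rewrite [X in _ * X]mxE.
have [r ur] : exists r : rat, u r *m c != 0.
  apply: contrapT => /forallNP h; move/eqP: c0; apply.
  apply/matrixP => j y; rewrite [y]ord1 [RHS]mxE.
  apply: (linear_relation_densities (c := fun j => c j 0)) => r.
  have /negP := h r; rewrite negbK => /eqP/matrixP/(_ 0 0); rewrite !mxE => ur0; rewrite -[RHS]ur0.
  by apply: eq_bigr => l _; rewrite mxE mulrC.
exists (fun l : 'I_n.+1 => if unlift ord0 l is Some l' then a l' else r).
set B := \matrix_(l, j) _.
have BE : B = col_mx (u r) A.
  apply/matrixP => l j; rewrite /B mxE.
  case: (unliftP ord0 l) => [l' ->|->].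
    have -> : lift ord0 l' = rshift 1 l' by exact: val_inj.
    by etransitivity; last exact: (esym (col_mxEd (u r) A l' j)); rewrite [RHS]mxE.
  have -> : ord0 = lshift n (ord0 : 'I_1) by exact: val_inj.
  exact: (esym (col_mxEu (u r) A ord0 j)).
have uA : ~~ (u r <= A)%MS.
  by apply: contra ur => /submxP[v ->]; rewrite -mulmxA Ac mulmx0.
have rk : \rank B = \rank (u r + A)%MS by rewrite BE addsmxE.
apply/eqP; rewrite eqn_leq rank_leq_row /= rk -{1}ha.
rewrite ltn_neqAle mxrankS ?addsmxSr// andbT.
rewrite (mxrank_leqif_eq (addsmxSr _ _)).2.
by apply: contra uA => /eqmxP e; rewrite (submx_trans (addsmxSl _ A))// e.
Qed.

End test_points.

Lemma nonroot_natr (R : realType) (p : {poly R}) : p != 0 -> exists t : nat, p.[t%:R] != 0.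
Proof.
move=> p0; apply: contrapT => /forallNP h.
pose rs : seq R := [seq (i%:R : R) | i <- iota 0 (size p)].
have : (size rs < size p)%N.
  apply: max_poly_roots => //.
    by apply/allP => x /mapP[i _ ->]; apply/rootP; have /negP := h i; rewrite negbK => /eqP.
  rewrite map_inj_uniq ?iota_uniq// => i j /eqP; by rewrite eqr_nat => /eqP.
by rewrite size_map size_iota ltnn.
Qed.

(* Powers of [t] turn the rows of [O] into the values at [t] of distinct
   polynomials. *)
Lemma separating_combination (R : realType) (J : nat) (O : 'M[R]_J) :
  O \in unitmx -> exists t : nat, injective (fun j => \sum_(l < J) t%:R ^+ l * O j l).
Proof.
move=> Ou; pose p j : {poly R} := \sum_(l < J) O j l *: 'X^l.
have pc j (l : 'I_J) : (p j)`_l = O j l.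
  rewrite coef_sum (bigD1 l)//= coefZ coefXn eqxx mulr1 big1 ?addr0// => i; rewrite -val_eqE => il.
  by rewrite coefZ coefXn eq_sym (negPf il) mulr0.
have pinj : injective p.
  move=> i j e; apply/eqP; apply: contraTT Ou => ij.
  rewrite unitmxE (determinant_alternate ij) ?unitr0// => l.
  by rewrite -!pc e.
pose T := \prod_(i < J) \prod_(j < J | i != j) (p i - p j).
have [|t] := @nonroot_natr R T.
  rewrite prodf_seq_neq0; apply/allP => i _; rewrite implyTb prodf_seq_neq0.
  apply/allP => j _; apply/implyP => ij.
  by rewrite subr_eq0 (inj_eq pinj).
rewrite /T horner_prod prodf_seq_neq0 => /allP ht; exists t => i j e.
apply/eqP; apply: contraT => ij.
have := ht i (mem_index_enum _); rewrite implyTb horner_prod prodf_seq_neq0.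
move=> /allP/(_ j (mem_index_enum _)); rewrite ij /= hornerD hornerN.
have pt k : (p k).[t%:R] = \sum_(l < J) t%:R ^+ l * O k l.
  rewrite horner_sum; apply: eq_bigr => l _.
  by rewrite hornerZ hornerXn mulrC.
by rewrite !pt e subrr eqxx.
Qed.

(** * Uniform deviations over the cells *)

Section deviations.
Variables (R : realType) (d : measure_display) (Omega : measurableType d).
Variables (P : probability Omega R) (J : nat) (Q : 'M[R]_J) (pi : 'I_J -> R).
Variables (f : 'I_J -> R -> R) (theta : nat -> Omega -> 'I_J).
Variable X : nat -> Omega -> R.
Hypotheses (Qs : stochastic_matrix Q) (ps : prob_vector pi).
Hypothesis df : forall j, is_density_lebesgue (f j).
Hypothesis HMM : is_HMM P Q pi f theta X.
Variables (K : R).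
Hypotheses (K1 : 1 <= K) (hK : poisson_bound Q pi K).

Definition misses M (t : R) (B1 B2 B3 : set R) : set Omega :=
  [set w | M%:R * t <= `|hits X B1 B2 B3 M w - M%:R * blockprob Q pi f B1 B2 B3|].

Lemma measurable_misses M t B1 B2 B3 : measurable B1 -> measurable B2 ->
  measurable B3 -> measurable (misses M t B1 B2 B3).
Proof.
move=> m1 m2 m3; apply: measurable_ge_preimage.
apply: measurableT_comp => //; apply: measurable_funB => //.
exact: (measurable_hits HMM).
Qed.

Lemma expR_ln_powers (N n : nat) : (0 < N)%N ->
  expR (- n%:R * ln N%:R) = (N%:R ^+ n)^-1 :> R.
Proof. by move=> N0; rewrite mulNr expRN expRM_natl lnK// posrE ltr0n. Qed.

(** The threshold leaves an exponent of at most [- 72 q' la^2 M], where [M = N %/ 3]. Since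
    [N <= 6 M] and [q' la^2 N = ln N], this is at most [- 12 ln N]. *)
Lemma misses_rate N (la q q' F : R) B1 B2 B3 :
  measurable B1 -> measurable B2 -> measurable B3 -> (3 <= N)%N ->
  0 < la -> la * (8 * K) <= 1 -> 0 <= q <= 1 -> (forall j, mass (f j) B2 <= q) ->
  q <= F * q' -> 0 <= F -> 0 <= q' -> q' * la ^+ 2 * N%:R = ln N%:R ->
  (P (misses (N %/ 3) ((18 * K * F + 72) * (q' * la)) B1 B2 B3) <=
    (6 * (N%:R ^+ 12)^-1)%:E)%E.
Proof.
move=> m1 m2 m3 N3 la0 laK q01 hq qF F0 q'0 qN.
apply: le_trans (hits_bernstein Qs ps df HMM m1 m2 m3 _ _ K1 hK la0 laK q01 hq) _.
rewrite lee_fin ler_wpM2l// -expR_ln_powers ?(leq_trans _ N3)//.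
rewrite ler_expR.
have L0 : 0 <= ln N%:R :> R by rewrite ln_ge0// ler1n (leq_trans _ N3).
have NM : N%:R <= 6 * (N %/ 3)%:R :> R by rewrite -natrM ler_nat; clear -N3; lia.
set M := (N %/ 3)%:R in NM *.
have M0 : 0 <= M by [].
have s1 : 18 * K * la ^+ 2 * q - la * ((18 * K * F + 72) * (q' * la)) <= - 72 * (q' * la ^+ 2).
  have : 18 * K * la ^+ 2 * q <= 18 * K * la ^+ 2 * (F * q').
    by apply: ler_wpM2l qF; apply: mulr_ge0; [have := K1; lra|exact: sqr_ge0].
  by lra.
apply: (le_trans (ler_wpM2r M0 s1)); rewrite -qN.
have ql : 0 <= q' * la ^+ 2 by apply: mulr_ge0 => //; exact: sqr_ge0.
by have := ler_wpM2l ql NM; lra.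
Qed.

Lemma hits_natr M B1 B2 B3 w : exists n : nat, hits X B1 B2 B3 M w = n%:R.
Proof.
exists (\sum_(n < M) (w \in hit X B1 B2 B3 n))%N.
by rewrite /hits natr_sum; apply: eq_bigr => n _; rewrite indicE.
Qed.

(** As [pi] is bounded below, the law of [X 0] dominates every emission law up to a constant. This
    ties the failure probability of a cell to masses that sum to 1 over the line. *)
Lemma stationary_mass_le (c : R) B j : (forall i, (pi i)^-1 <= c) -> (forall i, 0 < pi i) ->
  measurable B -> mass (f j) B <= c * fine (P (X 0%N @^-1` B)).
Proof.
move=> hc p0 mB.
have -> : X 0%N @^-1` B = window X 0 [:: B] by rewrite window_cons window_nil setIT.
have ml B' : B' \in [:: B] -> measurable B' by rewrite inE => /eqP ->.
rewrite (window_law Qs ps HMM ml) /=.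
under eq_bigr do rewrite trans_cst// mulr1.
apply: (@le_trans _ _ (c * (pi j * mass (f j) B))).
  rewrite mulrA ler_peMl ?mass_ge0// -ler_pdivrMr//.
  by rewrite div1r.
have c0 : 0 <= c by rewrite (le_trans _ (hc j))// invr_ge0 ltW.
rewrite ler_wpM2l// (bigD1 j)//= lerDl sumr_ge0// => i _.
by rewrite mulr_ge0 ?mass_ge0// ltW.
Qed.

(* Cells of mass at least [N^-8] are covered by the Bernstein bound, the others
   only fail if they are hit twice; both probabilities are at most a multiple
   of [N^-3] times the mass of the cell, hence summable over the cells. *)
Lemma cell_misses_rate (c F : R) N (h la t : R) B1 B3 z : (forall i, (pi i)^-1 <= c) ->
  (forall i, 0 < pi i) -> measurable B1 -> measurable B3 ->
  (3 <= N)%N -> 1 <= ln N%:R :> R ->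
  0 < la <= 1 -> la * (8 * K) <= 1 -> 0 < h -> F * h <= 1 -> 1 <= F ->
  (forall j, mass (f j) (cell h z) <= F * h) -> h * la ^+ 2 * N%:R = ln N%:R ->
  (P (misses (N %/ 3) ((18 * K * F + 72) * (h * la)) B1 (cell h z) B3) <=
    ((6 + expR 1) * c * (N%:R ^+ 3)^-1)%:E * P (X 0%N @^-1` (cell h z)))%E.
Proof.
move=> hc p0 m1 m3 N3 L1 /andP[la0 la1] laK h0 Fh F1 hq hN.
have mc := measurable_cell h z.
set px := P (X 0%N @^-1` _).
have mX : measurable (X 0%N @^-1` cell h z).
  by rewrite -[X in measurable X]setTI; case: HMM => mX _; exact: mX.
have fpx : px \is a fin_num by rewrite fin_num_measure.
rewrite -(fineK fpx) -EFinM; set y := fine px.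
have y0 : 0 <= y by rewrite fine_ge0// /px measure_ge0.
pose q := c * y.
have qm j : mass (f j) (cell h z) <= q by exact: stationary_mass_le.
have N1 : 1 <= N%:R :> R by rewrite ler1n (leq_trans _ N3).
have n0 : 0 < N%:R :> R := lt_le_trans ltr01 N1.
have [i0 _|J0] := pickP [pred j : 'I_J | true]; last first.
  by exfalso; move: ps.2; rewrite big1 => [/esym/eqP|j]; [rewrite oner_eq0|have := J0 j].
have c0 : 0 <= c by rewrite (le_trans _ (hc i0))// invr_ge0 ltW.
have q0 : 0 <= q by rewrite mulr_ge0.
have -> : (6 + expR 1) * c * (N%:R ^+ 3)^-1 * y = (6 + expR 1) * ((N%:R ^+ 3)^-1 * q).
  by rewrite /q; ring.
have e0 : 0 <= expR 1 :> R := expR_ge0 1.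
have [qN|qN] := leP (N%:R ^+ 8)^-1 q.
  (* Since 12 exceeds 3 + 8, [N^-12] is at most [N^-3 * N^-8], hence at most [N^-3 * q]. *)
  apply: (@le_trans _ _ (6 * (N%:R ^+ 12)^-1)%:E).
    have F0 : 0 <= F by lra.
    have h0' : 0 <= h by exact: ltW.
    have Fh01 : 0 <= F * h <= 1 by rewrite Fh andbT mulr_ge0.
    exact: (@misses_rate N la (F * h) h F).
  rewrite lee_fin; apply: (@le_trans _ _ (6 * ((N%:R ^+ 3)^-1 * (N%:R ^+ 8)^-1))).
    rewrite ler_wpM2l// -invfM -exprD lef_pV2 ?posrE ?exprn_gt0//.
    by rewrite ler_weXn2l.
  have i3 : 0 <= (N%:R ^+ 3)^-1 :> R by rewrite invr_ge0 exprn_ge0.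
  have := ler_wpM2l i3 qN; have := mulr_ge0 i3 q0.
  by move=> h1; have := mulr_ge0 e0 h1; lra.
(* With at most one hit and an expected count of at most 1 the deviation is at most 1, while the
   threshold is at least 72/6, because [N h la >= N h la^2 = ln N >= 1]. *)
have sub : misses (N %/ 3) ((18 * K * F + 72) * (h * la)) B1 (cell h z) B3 `<=`
    [set w | 2 <= hits X B1 (cell h z) B3 (N %/ 3) w].
  move=> w; rewrite /misses /= => hw; rewrite leNgt; apply/negP => h2; move: hw; apply/negP.
  have [n hn] := hits_natr (N %/ 3) B1 (cell h z) B3 w.
  rewrite hn in h2 *; rewrite -ltNge.
  have n1 : n%:R <= 1 :> R by move: h2; rewrite ltr_nat ltnS -(ler_nat R).
  have p1 := blockprob_ge0 Qs ps df B1 (cell h z) B3.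
  have p2 := blockprob_le Qs ps df m1 m3 qm.
  set p := blockprob _ _ _ _ _ _ in p1 p2 *.
  have Mp : (N %/ 3)%:R * p <= 1.
    apply: (@le_trans _ _ (N%:R * (N%:R ^+ 8)^-1)).
      by rewrite ler_pM// ?ler_nat ?leq_div// ltW// (le_lt_trans p2).
    by rewrite exprS invfM mulVKf ?gt_eqF// invf_le1 ?exprn_gt0// exprn_ege1.
  have Mp0 : 0 <= (N %/ 3)%:R * p by rewrite mulr_ge0.
  have n00 : 0 <= n%:R :> R by [].
  apply: (@le_lt_trans _ _ 1); first by rewrite ler_norml; lra.
  have NM : N%:R <= 6 * (N %/ 3)%:R :> R by rewrite -natrM ler_nat; clear -N3; lia.
  have hl : 0 <= h * la by rewrite mulr_ge0// ltW.
  have s1 : 1 <= N%:R * (h * la).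
    apply: (le_trans L1); rewrite -hN expr2 mulrA mulrC ler_wpM2l// ler_piMr//.
  have s2 : 1 <= 6 * ((N %/ 3)%:R * (h * la)).
    by rewrite (le_trans s1)// [leRHS]mulrA ler_wpM2r.
  have s3 : 0 <= K * F * ((N %/ 3)%:R * (h * la)).
    by apply: mulr_ge0; [apply: mulr_ge0; have := K1; lra|apply: mulr_ge0].
  by lra.
apply: (@le_trans _ _ (P [set w | (2 <= hits X B1 (cell h z) B3 (N %/ 3) w)%R])).
  apply: le_measure; rewrite ?inE//; first exact: measurable_misses.
  by apply: measurable_ge_preimage; exact: (measurable_hits HMM).
apply: (le_trans (hits_ge2 Qs ps df HMM m1 mc m3 _ q0 qm)).
rewrite lee_fin.
have MN : (N %/ 3)%:R <= N%:R :> R by rewrite ler_nat leq_div.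
have s1 : (q * (N %/ 3)%:R) ^+ 2 <= (N%:R ^+ 3)^-1 * q.
  apply: (@le_trans _ _ (q * (N%:R ^+ 8)^-1 * N%:R ^+ 2)).
    rewrite exprMn [q ^+ 2]expr2 ler_pM ?mulr_ge0// ?sqr_ge0//.
      by rewrite ler_wpM2l// ltW.
    by rewrite lerXn2r ?nnegrE.
  rewrite [leRHS]mulrC -mulrA ler_wpM2l// (exprD N%:R 6 2) invfM.
  rewrite mulfVK ?gt_eqF ?exprn_gt0// lef_pV2 ?posrE ?exprn_gt0//.
  by rewrite ler_weXn2l.
have := ler_wpM2l e0 s1.
have : 0 <= (N%:R ^+ 3)^-1 * q by rewrite mulr_ge0// invr_ge0 exprn_ge0.
by lra.
Qed.

End deviations.

Lemma union_bound (R : realType) (d : measure_display) (T : measurableType d)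
    (P : probability T R) (I : finType) (A : I -> set T) (x : R) :
  (forall i, measurable (A i)) -> (forall i, (P (A i) <= x%:E)%E) ->
  measurable (\big[setU/set0]_i A i) /\
  (P (\big[setU/set0]_i A i) <= (#|I|%:R * x)%:E)%E.
Proof.
move=> mA PA; rewrite cardE /index_enum -enumT.
elim: (enum I) => [|i s [ms Ps]]; first by rewrite !big_nil measure0 mul0r.
rewrite big_cons; split; first exact: measurableU.
rewrite (le_trans (measureU2 _ _ _))//= -natr1 mulrDl mul1r addrC EFinD.
exact: leeD.
Qed.

Section union.
Variables (R : realType) (d : measure_display) (Omega : measurableType d).
Variables (P : probability Omega R) (X0 : Omega -> R).
Hypothesis mX0 : measurable_fun setT X0.

(* The cells partition the line, so a bound proportional to their masses is
   inherited by the union. *)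
Lemma cells_union_bound (h x : R) (A : int -> set Omega) : 0 <= x ->
  (forall z, measurable (A z)) ->
  (forall z, (P (A z) <= x%:E * P (X0 @^-1` cell h z))%E) ->
  measurable (\bigcup_z A z) /\ (P (\bigcup_z A z) <= x%:E)%E.
Proof.
move=> x0 mA PA.
(* Reindexes the integers by their codes, to apply countable additivity along the naturals; a number
   that codes nothing contributes the empty set. *)
pose pull (F : int -> set Omega) n := if @pickle_inv int n is Some z then F z else set0.
have mpull F n : (forall z, measurable (F z)) -> measurable (pull F n).
  by move=> mF; rewrite /pull; case: pickle_inv.
have pullE F : \bigcup_z F z = \bigcup_n pull F n.
  apply/seteqP; split=> w [].
    by move=> z _ Fz; exists (pickle z) => //; rewrite /pull pickleK_inv.
  by move=> n _; rewrite /pull; case: pickle_inv => // z Fz; exists z.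
pose B z := X0 @^-1` cell h z.
have mB z : measurable (B z).
  by rewrite -[B z]setTI; apply: mX0 => //; exact: measurable_cell.
have tB : trivIset setT (pull B).
  move=> n m _ _ [w []]; rewrite /pull.
  have := @pickle_invK int n; have := @pickle_invK int m.
  case: pickle_inv => // z' zm; case: pickle_inv => // z zn.
  rewrite /B /cell /= => e e'; rewrite -[n]zn -[m]zm /=; congr pickle.
  by rewrite -e -e'.
have mU : measurable (\bigcup_z A z).
  by rewrite pullE; apply: bigcupT_measurable => n; exact: mpull.
split=> //.
rewrite pullE in mU *.
apply: (@le_trans _ _ (\sum_(n <oo) P (pull A n))%E).
  by apply: generalized_Boole_inequality => // n; exact: mpull.
apply: (@le_trans _ _ (\sum_(n <oo) (x%:E * P (pull B n)))%E).
  apply: lee_nneseries => // n _; rewrite /pull; case: pickle_inv => //.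
  by rewrite !measure0 mule0.
rewrite nneseriesZl//.
have <- : P (\bigcup_n pull B n) = (\sum_(n <oo) P (pull B n))%E.
  rewrite measure_bigcup//; last by move=> n _; exact: mpull.
  by apply: eq_eseriesl => n; rewrite in_setT.
rewrite -[leRHS]mule1; apply: lee_wpmul2l => //.
apply: probability_le1; apply: bigcupT_measurable => n; exact: mpull.
Qed.

End union.

(** * Bandwidth and rate *)

Section scales.
Variables (R : realType) (s : R).
Hypothesis s0 : 0 < s.

(* The bandwidth is the fourth power of [scale]. *)
Definition scale (N : nat) : R := (N%:R / ln N%:R) `^ (- (4 * (1 + 2 * s))^-1).

Let u (N : nat) : R := N%:R / ln N%:R.

Lemma s12_gt0 : 0 < 1 + 2 * s.
Proof. by have := s0; lra. Qed.

Lemma rateE N : rate s N = scale N `^ (4 * s).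
Proof.
rewrite /rate /scale -powRrM; congr (_ `^ _).
by field; apply: lt0r_neq0; exact: s12_gt0.
Qed.

Lemma ln_natr_gt0 N : (2 <= N)%N -> 0 < ln N%:R :> R.
Proof. by move=> N2; rewrite ln_gt0// ltr1n. Qed.

Lemma scale_gt0 N : (2 <= N)%N -> 0 < scale N.
Proof.
move=> N2; rewrite powR_gt0// divr_gt0 ?ln_natr_gt0// ltr0n.
exact: leq_trans N2.
Qed.

Lemma rate_gt0 N : (2 <= N)%N -> 0 < rate s N.
Proof. by move=> N2; rewrite rateE powR_gt0// scale_gt0. Qed.

(** The balance of bias and deviation for the bandwidth [h = scale ^+ 4]: it is the hypothesis of
    [misses_rate] both for [q' = h], [la = r] and for [q' = 1], [la = scale ^+ 2 * r]. *)
Lemma scale_rate N : (2 <= N)%N -> scale N ^+ 4 * rate s N ^+ 2 * N%:R = ln N%:R.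
Proof.
move=> N2; have l0 := ln_natr_gt0 N2.
have n0 : 0 < N%:R :> R by rewrite ltr0n (leq_trans _ N2).
have u0 : 0 < u N by rewrite divr_gt0.
have uu a : u N `^ a != 0 by rewrite gt_eqF// powR_gt0.
suff -> : scale N ^+ 4 * rate s N ^+ 2 = (u N)^-1.
  by rewrite /u invf_div divfK// gt_eqF.
rewrite /rate /scale -/(u N) -!powR_mulrn ?powR_ge0// -!powRrM -powRD; last first.
  by rewrite (gt_eqF u0) implybT.
rewrite -[(u N)^-1](powR_inv1 (ltW u0)); congr (_ `^ _).
by field; apply: lt0r_neq0; exact: s12_gt0.
Qed.

Lemma ln_le_sqrt (x : R) : 0 < x -> ln x <= 2 * Num.sqrt x.
Proof.
move=> x0; have sx : 0 < Num.sqrt x by rewrite sqrtr_gt0.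
rewrite -{1}(sqr_sqrtr (ltW x0)) lnXn// -[leLHS]mulr_natl ler_wpM2l//.
by rewrite ltW// ln_sublinear.
Qed.

Lemma scale_small eps : 0 < eps -> \forall N \near \oo, scale N <= eps.
Proof.
move=> e0; pose k := (4 * (1 + 2 * s))^-1.
have k0 : 0 < k by rewrite invr_gt0 mulr_gt0// s12_gt0.
pose b := eps `^ (- k^-1).
have b0 : 0 < b by rewrite powR_gt0.
have [n nb] : exists n : nat, 4 * b ^+ 2 <= n%:R.
  by exists (Num.bound (4 * b ^+ 2)); rewrite ltW// archi_boundP// mulr_ge0// sqr_ge0.
exists (maxn n 2) => // N /=; rewrite geq_max => /andP[nN N2].
have l0 := ln_natr_gt0 N2.
have n0 : 0 < N%:R :> R by rewrite ltr0n (leq_trans _ N2).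
have sN := sqr_sqrtr (ltW n0).
have sb : 2 * b <= Num.sqrt N%:R.
  rewrite -ler_sqr ?nnegrE ?mulr_ge0 ?sqrtr_ge0 ?(ltW b0)// sN exprMn.
  apply: le_trans (_ : n%:R <= _); last by rewrite ler_nat.
  by apply: le_trans nb; rewrite ler_wpM2r ?sqr_ge0// -natrX ler_nat.
(* [b ln N <= 2 b sqrt N <= N], by [ln_le_sqrt] and [2 b <= sqrt N]. *)
have bu : b <= u N.
  rewrite /u ler_pdivlMr//; move: sN.
  have := ler_wpM2l (ltW b0) (ln_le_sqrt n0).
  have := ler_wpM2r (sqrtr_ge0 (N%:R : R)) sb.
  by set S := Num.sqrt _; rewrite expr2; lra.
rewrite /scale -/(u N) -/k powRN -[eps](invrK) lef_pV2 ?posrE ?invr_gt0 ?powR_gt0//; last first.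
  exact: lt_le_trans bu.
have -> : eps^-1 = b `^ k by rewrite /b -powRrM mulNr mulVf ?gt_eqF// powRN powRr1 ?ltW.
by apply: ge0_ler_powR => //; rewrite ?nnegrE ltW// (lt_le_trans b0).
Qed.

Lemma rate_small eps : 0 < eps -> \forall N \near \oo, rate s N <= eps.
Proof.
move=> e0; have s4 : 0 < 4 * s by rewrite mulr_gt0.
have := scale_small (powR_gt0 ((4 * s)^-1) e0).
apply: filterS => N h; rewrite rateE.
rewrite (le_trans (ge0_ler_powR (ltW s4) _ _ h)) ?nnegrE ?powR_ge0//.
by rewrite -powRrM mulVf ?gt_eqF// powRr1// ltW.
Qed.

Lemma near_ge_nat n : \forall N \near \oo, (n <= N)%N.
Proof. by exists n. Qed.

Lemma ln_large : \forall N \near \oo, 1 <= ln N%:R :> R.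
Proof.
have [n hn] : exists n : nat, expR 1 <= n%:R :> R.
  by exists (Num.bound (expR 1 : R)); rewrite ltW// archi_boundP// expR_ge0.
exists (maxn n 1) => // N /=; rewrite geq_max => /andP[nN N1].
by rewrite -ler_expR lnK ?posrE ?ltr0n// (le_trans hn)// ler_nat.
Qed.

End scales.

(** * Moment matrices *)

Section moment_matrices.
Variables (R : realType) (J : nat) (Q : 'M[R]_J) (pi : 'I_J -> R).
Variable f : 'I_J -> R -> R.
Hypotheses (Qs : stochastic_matrix Q) (Qu : Q \in unitmx).
Hypotheses (pi0 : forall i, 0 < pi i).
Hypothesis df : forall j, is_density_lebesgue (f j).
Implicit Types (a : 'I_J -> R) (t : nat).

Definition cdfmx a : 'M[R]_J := \matrix_(j, l) mass (f j) (below (a l)).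
Definition leftmx a : 'M[R]_J := (cdfmx a)^T *m diag_mx (\row_i pi i) *m Q.
Definition rightmx a : 'M[R]_J := Q *m cdfmx a.
Definition eigval a t (j : 'I_J) : R := \sum_(k < J) t%:R ^+ k * cdfmx a j k.
Definition momentmx a : 'M[R]_J := leftmx a *m rightmx a.
Definition weightedmx a t : 'M[R]_J :=
  leftmx a *m diag_mx (\row_j eigval a t j) *m rightmx a.

Lemma sandwichE (A D : 'M[R]_J) (v : 'I_J -> R) l m :
  (A *m diag_mx (\row_j v j) *m D) l m = \sum_j A l j * v j * D j m.
Proof.
rewrite mxE; apply: eq_bigr => j _; congr (_ * _).
by rewrite mul_mx_diag !mxE.
Qed.

(** Given the middle hidden state [j], the three observations are independent: [leftmx] collects the
    past together with the law of [j], [rightmx] the future. *)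
Lemma blockprobE a B l m :
  blockprob Q pi f (below (a l)) B (below (a m)) =
  \sum_j leftmx a l j * mass (f j) B * rightmx a j m.
Proof.
rewrite /blockprob /blockop /trans.
under eq_bigr do rewrite mulrA mulr_sumr.
rewrite exchange_big /=; apply: eq_bigr => j _.
have -> : rightmx a j m = \sum_k Q j k * (mass (f k) (below (a m)) * \sum_h Q k h * 1).
  rewrite mxE; apply: eq_bigr => k _; rewrite mxE.
  by under eq_bigr do rewrite mulr1; rewrite (Qs.2 k) mulr1.
have -> : leftmx a l j = \sum_i pi i * mass (f i) (below (a l)) * Q i j.
  rewrite mxE; apply: eq_bigr => i _; congr (_ * _).
  by rewrite mul_mx_diag !mxE mulrC.
rewrite mulr_suml mulr_suml; apply: eq_bigr => i _.
by rewrite !mulrA.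
Qed.

Lemma momentmxE a l m :
  blockprob Q pi f (below (a l)) setT (below (a m)) = momentmx a l m.
Proof.
rewrite blockprobE mxE; apply: eq_bigr => j _.
by rewrite mass_setT// mulr1.
Qed.

Lemma weightedmxE a t l m :
  \sum_(k < J) t%:R ^+ k * blockprob Q pi f (below (a l)) (below (a k)) (below (a m)) =
  weightedmx a t l m.
Proof.
rewrite sandwichE; under eq_bigr do rewrite blockprobE mulr_sumr.
rewrite exchange_big /=; apply: eq_bigr => j _.
rewrite /eigval mulr_sumr mulr_suml; apply: eq_bigr => k _.
rewrite [cdfmx a j k]mxE; ring.
Qed.

Definition separates a t : Prop :=
  (cdfmx a \in unitmx) /\ injective (eigval a t).

Lemma leftmx_unit a : cdfmx a \in unitmx -> leftmx a \in unitmx.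
Proof.
move=> Ou; rewrite !unitmx_mul unitmx_tr Ou Qu andbT /= unitmxE det_diag unitfE.
by rewrite prodf_seq_neq0; apply/allP => i _; rewrite mxE gt_eqF.
Qed.

Lemma rightmx_unit a : cdfmx a \in unitmx -> rightmx a \in unitmx.
Proof. by move=> Ou; rewrite unitmx_mul Qu. Qed.

Lemma diagonalizes_le (r r' g : R) (P G : 'M[R]_J) mu W : r <= r' ->
  diagonalizes r g P G mu W -> diagonalizes r' g P G mu W.
Proof.
move=> rr [h1 h2 h3 h4]; split=> // [x y|j x y|j].
- exact: le_trans (h1 _ _) rr.
- exact: le_trans (h2 _ _ _) rr.
- exact: le_trans (h3 _) rr.
Qed.

Definition feasible (e r : R) (P G : 'M[R]_J) (mu : 'I_J -> R) (W : 'I_J -> 'M[R]_J) :=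
  [/\ diagonalizes r (Num.sqrt r) P G mu W, forall j, `|mu j| <= e^-1 &
      forall j x y, `|W j x y| <= e^-1].

(** The factor [e ^+ 2] pays for the square of the bound [e^-1] lost in [diagonalizes_perturb]. *)
Definition entry_close (T e r : R) (P P' : 'M[R]_J) : Prop :=
  forall x y, `|P x y - P' x y| <= T * (e ^+ 2 * r).

Lemma entry_closeC T e r P P' : entry_close T e r P P' -> entry_close T e r P' P.
Proof. by move=> h x y; rewrite distrC. Qed.

Lemma feasible_true (T e r : R) P G P' G' mu W : 0 <= T -> 0 < e <= 1 -> 0 < r ->
  entry_close T e r P P' -> entry_close T e r G G' -> feasible e r P' G' mu W ->
  diagonalizes ((1 + 2 * J%:R ^+ 2 * T) * r) (Num.sqrt r) P G mu W.
Proof.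
move=> T0 /andP[e0 e1] r0 PP GG [h hm hW].
have e1' : 1 <= e^-1 by rewrite invf_ge1.
have eta0 : 0 <= T * (e ^+ 2 * r) by rewrite mulr_ge0// mulr_ge0 ?sqr_ge0// ltW.
have := diagonalizes_perturb eta0 e1' PP GG hW hm h.
have -> : T * (e ^+ 2 * r) * e^-1 ^+ 2 = T * r by field; rewrite gt_eqF.
by have -> : r + 2 * J%:R ^+ 2 * (T * r) = (1 + 2 * J%:R ^+ 2 * T) * r by ring.
Qed.

Lemma lt_sqrt_self (c r : R) : 0 <= c -> 0 < r -> r < ((1 + c) ^+ 2)^-1 ->
  c * r < Num.sqrt r.
Proof.
move=> c0 r0 rc; have c1 : 0 < 1 + c by lra.
have s0 : 0 < Num.sqrt r by rewrite sqrtr_gt0.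
have : Num.sqrt r < (1 + c)^-1.
  rewrite -[X in _ < X]ger0_norm ?invr_ge0 ?ltW// -sqrtr_sqr exprVn.
  by rewrite ltr_sqrt// invr_gt0 exprn_gt0.
rewrite -[_^-1]mul1r ltr_pdivlMr// => h.
rewrite -[X in c * X](sqr_sqrtr (ltW r0)).
set S := Num.sqrt r in s0 h *.
have h' : 0 < 1 - c * S by lra.
by have := mulr_gt0 s0 h'; rewrite expr2; lra.
Qed.

(** Feasible data would nearly diagonalize the true matrices with tolerance [c * r] and gap
    [sqrt r]. For small [r] this is impossible if [momentmx] is singular, and otherwise it makes the
    eigenvalues distinct, contrary to the failure of [separates]. *)
Lemma not_separates_infeasible T a t : 0 <= T -> ~ separates a t ->
  exists2 eps : R, 0 < eps & forall e r P G, 0 < e <= 1 -> 0 < r < eps ->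
  entry_close T e r (momentmx a) P -> entry_close T e r (weightedmx a t) G ->
  forall mu W, ~ feasible e r P G mu W.
Proof.
move=> T0 nsep; pose c := 1 + 2 * J%:R ^+ 2 * T.
have c0 : 0 < c.
  by rewrite /c ltr_pwDl// mulr_ge0// mulr_ge0// sqr_ge0.
have [Ou|Ou] := boolP (cdfmx a \in unitmx); last first.
  have nP : momentmx a \notin unitmx.
    by rewrite /momentmx unitmx_mul /rightmx [X in _ && X]unitmx_mul (negPf Ou) !andbF.
  have [r0 r00 hr] := diagonalizes_singular nP.
  exists (r0 / c) => [|e r P G e1 /andP[rp rr] PP GG mu W /feasible_true h].
    by rewrite divr_gt0.
  apply: (hr (c * r) (Num.sqrt r) (weightedmx a t) mu W); last exact: h PP GG.
  by rewrite mulrC -ler_pdivlMr// ltW.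
have Au := leftmx_unit Ou.
pose kap := mxnorm1 (invmx (leftmx a)) * mxnorm1 (leftmx a).
have kap0 : 0 <= kap by rewrite mulr_ge0 ?mxnorm1_ge0.
pose C := 2 * (2 * J%:R * (kap * c)).
have C0 : 0 <= C.
  by apply: mulr_ge0 => //; apply: mulr_ge0 => //; apply: mulr_ge0 => //; exact: ltW.
exists (Num.min ((1 / 4) / c) (((1 + C) ^+ 2)^-1)).
  by rewrite lt_min divr_gt0// invr_gt0 exprn_gt0//; lra.
move=> e r P G e1 /andP[rp]; rewrite lt_min => /andP[rr rC] PP GG mu W h.
apply: nsep; split=> //.
apply: (diagonalizes_eigenvalues_inj Au (r := c * r) (g := Num.sqrt r)); last 1 first.
- exact: feasible_true PP GG h.
- by rewrite mulrC -ler_pdivlMr// ltW.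
- have := lt_sqrt_self C0 rp rC; congr (_ < _); rewrite /C /kap; ring.
Qed.

(** The exact spectral data remain feasible for the perturbed matrices, since their size and gap are
    fixed while [e] and [r] are small. Conversely all feasible data nearly diagonalize the true
    matrices, and [diagonalizes_stable] applies. *)
Lemma separates_feasible T a t : 0 <= T -> separates a t ->
  exists (tau : {perm 'I_J}) (C eps : R), [/\ 0 < C, 0 < eps &
  forall e r P G, 0 < e < eps -> 0 < r < eps ->
  entry_close T e r (momentmx a) P -> entry_close T e r (weightedmx a t) G ->
  (exists mu W, feasible e r P G mu W) /\
  forall mu W, feasible e r P G mu W -> forall j x y,
    `|W j x y - spectral_weight (leftmx a) (rightmx a) tau j x y| <= C * r].
Proof.
move=> T0 [Ou li]; pose c := 1 + 2 * J%:R ^+ 2 * T.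
have J20 : 0 <= 2 * J%:R ^+ 2 * T by rewrite mulr_ge0// mulr_ge0// sqr_ge0.
have c0 : 0 < c by rewrite ltr_pwDl.
have Au := leftmx_unit Ou; have Du := rightmx_unit Ou.
(* The labelling comes from sorting the eigenvalues; injectivity makes the order strict. *)
have [tau tauP] : exists tau : {perm 'I_J}, forall j k : 'I_J, (j < k)%N ->
    eigval a t (tau j) < eigval a t (tau k).
  pose s := [tuple eigval a t j | j < J].
  have /tuple_permP[p hp] : perm_eq (sort <=%R s) s by rewrite perm_sort.
  exists p => j k jk.
  have nthE (i : 'I_J) : nth 0 (sort <=%R s) i = eigval a t (p i).
    by rewrite hp -tnth_nth !tnth_mktuple.
  rewrite lt_neqAle; apply/andP; split.
    by apply: contraTneq jk => /li/perm_inj ->; rewrite ltnn.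
  rewrite -!nthE; apply: (sorted_leq_nth le_trans le_refl) => //.
  - exact: sort_le_sorted.
  - by rewrite inE size_sort size_tuple.
  - by rewrite inE size_sort size_tuple.
  - exact: ltnW.
have [g0 g00 hg] := spectral_weight_diagonalizes Au Du tauP.
have [C1 [r0 [C10 r00 hs]]] := diagonalizes_stable Au Du tauP.
pose w := spectral_weight (leftmx a) (rightmx a) tau.
pose b0 : R := 1 + \sum_j `|eigval a t (tau j)| + \sum_j mxnorm1 (w j).
have n1 : 0 <= \sum_j `|eigval a t (tau j)| by apply: sumr_ge0.
have n2 : 0 <= \sum_j mxnorm1 (w j) by apply: sumr_ge0 => j _; exact: mxnorm1_ge0.
have b01 : 1 <= b0 by rewrite /b0; lra.
have mub j : `|eigval a t (tau j)| <= b0.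
  have : `|eigval a t (tau j)| <= \sum_j `|eigval a t (tau j)|.
    by rewrite (bigD1 j)//= lerDl sumr_ge0.
  by rewrite /b0; lra.
have wb j x y : `|w j x y| <= b0.
  have : mxnorm1 (w j) <= \sum_j mxnorm1 (w j).
    by rewrite [leRHS](bigD1 j)//= lerDl sumr_ge0// => k _; exact: mxnorm1_ge0.
  by have := entry_le_mxnorm1 (w j) x y; rewrite /b0; lra.
have c1 : 0 < 1 + C1 * c by rewrite addr_gt0// mulr_gt0.
(* The exact data, of size [b0], acquire the error [(D - 1) e^2 r]; [D * e <= 1] and [e <= 1] bring
   it below [r]. *)
pose D := 1 + 2 * J%:R ^+ 2 * T * b0 ^+ 2.
have D1 : 1 <= D by rewrite lerDl mulr_ge0// sqr_ge0.
exists tau, (C1 * c), (Num.min (Num.min b0^-1 D^-1)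
  (Num.min (g0 ^+ 2) (Num.min (r0 / c) (((1 + C1 * c) ^+ 2)^-1)))).
have D0 : 0 < D by lra.
have b00 : 0 < b0 by lra.
split; first exact: mulr_gt0.
  by rewrite !lt_min !invr_gt0 b00 D0 !exprn_gt0// divr_gt0.
move=> e r P G; rewrite !lt_min => /and3P[e0 /andP[eb eD] _].
move=> /and5P[rp _ rg rr rC] PP GG.
have e1 : 0 < e <= 1.
  by rewrite e0 (le_trans (ltW eb))// invf_le1.
have eb' : b0 <= e^-1 by rewrite -[b0]invrK lef_pV2 ?posrE ?invr_gt0// ltW.
split.
  exists (eigval a t \o tau), w; split=> [|j|j x y]; last 2 first.
  - exact: le_trans (mub j) eb'.
  - exact: le_trans (wb j x y) eb'.
  have sg : Num.sqrt r <= g0.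
    by rewrite -[g0]gtr0_norm// -sqrtr_sqr ler_wsqrtr// ltW.
  have eta0 : 0 <= T * (e ^+ 2 * r) by rewrite mulr_ge0// mulr_ge0 ?sqr_ge0// ltW.
  have := diagonalizes_perturb eta0 b01 (entry_closeC PP) (entry_closeC GG) wb mub (hg _ sg).
  apply: diagonalizes_le; rewrite add0r.
  have -> : 2 * J%:R ^+ 2 * (T * (e ^+ 2 * r) * b0 ^+ 2) = (D - 1) * e ^+ 2 * r.
    by rewrite /D; ring.
  rewrite ler_piMl ?(ltW rp)//.
  have /andP[_ e11] := e1.
  have : D * e <= 1 by rewrite -ler_pdivlMl// mulr1 ltW.
  by rewrite expr2; nra.
move=> mu W /(feasible_true T0 e1 rp PP GG) h j x y.
have := hs _ _ _ _ _ _ _ h j x y; rewrite mulrA; apply.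
- by rewrite mulr_ge0 // ltW.
- by rewrite mulrC -ler_pdivlMr// ltW.
- by apply: (lt_sqrt_self _ rp rC); rewrite ltW// mulr_gt0.
Qed.

End moment_matrices.

(** * The estimator *)

Section estimator.
Variables (R : realType) (J : nat) (s : R).

Let k := Num.truncn s.

Definition weights : 'I_k.+1 -> {poly R} := projT1 (cid (increment_weights R k)).

Lemma weightsP : forall S : {poly R}, (size S <= k.+2)%N -> forall t,
  \sum_i (weights i).[t] * (S.[i.+1%:R] - S.[i%:R]) = S^`().[t].
Proof. exact: (projT2 (cid (increment_weights R k))). Qed.

(* Enumerates the rational thresholds [a] and the exponent bases [t] of
   [separates]; the junk value on non-codes is an ordinary candidate. *)
Definition test_code (c : nat) : ('I_J -> R) * nat :=
  if @unpickle ({ffun 'I_J -> rat} * nat)%type c is Some v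
  then (fun l => ratr (v.1 l), v.2) else (fun=> 0, 0%N).

Variable N : nat.
Implicit Types (x : 'I_N -> R) (c : nat).

Let e := scale s N.
Let h := e ^+ 4.
Let r := rate s N.
Let M := (N %/ 3)%N.

Definition seen x (m : nat) : R := if insub m is Some i then x i else 0.

(* Only the disjoint triples [X_(3n), X_(3n+1), X_(3n+2)] are used. *)
Definition freq x (B1 B2 B3 : set R) : R := M%:R^-1 * \sum_(n < M)
  \1_B1 (seen x (3 * n)) * \1_B2 (seen x (3 * n).+1) * \1_B3 (seen x (3 * n).+2).

Definition moment_est x c : 'M[R]_J :=
  \matrix_(l, m) freq x (below ((test_code c).1 l)) setT (below ((test_code c).1 m)).

Definition weighted_est x c : 'M[R]_J :=
  \matrix_(l, m) \sum_(i < J) (test_code c).2%:R ^+ i *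
    freq x (below ((test_code c).1 l)) (below ((test_code c).1 i)) (below ((test_code c).1 m)).

(** The bound [c < N] makes the search finite and involves only the thresholds of the first [N]
    codes, which are the ones recorded by [digest]. *)
Definition admissible x c (mu : 'I_J -> R) (W : 'I_J -> 'M[R]_J) : Prop :=
  (c < N)%N /\ feasible e r (moment_est x c) (weighted_est x c) mu W.

(** Equal to [N] when no code is admissible; [weight_est] then takes its zero default. *)
Definition selected x : nat :=
  find (fun c => `[< exists mu W, admissible x c mu W >]) (iota 0 N).

(* Any admissible weights will do, by [separates_feasible]. *)
Definition weight_est x : 'I_J -> 'M[R]_J :=
  (xget (fun=> 0, fun=> 0) [set v : ('I_J -> R) * ('I_J -> 'M[R]_J) |
     admissible x (selected x) v.1 v.2]).2.

(** Written as a finite kernel sum to make continuity in [y] visible; [smooth_estE] gives the form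
    through cell frequencies used in the analysis. *)
Definition smooth_est x (l m : 'I_J) (y : R) : R := h^-1 * (M%:R^-1 * \sum_(n < M)
  \1_(below ((test_code (selected x)).1 l)) (seen x (3 * n)) *
  \1_(below ((test_code (selected x)).1 m)) (seen x (3 * n).+2) *
  smoothing_kernel weights (y / h - (Num.floor (seen x (3 * n).+1 / h))%:~R)).

Definition density_est x (j : 'I_J) (y : R) : R :=
  \sum_l \sum_m weight_est x j m l * smooth_est x l m y.

Lemma continuous_sum_fun (I : finType) (F : I -> R -> R) :
  (forall i, continuous (F i)) -> continuous (fun y => \sum_i F i y).
Proof.
move=> cF; apply: (continuous_big (op := +%R)) => [|i _]; first exact: add_continuous.
exact: cF.
Qed.

Lemma continuous_density_est x j : continuous (density_est x j).
Proof.
apply: continuous_sum_fun => l; apply: continuous_sum_fun => m y.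
apply: cvgM; first exact: cvg_cst.
apply: cvgM; first exact: cvg_cst.
apply: cvgM; first exact: cvg_cst.
move: y; apply: continuous_sum_fun => n y.
apply: cvgM; first exact: cvg_cst.
set z : R := (Num.floor _)%:~R.
have cz : {for y, continuous (fun y : R => y / h - z)}.
  by apply: cvgB; [apply: cvgM; [exact: cvg_id|exact: cvg_cst]|exact: cvg_cst].
by apply: (continuous_comp cz); exact: continuous_smoothing_kernel.
Qed.

Lemma indic_cell z y : \1_(cell h z) y = (z == Num.floor (y / h))%:R :> R.
Proof.
rewrite indicE; congr (_%:R); congr nat_of_bool; apply/idP/eqP; first by rewrite inE.
by move=> ->; rewrite inE.
Qed.

Lemma smooth_estE x l m y (a := (test_code (selected x)).1) : smooth_est x l m y =
  h^-1 * smooth weights (fun z => freq x (below (a l)) (cell h z) (below (a m))) (y / h).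
Proof.
rewrite /smooth_est smooth_sum -smooth_scale; congr (_ * _).
apply: eq_smooth => z; rewrite /freq; congr (_ * _); apply: eq_bigr => n _.
by rewrite indic_cell mulrAC.
Qed.

(** The discrete data that determine the estimator: the cell of each observation and its comparisons
    with the thresholds of the first [N] codes. The choice by [xget] has no regularity in [x] and
    the sup norm runs over uncountably many points, but a function of countably many discrete values
    with measurable fibres is measurable. *)
Definition digest x : {ffun 'I_N -> int * {ffun 'I_N * 'I_J -> bool}} :=
  [ffun n => (Num.floor (x n / h), [ffun v : 'I_N * 'I_J => x n < (test_code v.1).1 v.2])].

Lemma digest_seen x x' m : digest x = digest x' ->
  Num.floor (seen x m / h) = Num.floor (seen x' m / h) /\
  forall c l, (c < N)%N -> (seen x m < (test_code c).1 l) = (seen x' m < (test_code c).1 l).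
Proof.
move=> /ffunP hd; rewrite /seen; case: insubP => [i _ _|//].
have := hd i; rewrite !ffunE => -[-> /ffunP hc]; split=> // c l cN.
by have := hc (Ordinal cN, l); rewrite !ffunE.
Qed.

Lemma indic_below (a y : R) : \1_(below a) y = (y < a)%R%:R :> R.
Proof.
rewrite indicE; congr (_%:R); congr nat_of_bool; apply/idP/idP; first by rewrite inE.
by move=> ya; rewrite inE.
Qed.

Lemma digest_admissible x x' : digest x = digest x' -> admissible x = admissible x'.
Proof.
move=> xx; apply/funext => c; apply/funext => mu; apply/funext => W.
rewrite /admissible; have [cN|cN] := ltnP c N; last by apply/propext; split=> -[].
have eb l m : \1_(below ((test_code c).1 l)) (seen x m) =
    \1_(below ((test_code c).1 l)) (seen x' m) :> R.
  by have [_ h2] := digest_seen m xx; rewrite !indic_below h2.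
have -> : moment_est x c = moment_est x' c.
  apply/matrixP => l m; rewrite [LHS]mxE [RHS]mxE.
  by congr (_ * _); apply: eq_bigr => n _; rewrite !eb !indicT.
suff -> : weighted_est x c = weighted_est x' c by [].
apply/matrixP => l m; rewrite [LHS]mxE [RHS]mxE; apply: eq_bigr => i _.
by do 2! congr (_ * _); apply: eq_bigr => n _; rewrite !eb.
Qed.

Lemma weight_est_spec x :
  admissible x (selected x) (xget (fun=> 0, fun=> 0) [set v : ('I_J -> R) * ('I_J -> 'M[R]_J) |
     admissible x (selected x) v.1 v.2]).1 (weight_est x) \/ weight_est x = fun=> 0.
Proof.
by rewrite /weight_est; case: xgetP => [v -> hv|_]; [left|right].
Qed.

Lemma weight_est_admissible x mu W : admissible x (selected x) mu W ->
  exists mu', admissible x (selected x) mu' (weight_est x).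
Proof.
move=> hW; rewrite /weight_est; case: xgetP => [v _ hv|/(_ (mu, W))]; first by exists v.1.
by move=> nh; exfalso; exact: nh.
Qed.

Lemma digest_density_est x x' : digest x = digest x' -> density_est x = density_est x'.
Proof.
move=> xx; have ea := digest_admissible xx.
have es : selected x = selected x' by rewrite /selected ea.
have ew : weight_est x = weight_est x' by rewrite /weight_est ea es.
apply/funext => j; apply/funext => y.
apply: eq_bigr => l _; apply: eq_bigr => m _.
(* If the search fails, [smooth_est] involves thresholds that [digest] does not record, but all its
   weights vanish. *)
have [sN|sN] := ltnP (selected x) N; last first.
  have w0 : weight_est x = fun=> 0.
    case: (weight_est_spec x) => [[cN _]|w0]; last exact: w0.
    by exfalso; move: (leq_ltn_trans sN cN); rewrite ltnn.
  have w0e : weight_est x j m l = 0 by rewrite w0 mxE.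
  by rewrite -ew w0e !mul0r.
rewrite ew; congr (_ * _); rewrite /smooth_est -es.
do 2! congr (_ * _); apply: eq_bigr => n _.
have [_ h1] := digest_seen (3 * n) xx; have [_ h3] := digest_seen (3 * n).+2 xx.
have [-> _] := digest_seen (3 * n).+1 xx.
by rewrite !indic_below (h1 _ _ sN) (h3 _ _ sN).
Qed.

Lemma weight_est_bound x j l m : 0 <= e -> `|weight_est x j l m| <= e^-1.
Proof.
move=> e0; case: (weight_est_spec x) => [[_ [_ _ ->]]//|->].
by rewrite mxE normr0 invr_ge0.
Qed.

Lemma freq_bound x B1 B2 B3 : 0 <= freq x B1 B2 B3 <= 1.
Proof.
have i01 (B : set R) (y : R) : 0 <= (\1_B y : R) <= 1 by rewrite indicE; case: (_ \in _); rewrite ?lexx ?ler01.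
have t01 n : 0 <= (\1_B1 (seen x (3 * n)) * \1_B2 (seen x (3 * n).+1) *
    \1_B3 (seen x (3 * n).+2) : R) <= 1.
  have := i01 B1 (seen x (3 * n)); have := i01 B2 (seen x (3 * n).+1).
  have := i01 B3 (seen x (3 * n).+2).
  move=> /andP[? ?] /andP[? ?] /andP[? ?]; apply/andP; split.
    by rewrite !mulr_ge0.
  by rewrite !mulr_ile1 ?mulr_ge0.
apply/andP; split.
  by rewrite mulr_ge0 ?invr_ge0// sumr_ge0// => n _; case/andP: (t01 n).
have [M0|M0] := posnP M; first by rewrite /freq M0 invr0 mul0r.
rewrite /freq mulrC ler_pdivrMr ?ltr0n// mul1r.
apply: (@le_trans _ _ (\sum_(n < M) 1)); last by rewrite sumr_const card_ord.
by apply: ler_sum => n _; case/andP: (t01 n).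
Qed.

(** Valid for every sample, because admissible weights are at most [e^-1]; it controls the
    expectation on the exceptional event. *)
Lemma density_est_bound x j y : 0 < e ->
  `|density_est x j y| <= J%:R ^+ 2 * (e^-1 * (h^-1 * smooth_norm weights)).
Proof.
move=> e0; have h0 : 0 < h by rewrite exprn_gt0.
have hs : 0 <= h^-1 * smooth_norm weights.
  by rewrite mulr_ge0 ?invr_ge0 ?smooth_norm_ge0// ltW.
have b l m : `|weight_est x j m l * smooth_est x l m y| <= e^-1 * (h^-1 * smooth_norm weights).
  rewrite normrM ler_pM//; first by apply: weight_est_bound; exact: ltW.
  rewrite smooth_estE normrM gtr0_norm ?invr_gt0// ler_pM2l ?invr_gt0//.
  rewrite -[leRHS]mulr1; apply: smooth_bound => n _.
  by have /andP[f0 f1] := freq_bound x (below ((test_code (selected x)).1 l))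
    (cell h (Num.floor (y / h) + n%:Z)) (below ((test_code (selected x)).1 m)); rewrite ger0_norm.
rewrite (le_trans (ler_norm_sum _ _ _))// expr2 -mulrA mulr_natl -[X in _ *+ X]card_ord.
rewrite -sumr_const; apply: ler_sum => l _; rewrite (le_trans (ler_norm_sum _ _ _))//.
by rewrite mulr_natl -[X in _ *+ X]card_ord -sumr_const; apply: ler_sum.
Qed.

End estimator.

(** Every preimage under [g] is a countable union of fibres of [p]. *)
Lemma measurable_saturated (R : realType) (d : measure_display) (T : measurableType d)
    (D : countType) (p : T -> D) (g : T -> \bar R) :
  (forall v, measurable (p @^-1` [set v])) -> (forall w w', p w = p w' -> g w = g w') ->
  measurable_fun setT g.
Proof.
move=> mp pg _ Y _; rewrite setTI.
pose A n := if @pickle_inv D n is Some v then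
  (if `[< exists w, p w = v /\ Y (g w) >] then p @^-1` [set v] else set0) else set0.
rewrite (_ : g @^-1` Y = \bigcup_n A n).
  apply: bigcupT_measurable => n; rewrite /A.
  by case: pickle_inv => [v|//]; case: ifP.
apply/seteqP; split=> [w Yw|w [n _]].
  exists (pickle (p w)) => //; rewrite /A pickleK_inv asboolT//; by exists w.
rewrite /A; case: pickle_inv => [v|//]; case: asboolP => // -[w' [<- Yw']] /= e.
by rewrite /preimage /= (pg _ _ e).
Qed.

Section observations.
Variables (R : realType) (d : measure_display) (Omega : measurableType d).
Variables (P : probability Omega R) (J : nat) (Q : 'M[R]_J) (pi : 'I_J -> R).
Variables (f : 'I_J -> R -> R) (theta : nat -> Omega -> 'I_J).
Variable X : nat -> Omega -> R.
Hypothesis HMM : is_HMM P Q pi f theta X.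

Definition obs N (w : Omega) : 'I_N -> R := fun k => X (nat_of_ord k) w.

Lemma seen_obs N w m : (m < N)%N -> seen (@obs N w) m = X m w.
Proof. by move=> mN; rewrite /seen insubT. Qed.

Lemma freq_obs N w B1 B2 B3 :
  freq (@obs N w) B1 B2 B3 = (N %/ 3)%:R^-1 * hits X B1 B2 B3 (N %/ 3) w.
Proof.
rewrite /freq /hits; congr (_ * _); apply: eq_bigr => n _.
have nN : (3 * n + 2 < N)%N by have := ltn_ord n; clear; lia.
rewrite !seen_obs; try lia.
rewrite /hit !window_cons window_nil setIT !indicI /= mulrA.
by rewrite !indicE.
Qed.

Lemma measurable_err (s : R) N (j : 'I_J) (g : R -> R) : measurable_fun setT
  (fun w => supnorm (fun y => density_est s (@obs N w) j y - g y)).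
Proof.
apply: (@measurable_saturated _ _ _ _ (fun w => digest J s (@obs N w))); last first.
  by move=> w w' /digest_density_est ->.
move=> v; have [mX _] := HMM.
have -> : (fun w => digest J s (@obs N w)) @^-1` [set v] =
    \bigcap_(n in [set: 'I_N]) ([set w | cell (scale s N ^+ 4) (v n).1 (X n w)] `&`
      \bigcap_(u in [set: 'I_N * 'I_J]) [set w | (X n w < (test_code R J u.1).1 u.2) = (v n).2 u]).
  apply/seteqP; split=> w /=.
    by move=> <- n _; split=> [|u _]; rewrite /cell /= !ffunE//= ffunE.
  move=> hw; apply/ffunP => n; rewrite ffunE; have [h1 h2] := hw n I.
  apply: injective_projections => /=; first exact: h1.
  by apply/ffunP => u; rewrite ffunE; exact: (h2 u I).
apply: fin_bigcap_measurable => // n _; apply: measurableI.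
  by have := mX n measurableT _ (measurable_cell (scale s N ^+ 4) (v n).1); rewrite setTI.
apply: fin_bigcap_measurable => // u _.
set a := (test_code R J u.1).1 u.2.
have mb : measurable [set w | X n w < a].
  by have := mX n measurableT _ (measurable_below a); rewrite setTI.
case: ((v n).2 u).
  by rewrite (_ : [set w | _] = [set w | X n w < a]).
rewrite (_ : [set w | _] = ~` [set w | X n w < a]); first exact: measurableC.
by apply/seteqP; split=> w /=; [move=> ->|move/negP/negbTE].
Qed.

End observations.

(** * Probability of small deviations *)

Section good_event.
Variables (R : realType) (J : nat) (s : R) (Q : 'M[R]_J) (pi : 'I_J -> R).
Variable f : 'I_J -> R -> R.
Hypotheses (s0 : 0 < s) (Qs : stochastic_matrix Q) (ps : prob_vector pi).
Hypothesis df : forall j, is_density_lebesgue (f j).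
Hypotheses (irr : irreducible_chain Q) (ape : aperiodic_chain Q).
Hypothesis inv : invariant_distribution Q pi.
Variable F : R.
Hypotheses (F1 : 1 <= F) (fF : forall j x, f j x <= F).

(** The moments are controlled for all codes up to [cs], so that the earlier ones are rejected; the
    cells only for [cs] itself, with a precision that becomes [T * rate] after division by the
    bandwidth. *)
Definition accurate (T : R) (cs N : nat) (x : 'I_N -> R) : Prop :=
  (forall c, (c <= cs)%N ->
    entry_close T (scale s N) (rate s N) (momentmx Q pi f (test_code R J c).1) (moment_est J x c) /\
    entry_close T (scale s N) (rate s N) (weightedmx Q pi f (test_code R J c).1 (test_code R J c).2)
      (weighted_est J x c)) /\
  forall l m z, let a := (test_code R J cs).1 in
    `|freq x (below (a l)) (cell (scale s N ^+ 4) z) (below (a m)) -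
      blockprob Q pi f (below (a l)) (cell (scale s N ^+ 4) z) (below (a m))| <=
    T * (scale s N ^+ 4 * rate s N).

Lemma accurate_whp cs : exists T Cb : R, [/\ 0 <= T, 0 <= Cb &
  \forall N \near \oo, forall (d : measure_display) (Omega : measurableType d)
    (P : probability Omega R) (theta : nat -> Omega -> 'I_J) (X : nat -> Omega -> R),
    is_HMM P Q pi f theta X ->
    exists Bad : set Omega, [/\ measurable Bad, (P Bad <= (Cb * (N%:R ^+ 3)^-1)%:E)%E &
      forall w, ~ Bad w -> accurate T cs (obs X w : 'I_N -> R)]].
Proof.
have [K K1 hK] := poisson_solution Qs ps irr ape inv.
have p0 := invariant_gt0 Qs ps irr inv.
pose cp := \sum_i (pi i)^-1.
have hcp i : (pi i)^-1 <= cp.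
  by rewrite /cp (bigD1 i)//= lerDl sumr_ge0// => j _; rewrite invr_ge0 ltW.
have cp0 : 0 <= cp by apply: sumr_ge0 => j _; rewrite invr_ge0 ltW.
pose T0 := 18 * K * F + 72.
have KF : 1 <= K * F by rewrite mulr_ege1.
have T00 : 0 <= T0 by rewrite /T0; lra.
(* The total weight with which frequency errors enter [weighted_est]. *)
pose sc c : R := \sum_(i < J) (test_code R J c).2%:R ^+ i.
have sc0 c : 0 <= sc c by apply: sumr_ge0 => i _; rewrite exprn_ge0.
pose T := T0 * (1 + \sum_(c < cs.+1) sc c).
(* The last component chooses the middle set: [None] stands for the whole line, as in [momentmx],
   and [Some k] for the half-line below the [k]-th threshold. *)
pose I1 := ('I_cs.+1 * ('I_J * 'I_J) * option 'I_J)%type.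
pose Cb := #|{: I1}|%:R * 6 + #|{: 'I_J * 'I_J}|%:R * ((6 + expR 1) * cp).
have sum0 : 0 <= \sum_(c < cs.+1) sc c by apply: sumr_ge0.
have e10 : 0 <= (6 + expR 1) * cp by rewrite mulr_ge0// addr_ge0// expR_ge0.
exists T, Cb; split.
- by rewrite mulr_ge0//; lra.
- by rewrite addr_ge0// mulr_ge0.
have K8 : 0 < (8 * K)^-1 by rewrite invr_gt0; lra.
have F0 : 0 < F by have := F1; lra.
have F8 : 0 < F^-1 by rewrite invr_gt0.
near=> N.
have N3 : (3 <= N)%N by near: N; exact: near_ge_nat.
have N2 : (2 <= N)%N by exact: ltnW.
have L1 : 1 <= ln N%:R :> R by near: N; exact: ln_large.
have eK : scale s N <= (8 * K)^-1 by near: N; exact: scale_small.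
have eF : scale s N <= F^-1 by near: N; exact: scale_small.
have e1 : scale s N <= 1 by near: N; exact: scale_small.
have rK : rate s N <= (8 * K)^-1 by near: N; exact: rate_small.
have r1 : rate s N <= 1 by near: N; exact: rate_small.
move=> d Omega P theta X HMM.
have e0 := scale_gt0 s N2; have r0 := rate_gt0 s0 N2.
have eq := scale_rate s0 N2.
set e := scale s N in eK eF e1 e0 eq *.
set r := rate s N in rK r1 r0 eq *.
set M := (N %/ 3)%N.
have M0 : 0 < M%:R :> R by rewrite ltr0n divn_gt0.
pose B2 (i : I1) : set R := let a := (test_code R J i.1.1).1 in
  if i.2 is Some k then below (a k) else setT.
have mB2 i : measurable (B2 i).
  by rewrite /B2; case: i.2 => [k|//]; exact: measurable_below.
pose A1 (i : I1) := let a := (test_code R J i.1.1).1 in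
  misses Q pi f X M (T0 * (e ^+ 2 * r)) (below (a i.1.2.1)) (B2 i) (below (a i.1.2.2)).
pose a := (test_code R J cs).1.
pose A2 (i : 'I_J * 'I_J) (z : int) := misses Q pi f X M (T0 * (e ^+ 4 * r))
   (below (a i.1)) (cell (e ^+ 4) z) (below (a i.2)).
have n0 : 0 < N%:R :> R by rewrite ltr0n (leq_trans _ N3).
have N1 : 1 <= N%:R :> R by rewrite ler1n (leq_trans _ N3).
have N312 : (N%:R ^+ 12)^-1 <= (N%:R ^+ 3)^-1 :> R.
  by rewrite lef_pV2 ?posrE ?exprn_gt0// ler_weXn2l.
have mA1 i : measurable (A1 i).
  by apply: (measurable_misses HMM) => //; exact: measurable_below.
have PA1 i : (P (A1 i) <= (6 * (N%:R ^+ 3)^-1)%:E)%E.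
  apply: (@le_trans _ _ (6 * (N%:R ^+ 12)^-1)%:E); last by rewrite lee_fin ler_wpM2l.
  (* Mass bound 1 and tilt [e ^+ 2 * r]: the required relation [la^2 N = ln N] is [scale_rate]. *)
  have := @misses_rate _ _ _ P J Q pi f theta X Qs ps df HMM K K1 hK N (e ^+ 2 * r) 1 1 F
     (below ((test_code R J i.1.1).1 i.1.2.1)) (B2 i) (below ((test_code R J i.1.1).1 i.1.2.2)).
  rewrite !mul1r mulr1; apply => //; try exact: measurable_below.
  - by rewrite mulr_gt0// exprn_gt0.
  - rewrite -ler_pdivlMr ?mul1r; last by lra.
    by rewrite (le_trans _ rK)// ler_piMl ?(ltW r0)// exprn_ile1// ltW.
  - by rewrite ler01 lexx.
  - by move=> j; apply: mass_le1.
  - exact: ltW.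
  - by rewrite exprMn -exprM.
have h0 : 0 < e ^+ 4 by rewrite exprn_gt0.
have PA2 i z : measurable (A2 i z) /\ (P (A2 i z) <=
    ((6 + expR 1) * cp * (N%:R ^+ 3)^-1)%:E * P (X 0%N @^-1` cell (e ^+ 4) z))%E.
  split.
    by apply: (measurable_misses HMM); [exact: measurable_below|exact: measurable_cell|exact: measurable_below].
  (* Here the mass bound is [F] times the bandwidth and the tilt is [r], again by [scale_rate]. *)
  apply: (@cell_misses_rate _ _ _ P J Q pi f theta X Qs ps df HMM K K1 hK cp F N (e ^+ 4) r) => //.
  - exact: measurable_below.
  - exact: measurable_below.
  - by rewrite r0.
  - by rewrite -ler_pdivlMr ?mul1r//; lra.
  - rewrite mulrC -ler_pdivlMr ?mul1r; last by lra.
    by rewrite (le_trans _ eF)// exprS ler_piMr ?(ltW e0)// exprn_ile1// ltW.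
  - by move=> j; exact: mass_cell_le.
have mX0 : measurable_fun setT (X 0%N) by case: HMM.
have c3 : 0 <= (6 + expR 1) * cp * (N%:R ^+ 3)^-1 :> R.
  by rewrite mulr_ge0// invr_ge0 exprn_ge0.
have U2 i := cells_union_bound mX0 c3 (fun z => (PA2 i z).1) (fun z => (PA2 i z).2).
have [mU1 PU1] := union_bound mA1 PA1.
have [mU2 PU2] := union_bound (fun i => (U2 i).1) (fun i => (U2 i).2).
exists (\big[setU/set0]_i A1 i `|` \big[setU/set0]_i \bigcup_z A2 i z); split.
- exact: measurableU.
- rewrite (le_trans (measureU2 _ mU1 mU2))// (le_trans (leeD PU1 PU2))//.
  by rewrite -EFinD lee_fin /Cb [leRHS]mulrDl -!mulrA.
move=> w nBad.
have nA1 i : ~ A1 i w.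
  by move=> Aw; apply: nBad; left; rewrite -bigcup_seq; exists i => //=; rewrite mem_index_enum.
have nA2 i z : ~ A2 i z w.
  move=> Aw; apply: nBad; right; rewrite -bigcup_seq.
  by exists i => /=; [rewrite mem_index_enum|exists z].
have fr t B1 B B3 : ~ misses Q pi f X M t B1 B B3 w ->
    `|freq (obs X w : 'I_N -> R) B1 B B3 - blockprob Q pi f B1 B B3| <= t.
  rewrite /misses /= freq_obs -/M => /negP; rewrite -ltNge => hlt.
  have -> : M%:R^-1 * hits X B1 B B3 M w - blockprob Q pi f B1 B B3 =
     M%:R^-1 * (hits X B1 B B3 M w - M%:R * blockprob Q pi f B1 B B3).
    by rewrite mulrBr mulKf// gt_eqF.
  by rewrite normrM gtr0_norm ?invr_gt0// ler_pdivrMl// ltW.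
have er : 0 <= e ^+ 2 * r by rewrite mulr_ge0 ?sqr_ge0// ltW.
have TT : T0 <= T by rewrite ler_peMr// lerDl.
split=> [c ccs|l m z].
  have cs1 : (c < cs.+1)%N by [].
  split=> l m.
    rewrite -momentmxE// mxE distrC.
    apply: (le_trans (fr _ _ _ _ (nA1 (Ordinal cs1, (l, m), None)))).
    by rewrite ler_wpM2r.
  rewrite -weightedmxE// mxE distrC -sumrB (le_trans (ler_norm_sum _ _ _))//.
  apply: (@le_trans _ _ (sc c * (T0 * (e ^+ 2 * r)))).
    rewrite /sc mulr_suml; apply: ler_sum => i _.
    rewrite -mulrBr normrM ger0_norm ?exprn_ge0// ler_wpM2l ?exprn_ge0//.
    exact: (fr _ _ _ _ (nA1 (Ordinal cs1, (l, m), Some i))).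
  rewrite mulrA ler_wpM2r// mulrC ler_wpM2l//.
  rewrite (bigD1 (Ordinal cs1))//= addrCA lerDl addr_ge0// sumr_ge0//.
apply: (le_trans (fr _ _ _ _ (nA2 (l, m) z))).
by rewrite ler_wpM2r// mulr_ge0// ltW.
Unshelve. all: by end_near.
Qed.

End good_event.

(** * Accuracy on the good event *)

Lemma find_iota (p : pred nat) N c : (c < N)%N -> p c ->
  (forall i, (i < c)%N -> ~~ p i) -> find p (iota 0 N) = c.
Proof.
move=> cN pc hp; have hN : (find p (iota 0 N) < N)%N.
  rewrite -[X in (_ < X)%N](size_iota 0 N) -has_find.
  by apply/hasP; exists c => //; rewrite mem_iota.
have pf : p (find p (iota 0 N)).
  have := @nth_find _ 0%N p (iota 0 N); rewrite nth_iota// add0n; apply.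
  by rewrite has_find size_iota.
case: (ltngtP (find p (iota 0 N)) c) => // [lt|gt].
  by have := hp _ lt; rewrite pf.
by have := before_find 0%N gt; rewrite nth_iota// add0n pc.
Qed.

Lemma smooth_lin (R : realType) k (q : 'I_k.+1 -> {poly R}) (I : finType)
    (c : I -> R) (a : I -> int -> R) u :
  smooth q (fun z => \sum_i c i * a i z) u = \sum_i c i * smooth q (a i) u.
Proof.
rewrite /smooth; under [RHS]eq_bigr do rewrite mulr_sumr.
rewrite [RHS]exchange_big /=; apply: eq_bigr => b _.
under [RHS]eq_bigr do rewrite mulrCA.
rewrite -mulr_sumr; congr (_ * _).
under [RHS]eq_bigr do rewrite mulr_sumr.
rewrite [RHS]exchange_big /=; apply: eq_bigr => i _.
by rewrite mulr_sumr; apply: eq_bigr => j _; rewrite mulrCA.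
Qed.

Section accuracy.
Variables (R : realType) (J : nat) (s : R) (Q : 'M[R]_J) (pi : 'I_J -> R).
Variable f : 'I_J -> R -> R.
Hypotheses (s0 : 0 < s) (Qs : stochastic_matrix Q) (Qu : Q \in unitmx).
Hypothesis (p0 : forall i, 0 < pi i).
Hypothesis df : forall j, is_density_lebesgue (f j).
Hypotheses (lf : assumption_A3 f) (hf : assumption_A4 s f).

Lemma exists_separating_code : exists c,
  separates f (test_code R J c).1 (test_code R J c).2.
Proof.
have cf j : continuous (f j) by exact: holder_continuous (hf j).
have [a ha] := exists_test_points df cf lf.
pose v : {ffun 'I_J -> rat} := [ffun l => a l].
have hv : cdfmx f (fun l => ratr (v l)) \in unitmx.
  suff -> : cdfmx f (fun l => ratr (v l)) = \matrix_(j, l) mass (f j) (below (ratr (a l))) by [].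
  by apply/matrixP => j l; rewrite !mxE ffunE.
have [t ht] := separating_combination hv.
by exists (pickle (v, t)); rewrite /test_code pickleK.
Qed.

Variable cs : nat.
Hypothesis cs_sep : separates f (test_code R J cs).1 (test_code R J cs).2.
Hypothesis cs_min : forall c, (c < cs)%N ->
  ~ separates f (test_code R J c).1 (test_code R J c).2.

Let a := (test_code R J cs).1.
Let A := leftmx Q pi f a.
Let D := rightmx Q f a.

(** Each of the finitely many codes below [cs] is rejected for large [N], and [cs] is accepted, so
    the search stops at [cs]; there every feasible choice is accurate. *)
Lemma weight_est_accurate T : 0 <= T -> exists (tau : {perm 'I_J}) (C : R), 0 < C /\
  \forall N \near \oo, forall x : 'I_N -> R, accurate s Q pi f T cs x ->
    selected J s x = cs /\
    forall j l m, `|weight_est s x j l m - spectral_weight A D tau j l m| <= C * rate s N.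
Proof.
move=> T0.
have [tau [C [eps [C0 eps0 hC]]]] := separates_feasible (pi := pi) Qu p0 T0 cs_sep.
exists tau, C; split=> //.
pose rejects (i : 'I_cs) : set nat := [set N | forall x : 'I_N -> R,
  accurate s Q pi f T cs x ->
  forall (mu : 'I_J -> R) (W : 'I_J -> 'M[R]_J), ~ admissible s x i mu W].
have rej i : \forall N \near \oo, rejects i N.
  have [ei ei0 hei] := not_separates_infeasible (pi := pi) Qu p0 T0 (cs_min (ltn_ord i)).
  have ei2 : 0 < ei / 2 by rewrite divr_gt0.
  near=> N => x [hx _] mu W [iN].
  have [h1 h2] := hx i (ltnW (ltn_ord i)).
  have N2 : (2 <= N)%N by near: N; exact: near_ge_nat.
  apply: (hei (scale s N) (rate s N) _ _ _ _ h1 h2).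
    rewrite scale_gt0//=; near: N; exact: scale_small.
  rewrite rate_gt0//=; apply: (@le_lt_trans _ _ (ei / 2)); last by rewrite ltr_pdivrMr// ltr_pMr// ltr1n.
  near: N; exact: rate_small.
have bad := filter_forall _ rej.
have eps2 : 0 < eps / 2 by rewrite divr_gt0.
have epsh : eps / 2 < eps by rewrite ltr_pdivrMr// ltr_pMr// ltr1n.
near=> N => x hx.
have N2 : (2 <= N)%N by near: N; exact: near_ge_nat.
have csN : (cs < N)%N by near: N; exact: near_ge_nat.
have [h1 h2] := hx.1 cs (leqnn cs).
have e1 : 0 < scale s N < eps.
  by rewrite scale_gt0//=; apply: le_lt_trans epsh; near: N; exact: scale_small.
have r1 : 0 < rate s N < eps.
  by rewrite rate_gt0//=; apply: le_lt_trans epsh; near: N; exact: rate_small.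
have [[mu0 [W0 f0]] hW] := hC _ _ _ _ e1 r1 h1 h2.
have sel : selected J s x = cs.
  apply: find_iota => // [|i ics]; first by apply/asboolP; exists mu0, W0; split.
  apply/negP => /asboolP[mu [W]].
  have badN : forall i, rejects i N by near: N; exact: bad.
  exact: (badN (Ordinal ics)).
split=> // j l m.
have [|mu [_ hfe]] := @weight_est_admissible R J s N x mu0 W0.
  by rewrite sel; split.
by apply: (hW mu _ _ j l m); move: hfe; rewrite sel.
Unshelve. all: by end_near.
Qed.

End accuracy.

(** * Uniform error of the density estimator *)

Section risk.
Variables (R : realType) (J : nat) (s : R) (Q : 'M[R]_J) (pi : 'I_J -> R).
Variable f : 'I_J -> R -> R.
Hypotheses (s0 : 0 < s) (Qs : stochastic_matrix Q) (Qu : Q \in unitmx).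
Hypothesis (p0 : forall i, 0 < pi i).
Hypothesis df : forall j, is_density_lebesgue (f j).
Hypothesis hf : assumption_A4 s f.
Variable F : R.
Hypotheses (F1 : 1 <= F) (fF : forall j x, f j x <= F).
Variable cs : nat.
Hypothesis cs_sep : separates f (test_code R J cs).1 (test_code R J cs).2.
Hypothesis cs_min : forall c, (c < cs)%N ->
  ~ separates f (test_code R J c).1 (test_code R J c).2.

Let a := (test_code R J cs).1.
Let A := leftmx Q pi f a.
Let D := rightmx Q f a.
Let S (y : R) : 'M[R]_J := A *m diag_mx (\row_j f j y) *m D.

Lemma scale_powR N : (scale s N ^+ 4) `^ s = rate s N.
Proof. by rewrite (rateE s0) powRrM (powR_mulrn 4 (powR_ge0 _ _)). Qed.

Lemma smooth_est_accurate T : 0 <= T -> exists2 C : R, 0 <= C &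
  \forall N \near \oo, forall x : 'I_N -> R, accurate s Q pi f T cs x ->
    selected J s x = cs -> forall l m y, `|smooth_est s x l m y - S y l m| <= C * rate s N.
Proof.
move=> T0.
have /choice[Cf hCf] : forall j, exists C : R, 0 < C /\ forall h x : R, 0 < h ->
    (Num.truncn s).+2%:R * h <= 1 ->
    `|h^-1 * smooth (@weights R s) (fun z => mass (f j) (cell h z)) (x / h) - f j x| <= C * h `^ s.
  move=> j; have [C C0 hC] := smooth_bias s0 (hf j) (df j) (@weightsP R s).
  by exists C.
pose nA := mxnorm1 A * mxnorm1 D.
pose Cm := \sum_j Cf j.
have Cf0 j : 0 <= Cf j by apply: ltW; exact: (hCf j).1.
have Cm0 : 0 <= Cm by exact: sumr_ge0.
have nA0 : 0 <= nA by rewrite mulr_ge0 ?mxnorm1_ge0.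
have sn0 := smooth_norm_ge0 (@weights R s).
exists (smooth_norm (@weights R s) * T + nA * Cm); first by rewrite addr_ge0// mulr_ge0.
have k0 : 0 < (Num.truncn s).+2%:R^-1 :> R by rewrite invr_gt0.
near=> N => x [_ hx] sel l m y.
have N2 : (2 <= N)%N by near: N; exact: near_ge_nat.
have e1 : scale s N <= 1 by near: N; exact: scale_small.
have ek : scale s N <= (Num.truncn s).+2%:R^-1 by near: N; exact: scale_small.
have e0 := scale_gt0 s N2; have r0 := rate_gt0 s0 N2.
set h := scale s N ^+ 4 in hx *.
have h0 : 0 < h by rewrite exprn_gt0.
have hk : (Num.truncn s).+2%:R * h <= 1.
  rewrite mulrC -ler_pdivlMr// mul1r (le_trans _ ek)// /h exprS ler_piMr ?(ltW e0)//.
  by rewrite exprn_ile1// ltW.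
(* Stochastic error of the cell frequencies plus the biases of the [J] densities, mixed with the
   coefficients of the factorization [blockprobE]. *)
have -> : smooth_est s x l m y - S y l m =
  h^-1 * smooth (@weights R s) (fun z => freq x (below (a l)) (cell h z) (below (a m)) -
     blockprob Q pi f (below (a l)) (cell h z) (below (a m))) (y / h) +
  \sum_j A l j * D j m * (h^-1 * smooth (@weights R s) (fun z => mass (f j) (cell h z)) (y / h)
    - f j y).
  have e2 : S y l m = \sum_j A l j * D j m * f j y.
    by rewrite /S sandwichE; apply: eq_bigr => j _; rewrite mulrAC.
  have e3 : smooth (@weights R s) (fun z => blockprob Q pi f (below (a l)) (cell h z) (below (a m)))
      (y / h) = \sum_j A l j * D j m *
        smooth (@weights R s) (fun z => mass (f j) (cell h z)) (y / h).
    rewrite -smooth_lin; apply: eq_smooth => z; rewrite blockprobE//.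
    by apply: eq_bigr => j _; rewrite mulrAC.
  rewrite smooth_estE sel -/a smoothB mulrBr e2 e3.
  rewrite [X in _ = _ + X](_ : _ = h^-1 * (\sum_j A l j * D j m *
      smooth (@weights R s) (fun z => mass (f j) (cell h z)) (y / h)) -
      \sum_j A l j * D j m * f j y); last first.
    rewrite mulr_sumr -sumrB; apply: eq_bigr => j _.
    by rewrite mulrBr [h^-1 * (_ * _)]mulrCA.
  by rewrite addrA subrK.
rewrite (le_trans (ler_normD _ _))// mulrDl lerD//.
  rewrite normrM gtr0_norm ?invr_gt0// mulrC ler_pdivrMr//.
  have -> : smooth_norm (@weights R s) * T * rate s N * h =
     smooth_norm (@weights R s) * (T * (h * rate s N)) by ring.
  by apply: smooth_bound => n _; exact: hx.
rewrite (le_trans (ler_norm_sum _ _ _))//.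
have -> : nA * Cm * rate s N = \sum_j nA * (Cf j * rate s N).
  by rewrite /Cm -mulr_sumr -mulr_suml mulrA.
apply: ler_sum => j _; rewrite normrM ler_pM//.
  by rewrite normrM ler_pM// entry_le_mxnorm1.
by rewrite -scale_powR; exact: (hCf j).2.
Unshelve. all: by end_near.
Qed.

Lemma density_est_accurate T : 0 <= T -> exists (tau : {perm 'I_J}) (C : R), 0 <= C /\
  \forall N \near \oo, forall x : 'I_N -> R, accurate s Q pi f T cs x ->
    forall j y, `|density_est s x j y - f (tau j) y| <= C * rate s N.
Proof.
move=> T0.
have [tau [C1 [C10 hW]]] := weight_est_accurate s0 Qu p0 cs_sep cs_min T0.
have [C2 C20 hS] := smooth_est_accurate T0.
pose w := spectral_weight A D tau.
pose nw := \sum_j mxnorm1 (w j).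
pose nS := mxnorm1 A * mxnorm1 D * F.
have nw0 : 0 <= nw by apply: sumr_ge0 => j _; exact: mxnorm1_ge0.
have F0 : 0 <= F by have := F1; lra.
have nS0 : 0 <= nS by rewrite mulr_ge0// mulr_ge0 ?mxnorm1_ge0.
have wb j l m : `|w j l m| <= nw.
  rewrite (le_trans (entry_le_mxnorm1 _ _ _))// /nw (bigD1 j)//= lerDl.
  by apply: sumr_ge0 => i _; exact: mxnorm1_ge0.
have Sb y l m : `|S y l m| <= nS.
  apply: conj_entry_le => i j; rewrite !mxE.
  case: eqP => _; rewrite ?mulr1n ?mulr0n ?normr0//.
  by rewrite ger0_norm//; case: (df i).
pose C := J%:R ^+ 2 * ((nw + C1) * C2 + C1 * nS).
exists tau, C; split.
  rewrite /C mulr_ge0 ?sqr_ge0// addr_ge0// mulr_ge0 ?addr_ge0// ltW//.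
near=> N => x hx j y.
have N2 : (2 <= N)%N by near: N; exact: near_ge_nat.
have r0 := rate_gt0 s0 N2.
have r1 : rate s N <= 1 by near: N; exact: rate_small.
have [sel hw] : selected J s x = cs /\
    forall j l m, `|weight_est s x j l m - w j l m| <= C1 * rate s N.
  by move: x hx; near: N.
have hs : forall l m y, `|smooth_est s x l m y - S y l m| <= C2 * rate s N.
  by move: sel; move: x hx {hw}; near: N.
have Ou := cs_sep.1.
(* Expresses [f (tau j) y] by the exact weights and [S y], which reduces the error to differences of
   products. *)
rewrite -(spectral_weight_trace tau (leftmx_unit Qu p0 Ou) (rightmx_unit Qu Ou) (f ^~ y) j).
rewrite /density_est -sumrB.
have term l m : `|weight_est s x j m l * smooth_est s x l m y - w j m l * S y l m| <=
    ((nw + C1) * C2 + C1 * nS) * rate s N.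
  have -> : weight_est s x j m l * smooth_est s x l m y - w j m l * S y l m =
    weight_est s x j m l * (smooth_est s x l m y - S y l m) +
    (weight_est s x j m l - w j m l) * S y l m by ring.
  rewrite (le_trans (ler_normD _ _))// !normrM.
  have W1 : `|weight_est s x j m l| <= nw + C1.
    rewrite -[weight_est s x j m l](subrK (w j m l)) (le_trans (ler_normD _ _))// addrC.
    by rewrite lerD// (le_trans (hw _ _ _))// ler_piMr// ltW.
  have t1 : `|weight_est s x j m l| * `|smooth_est s x l m y - S y l m| <=
      (nw + C1) * (C2 * rate s N) by rewrite ler_pM.
  have t2 : `|weight_est s x j m l - w j m l| * `|S y l m| <= C1 * rate s N * nS.
    by rewrite ler_pM.
  by rewrite (le_trans (lerD t1 t2))//; lra.
rewrite /C -mulrA expr2 -mulrA (le_trans (ler_norm_sum _ _ _))//.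
rewrite mulr_natl -[X in _ *+ X]card_ord -sumr_const; apply: ler_sum => l _.
rewrite -sumrB (le_trans (ler_norm_sum _ _ _))//.
by rewrite mulr_natl -[X in _ *+ X]card_ord -sumr_const; apply: ler_sum => m _; exact: term.
Unshelve. all: by end_near.
Qed.

End risk.

(** * From the good event to probability and expectation *)

Lemma supnorm_le (R : realType) (g : R -> R) (c : R) :
  (forall y, `|g y| <= c) -> (supnorm g <= c%:E)%E.
Proof. by move=> gc; apply: ge_ereal_sup => _ [y _ <-]; rewrite lee_fin. Qed.

Lemma supnorm_ge0 (R : realType) (g : R -> R) : (0 <= supnorm g)%E.
Proof.
apply: (@le_trans _ _ (`|g 0|)%:E); first by rewrite lee_fin.
by apply: ereal_sup_ubound; exists 0.
Qed.

Lemma integral_le_off_event (R : realType) (d : measure_display) (T : measurableType d)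
    (P : probability T R) (g : T -> \bar R) (A : set T) (c b x : R) :
  measurable_fun setT g -> (forall w, 0 <= g w)%E -> measurable A -> 0 <= c -> 0 <= b ->
  (forall w, ~ A w -> g w <= c%:E)%E -> (forall w, g w <= b%:E)%E ->
  (P A <= x%:E)%E -> (\int[P]_w g w <= (c + b * x)%:E)%E.
Proof.
move=> mg g0 mA c0 b0 gc gb PA.
apply: (@le_trans _ _ (\int[P]_w (c%:E + b%:E * (\1_A w)%:E))%E).
  apply: ge0_le_integral => //.
  - apply: emeasurable_funD => //; apply: emeasurable_funM => //.
    by apply/measurable_EFinP; exact: measurable_indic.
  move=> w _; rewrite indicE; have [wA|wA] := boolP (w \in A).
    by rewrite mule1 (le_trans (gb w))// leeDr// lee_fin.
  by rewrite mule0 adde0 gc//; move: wA; rewrite notin_setE.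
rewrite ge0_integralD//; last 2 first.
- by move=> w _; rewrite -EFinM lee_fin mulr_ge0.
- apply: emeasurable_funM => //.
  by apply/measurable_EFinP; exact: measurable_indic.
rewrite integral_cst// ge0_integralZl//; last first.
- by apply/measurable_EFinP; exact: measurable_indic.
rewrite integral_indic// setIT EFinD EFinM; apply: leeD; last exact: lee_wpmul2l.
by rewrite -[leRHS]mule1; apply: lee_wpmul2l => //; exact: probability_le1.
Qed.

Unset Implicit Arguments.
Set Strict Implicit.

Theorem theorem5 (R : realType) (J : nat) (s : R) (L0 : nat -> R) :
  (2 <= J)%N -> 0 < s ->
  L0 @ \oo --> +oo ->
  (fun N => L0 N `^ Num.max 5 ((J%:R + 3) / 2) * rate s N) @ \oo --> (0 : R) ->
  exists est : forall N : nat, ('I_N -> R) -> 'I_J -> R -> R,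
    (forall N x j, continuous (est N x j)) /\
    forall (Q : 'M[R]_J) (pi : 'I_J -> R) (f : 'I_J -> R -> R),
      stochastic_matrix Q -> prob_vector pi -> (forall j, is_density_lebesgue (f j)) ->
      assumption_A2' Q pi -> assumption_A3 f -> assumption_A4 s f ->
      exists (tau : {perm 'I_J}) (C C' : R), 0 < C /\ 0 < C' /\
      forall (d : measure_display) (Omega : measurableType d)
             (P : probability Omega R)
             (theta : nat -> Omega -> 'I_J) (X : nat -> Omega -> R),
        is_HMM P Q pi f theta X ->
        forall j : 'I_J,
          let err : nat -> Omega -> \bar R := fun (N : nat) (w : Omega) =>
            supnorm (fun y => est N (fun k : 'I_N => X (nat_of_ord k) w) j y
                              - f (tau j) y) in
          (forall N, measurable_fun [set: Omega] (err N)) /\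
          (fun N => P [set w | ((C * L0 N ^+ 5 * rate s N)%:E <= err N w)%E])
            @ \oo --> (0 : \bar R) /\
          \forall N \near \oo,
            (\int[P]_w err N w <= (C' * L0 N ^+ 5 * rate s N)%:E)%E.
Proof.
move=> _ s0 L0y _.
exists (fun N => @density_est R J s N); split.
  by move=> N x j; exact: continuous_density_est.
move=> Q pi f Qs ps df [rkQ irr ape inv] lf hf.
have Qu : Q \in unitmx by rewrite -row_free_unit /row_free rkQ.
have p0 := invariant_gt0 Qs ps irr inv.
have [F F1 fF] : exists2 F : R, 1 <= F & forall j x, f j x <= F.
  have /choice[Fj hFj] : forall j, exists F : R, 1 <= F /\ forall x, f j x <= F.
    move=> j; have [F F1 fF] := holder_density_bounded s0 (hf j) (df j) (@weightsP R s).
    by exists F.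
  have Fj0 j : 0 <= Fj j by apply: le_trans (hFj j).1.
  exists (1 + \sum_j Fj j) => [|j x]; first by rewrite lerDl sumr_ge0.
  rewrite (le_trans ((hFj j).2 x))// (bigD1 j)//= addrCA lerDl.
  by rewrite addr_ge0// sumr_ge0.
pose sep c := `[< separates f (test_code R J c).1 (test_code R J c).2 >].
have exc : exists c, sep c.
  by have [c hc] := exists_separating_code df lf hf; exists c; apply/asboolP.
(* [cs] depends on the unknown parameters; on the good event the search in the estimator finds
   it. *)
have [cs /asboolP cs_sep cs_min'] := ex_minnP exc.
have cs_min c : (c < cs)%N -> ~ separates f (test_code R J c).1 (test_code R J c).2.
  by move=> ccs /asboolP /cs_min'; rewrite leqNgt ccs.
have [T [Cb [T0 Cb0 whp]]] := accurate_whp s0 Qs ps df irr ape inv F1 fF cs.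
have [tau [Ca [Ca0 acc]]] := density_est_accurate s0 Qs Qu p0 df hf F1 fF cs_sep cs_min T0.
pose nK := J%:R ^+ 2 * smooth_norm (@weights R s) + F.
have F0 : 0 <= F by lra.
have nK0 : 0 <= nK by rewrite addr_ge0// mulr_ge0 ?sqr_ge0 ?smooth_norm_ge0.
(* The first added 1 makes [C * L0 N ^+ 5 * rate] exceed [Ca * rate] strictly, so a large error
   forces [Bad]; [nK * Cb] is the share of [Bad] in the expectation. *)
exists tau, (Ca + 1), (Ca + nK * Cb + 1).
split; first by lra.
split; first by rewrite ltr_wpDl// addr_ge0// mulr_ge0.
move=> d Omega P theta X HMM j err.
have merr N : measurable_fun [set: Omega] (err N).
  exact: (measurable_err HMM s N j (f (tau j))).
have L5 : \forall N \near \oo, 1 <= L0 N ^+ 5.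
  have : \forall N \near \oo, 1 <= L0 N.
    by move/cvgryPge: L0y; apply.
  by apply: filterS => N; exact: exprn_ege1.
have key : \forall N \near \oo, [/\ (3 <= N)%N, 1 <= L0 N ^+ 5 &
    exists Bad : set Omega, [/\ measurable Bad,
    (P Bad <= (Cb * (N%:R ^+ 3)^-1)%:E)%E &
    forall w, ~ Bad w -> (err N w <= (Ca * rate s N)%:E)%E]].
  near=> N; split; [by near: N; exact: near_ge_nat|by near: N|].
  have whpN : forall (d : measure_display) (Omega : measurableType d)
    (P : probability Omega R) (theta : nat -> Omega -> 'I_J) (X : nat -> Omega -> R),
    is_HMM P Q pi f theta X ->
    exists Bad : set Omega, [/\ measurable Bad, (P Bad <= (Cb * (N%:R ^+ 3)^-1)%:E)%E &
      forall w, ~ Bad w -> accurate s Q pi f T cs (obs X w : 'I_N -> R)].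
    by near: N.
  have [Bad [mB PB hB]] := whpN _ _ _ _ _ HMM.
  exists Bad; split=> // w /hB aw; apply: supnorm_le => y.
  have accN : forall x : 'I_N -> R, accurate s Q pi f T cs x ->
    forall j y, `|density_est s x j y - f (tau j) y| <= Ca * rate s N by near: N.
  exact: accN.
split=> //; split.
- apply: (@squeeze_cvge _ _ _ _ (cst 0%E) _ (fun N => (2 * Cb * harmonic N)%:E)).
  + near=> N; have [N3 L1 [Bad [mB PB hB]]] : [/\ (3 <= N)%N, 1 <= L0 N ^+ 5 &
      exists Bad : set Omega, [/\ measurable Bad,
      (P Bad <= (Cb * (N%:R ^+ 3)^-1)%:E)%E &
      forall w, ~ Bad w -> (err N w <= (Ca * rate s N)%:E)%E]] by near: N.
    rewrite measure_ge0/=.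
    have r0 : 0 < rate s N by apply: rate_gt0 => //; exact: ltnW.
    apply: (@le_trans _ _ (P Bad)).
      apply: le_measure; rewrite ?inE//.
        by rewrite -[X in measurable X]setTI; exact: emeasurable_fun_c_infty.
      move=> w /= hw; apply: contrapT => /hB; apply/negP; rewrite -ltNge.
      apply: lt_le_trans hw; rewrite lte_fin ltr_pM2r//.
      by rewrite (lt_le_trans _ (ler_peMr _ L1))//; lra.
    have N0 : 0 < N%:R :> R by rewrite ltr0n; exact: leq_trans N3.
    have N1 : 1 <= N%:R :> R by rewrite ler1n; exact: leq_trans N3.
    (* [harmonic N] is [1 / (N + 1)], hence the factor 2. *)
    have hN : (N%:R ^+ 3)^-1 <= 2 * harmonic N :> R.
      rewrite /harmonic -div1r ler_pdivrMr ?exprn_gt0// mulrAC ler_pdivlMr ?ltr0n// mul1r -natr1.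
      by have := @ler_eXnr _ N%:R 3 isT N1; lra.
    apply: (le_trans PB); rewrite lee_fin -[2 * Cb]mulrC -mulrA; exact: ler_wpM2l.
  + exact: cvg_cst.
  + apply: cvg_EFin; first by near=> N.
    rewrite -[X in _ --> X](mulr0 (2 * Cb)).
    by apply: cvgM; [exact: cvg_cst|exact: cvg_harmonic].
- near=> N; have [N3 L1 [Bad [mB PB hB]]] : [/\ (3 <= N)%N, 1 <= L0 N ^+ 5 &
      exists Bad : set Omega, [/\ measurable Bad,
      (P Bad <= (Cb * (N%:R ^+ 3)^-1)%:E)%E &
      forall w, ~ Bad w -> (err N w <= (Ca * rate s N)%:E)%E]] by near: N.
  have N2 : (2 <= N)%N by exact: ltnW.
  have r0 : 0 < rate s N by exact: rate_gt0.
  have e0 : 0 < scale s N by exact: scale_gt0.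
  have r1 : rate s N <= 1 by near: N; exact: rate_small.
  have e1 : scale s N <= 1 by near: N; exact: scale_small.
  have l1 : 1 <= ln N%:R :> R by near: N; exact: ln_large.
  have N0 : 0 < N%:R :> R by rewrite ltr0n; exact: leq_trans N3.
  have eN := scale_rate s0 N2.
  have b0 : 0 <= nK * N%:R ^+ 2 by rewrite mulr_ge0// exprn_ge0.
  (* Both [e^-1] and [h^-1] are at most [N], because [N h >= N h r^2 = ln N >= 1]; their product in
     [density_est_bound] gives [N ^+ 2]. *)
  have errb w : (err N w <= (nK * N%:R ^+ 2)%:E)%E.
    apply: supnorm_le => y; rewrite (le_trans (ler_normB _ _))//.
    have e4N : 1 <= N%:R * scale s N ^+ 4.
      apply: (le_trans l1); rewrite -eN mulrC ler_wpM2l// ler_piMr ?exprn_ge0 ?(ltW e0)//.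
      by rewrite exprn_ile1// ltW.
    have e1N : (scale s N)^-1 <= N%:R.
      rewrite -div1r ler_pdivrMr// (le_trans e4N)// ler_wpM2l// exprS ler_piMr ?(ltW e0)//.
      by rewrite exprn_ile1// ltW.
    have e4N' : (scale s N ^+ 4)^-1 <= N%:R by rewrite -div1r ler_pdivrMr ?exprn_gt0.
    have sn0 := smooth_norm_ge0 (@weights R s).
    have b1 : `|density_est s (fun k : 'I_N => X k w) j y| <=
        J%:R ^+ 2 * smooth_norm (@weights R s) * N%:R ^+ 2.
      apply: (le_trans (density_est_bound _ _ _ e0)); rewrite -mulrA ler_wpM2l ?sqr_ge0//.
      rewrite mulrA mulrC ler_wpM2l// expr2 ler_pM ?invr_ge0 ?exprn_ge0 ?(ltW e0)//.
    have b2 : `|f (tau j) y| <= F * N%:R ^+ 2.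
      rewrite ger0_norm; last by case: (df (tau j)).
      by rewrite (le_trans (fF _ _))// ler_peMr// exprn_ege1// ler1n; exact: leq_trans N3.
    by rewrite /nK mulrDl lerD.
  have Cr0 : 0 <= Ca * rate s N by rewrite mulr_ge0// ltW.
  have := integral_le_off_event (merr N) (fun w => supnorm_ge0 _) mB Cr0 b0 hB errb PB.
  move=> /le_trans; apply; rewrite lee_fin.
  (* [N r >= N h r^2 = ln N >= 1], so the share [N^2 * N^-3] of the exceptional event is of order
     [rate]. *)
  have rN : N%:R^-1 <= rate s N.
    rewrite -div1r ler_pdivrMr// (le_trans l1)// -eN ler_wpM2r//.
    rewrite (@le_trans _ _ (rate s N ^+ 2))//.
      by rewrite ler_piMl ?exprn_ge0 ?(ltW r0)// exprn_ile1// ltW.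
    by rewrite expr2 ler_piMr// ltW.
  have -> : nK * N%:R ^+ 2 * (Cb * (N%:R ^+ 3)^-1) = nK * Cb * N%:R^-1.
    by field; rewrite gt_eqF.
  have t1 : nK * Cb * N%:R^-1 <= nK * Cb * rate s N by rewrite ler_wpM2l// mulr_ge0.
  apply: (@le_trans _ _ ((Ca + nK * Cb + 1) * rate s N)); first by lra.
  rewrite ler_wpM2r ?(ltW r0)// ler_peMr// !addr_ge0//; exact: mulr_ge0.
Unshelve. all: by end_near.
Qed.
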